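(* There is a bijection $\phi$ from the set of all two-stack sortable permutations (of all lengths $n\ge 1$) to the set of all fighting fish with the following property. Let $\pi$ be a two-stack sortable permutation of length $n$, with $i$ ascents and $j$ descents, and suppose that $\mathcal{S}(\pi)$ has $k$ left-to-right maxima and that there are $\ell$ elements $a$ such that $a$ precedes $a-1$ in $\mathcal{S}(\pi)$. Then $\phi(\pi)$ is a fighting fish with $n+1$ lower free edges, of which $i+1$ are left lower free edges and $j+1$ are right lower free edges, whose fin has length $k+1$, and which has $\ell+1$ tails.
   Context: Stack-sorting operator: for a finite sequence $A$ of distinct integers, define $\mathcal{S}(\epsilon)=\epsilon$ for the empty sequence, and if $A$ is non-empty with largest element $m$, write $A=A_L\cdot(m)\cdot A_R$ (concatenation, $A_L$ the part before $m$, $A_R$ the part after) and set $\mathcal{S}(A)=\mathcal{S}(A_L)\cdot\mathcal{S}(A_R)\cdot(m)$. A permutation $\sigma\in\mathfrak{S}_n$ ($n\ge1$), viewed as the sequence $(\sigma(1),\dots,\sigma(n))$, is two-stack sortable if $\mathcal{S}(\mathcal{S}(\sigma))$ is the identity permutation; the empty permutation is not counted as two-stack sortable. An ascent (resp. descent) of $\sigma$ is an index $i$ with $\sigma(i)<\sigma(i+1)$ (resp. $\sigma(i)>\sigma(i+1)$). A left-to-right maximum of a sequence $(b_1,\dots,b_n)$ is an index $i$ with $b_i>b_j$ for all $j<i$. Fighting fish: a cell is a unit square rotated by 45 degrees, so it has an upper-left, lower-left, upper-right and lower-right edge, and a left and a right vertex. Cells are glued along edges; an edge is free if it belongs to only one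 cell. A fighting fish is any object obtained by starting from a single cell (the head) and repeatedly adding a new cell in one of three ways: (a) glue the new cell's lower-left edge to a free upper-right edge of an existing cell; (b) glue the new cell's upper-left edge to a free lower-right edge of an existing cell; (c) if a cell $a$ has cells $b$ and $c$ glued to its upper-right and lower-right edges respectively, and $b$ has a free lower-right edge and $c$ has a free upper-right edge, glue the new cell simultaneously to both (its upper-left edge to the lower-right edge of $b$, its lower-left edge to the upper-right edge of $c$). Fighting fish are considered as glued surfaces up to isomorphism (cells may overlap when drawn in the plane). A lower free edge is a free edge that is the lower-left or lower-right edge of its cell; it is called left in the first case and right in the second. A tail is the right vertex of a cell both of whose right edges are free. The nose is the left vertex of the head. The fin is the path from the nose to the first tail met when following the free edges (the boundary) counter-clockwise; its length (fin-length) is its number of edges. *)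

(* Defs.v *)
From mathcomp Require Import all_boot.
Set Implicit Arguments. Unset Strict Implicit. Unset Printing Implicit Defensive.

(* S with fuel; S(A) = S(A_L) ++ S(A_R) ++ [m], m = max of A.
   Fuel size s is always sufficient since the pieces strictly shrink. *)
Fixpoint stack_sort_fuel (k : nat) (s : seq nat) : seq nat :=
  match k with
  | 0 => [::]
  | k'.+1 =>
    if s is [::] then [::] else
    let m := foldr maxn 0 s in
    let i := index m s in
    stack_sort_fuel k' (take i s) ++ stack_sort_fuel k' (drop i.+1 s) ++ [:: m]
  end.

Definition stack_sort (s : seq nat) : seq nat := stack_sort_fuel (size s) s.

Definition is_perm_seq (s : seq nat) : bool := perm_eq s (iota 1 (size s)).

Definition two_stack_sortable (s : seq nat) : bool :=
  [&& 0 < size s, is_perm_seq s & stack_sort (stack_sort s) == iota 1 (size s)].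

Definition TSS := {s : seq nat | two_stack_sortable s}.

Definition ascents (s : seq nat) : nat :=
  count (fun i => nth 0 s i < nth 0 s i.+1) (iota 0 (size s).-1).
Definition descents (s : seq nat) : nat :=
  count (fun i => nth 0 s i > nth 0 s i.+1) (iota 0 (size s).-1).

Definition ltr_maxima (s : seq nat) : nat :=
  count (fun i => all (fun j => nth 0 s j < nth 0 s i) (iota 0 i)) (iota 0 (size s)).

Definition precedes_pred_count (s : seq nat) : nat :=
  count (fun a => (a - 1 \in s) && (index a s < index (a - 1) s)) s.

(* A fish is encoded by its finite set of cells 'I_fsize, its head, and
   the two kinds of gluings that occur:
   fur a = Some b : the upper-right edge of a is glued to the lower-left edge of b;
   fdr a = Some c : the lower-right edge of a is glued to the upper-left edge of c. *)
Record FishData := MkFish {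
  fsize : nat;
  fur : 'I_fsize -> option 'I_fsize;
  fdr : 'I_fsize -> option 'I_fsize;
  fhead : 'I_fsize }.
Arguments fur : clear implicits.
Arguments fdr : clear implicits.
Arguments fhead : clear implicits.

Definition liftc n (x : 'I_n) : 'I_n.+1 := widen_ord (leqnSn n) x.

Definition ext n (g : 'I_n -> option 'I_n) : 'I_n.+1 -> option 'I_n.+1 :=
  fun y => match unlift ord_max y with
           | Some y' => omap (@liftc n) (g y')
           | None => None
           end.

Definition ext_set n (g : 'I_n -> option 'I_n) (x : 'I_n) : 'I_n.+1 -> option 'I_n.+1 :=
  fun y => if y == liftc x then Some ord_max else ext g y.

Inductive fish_gen : FishData -> Prop :=
| fg_head : fish_gen (@MkFish 1 (fun _ => None) (fun _ => None) ord0)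
| fg_a (F : FishData) (x : 'I_(fsize F)) :
    fish_gen F -> fur F x = None ->
    fish_gen (@MkFish (fsize F).+1 (ext_set (fur F) x) (ext (fdr F)) (liftc (fhead F)))
| fg_b (F : FishData) (x : 'I_(fsize F)) :
    fish_gen F -> fdr F x = None ->
    fish_gen (@MkFish (fsize F).+1 (ext (fur F)) (ext_set (fdr F) x) (liftc (fhead F)))
| fg_c (F : FishData) (a b c : 'I_(fsize F)) :
    fish_gen F -> fur F a = Some b -> fdr F a = Some c ->
    fdr F b = None -> fur F c = None ->
    fish_gen (@MkFish (fsize F).+1 (ext_set (fur F) c) (ext_set (fdr F) b) (liftc (fhead F))).

Definition fish_iso (F G : FishData) : Prop :=
  exists f : 'I_(fsize F) -> 'I_(fsize G),
    [/\ bijective f, f (fhead F) = fhead G,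
        forall x, fur G (f x) = omap f (fur F x)
      & forall x, fdr G (f x) = omap f (fdr F x)].

Definition fighting_fish (F : FishData) : Prop :=
  exists G, fish_gen G /\ fish_iso G F.

Definition left_lower_free (F : FishData) : nat :=
  #|[pred c : 'I_(fsize F) | ~~ [exists a, fur F a == Some c]]|.
Definition right_lower_free (F : FishData) : nat :=
  #|[pred c : 'I_(fsize F) | fdr F c == None]|.
Definition lower_free (F : FishData) : nat := left_lower_free F + right_lower_free F.

Definition tails (F : FishData) : nat :=
  #|[pred c : 'I_(fsize F) | (fur F c == None) && (fdr F c == None)]|.

(* Boundary walk. Edges of a cell, oriented counterclockwise:
   LL : left -> bottom, LR : bottom -> right, UR : right -> top, UL : top -> left. *)
Inductive ekind := LL | LR | UR | UL.

Definition nextk (k : ekind) : ekind :=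
  match k with LL => LR | LR => UR | UR => UL | UL => LL end.

Definition glued (F : FishData) (e : 'I_(fsize F) * ekind) : option ('I_(fsize F) * ekind) :=
  let: (c, k) := e in
  match k with
  | LR => omap (fun d => (d, UL)) (fdr F c)
  | UR => omap (fun b => (b, LL)) (fur F c)
  | LL => omap (fun a => (a, UR)) [pick a | fur F a == Some c]
  | UL => omap (fun a => (a, LR)) [pick a | fdr F a == Some c]
  end.

(* starting from edge e (which starts at the current vertex), rotate around
   the vertex until a free edge is found: this is the next boundary edge *)
Fixpoint outgoing (F : FishData) (fuel : nat) (e : 'I_(fsize F) * ekind)
  : 'I_(fsize F) * ekind :=
  match fuel with
  | 0 => e
  | fuel'.+1 =>
    match glued e with
    | None => e
    | Some (c', k') => outgoing fuel' (c', nextk k')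
    end
  end.

Definition bsucc (F : FishData) (e : 'I_(fsize F) * ekind) : 'I_(fsize F) * ekind :=
  outgoing (4 * fsize F) (e.1, nextk e.2).

(* first boundary edge starting at the nose (left vertex of the head) *)
Definition fin_start (F : FishData) : 'I_(fsize F) * ekind :=
  outgoing (4 * fsize F) (fhead F, LL).

Definition ends_at_tail (F : FishData) (e : 'I_(fsize F) * ekind) : bool :=
  match e.2 with
  | LR => (fur F e.1 == None) && (fdr F e.1 == None)
  | _ => false
  end.

(* the fin (path from the nose to the first tail met ccw) has m edges *)
Definition fin_length (F : FishData) (m : nat) : Prop :=
  [/\ 0 < m, ends_at_tail (iter m.-1 (@bsucc F) (fin_start F))
    & forall i, i < m.-1 -> ~~ ends_at_tail (iter i (@bsucc F) (fin_start F))].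

(* Main.v *)
(* A fish is determined by its boundary word, read counterclockwise from the nose
   with letters E = LL, N = LR, W = UR, S = UL: fighting fish correspond to the words
   derived from ENWS by W -> NWS, N -> ENW and WN -> NW (one rule per way of gluing a
   cell), because a tail that is not the head can always be taken as the last glued
   cell.

   Removing the final S, such a word factors uniquely as f y h, where f is a nonempty
   prefix of the fin of f h, and where y S and f h are again fish words, except that
   f h may be EW, and that y may be N if f is the whole fin. Existence follows the
   derivation; uniqueness holds because fish words have no proper balanced factor. So
   fish are trees with nodes (j, l, r), where |f| = j + 1, y comes from l and f h from r.

   Two-stack sortable permutations satisfy the same recursion: writing p = L n R with L
   nonempty, the sequence S(L) S(R) n avoids 231 exactly when S(L) = a m and S(R) = b b'
   avoid it and a < b < m < b'. Since the left-to-right maxima of a 231-avoiding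
   sequence start its direct summands, such a splitting of S(R) amounts to the choice of
   the number j of left-to-right maxima of b'. *)
From HB Require Import structures.
From Stdlib Require Import IndefiniteDescription.
Require Import Defs.
From mathcomp Require Import all_boot zify.
Set Implicit Arguments. Unset Strict Implicit. Unset Printing Implicit Defensive.

(** * Boundary words *)

(** Two difficulties shape the proof. A fish may overlap itself and can be glued in many orders, so
    neither plane coordinates nor gluing histories identify its cells. A cell is therefore named by
    a term built from the names of its lower-left and upper-left neighbours. Such names do not
    depend on the gluing order and are preserved by isomorphisms, so comparing fish means comparing
    sets of names. Secondly, the factor [y] has one [N] too many to be balanced. Deleting the last
    edge of the fin, which lies in [y], makes it balanced, and only then do balanced factors decide
    uniqueness.

    The ranges of [j] agree on both sides. If [S(R)] has k left-to-right maxima, then [b'] has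
    between 0 and k of them, while the fin of [f h] has k+1 edges and nonempty prefixes of lengths 1
    to k+1. An empty [L] leaves no choice, just as [y = N] forces [f] to be the whole fin. The nodes
    with j < k are those that create an additional tail on one side and an additional element
    preceding its predecessor in value on the other. *)

Lemma cat_eq_cat T (a b c d : seq T) : a ++ b = c ++ d ->
  (exists e, a = c ++ e /\ d = e ++ b) \/ (exists e, c = a ++ e /\ b = e ++ d).
Proof.
elim: a c => [|x a IH] [|y c] //=.
- by move=> ->; left; exists [::].
- by move=> ->; right; exists (y :: c).
- by move=> <-; left; exists (x :: a).
move=> [-> /IH [[e [-> ->]]|[e [-> ->]]]]; [left|right]; by exists e.
Qed.

Lemma mem_split (T : eqType) (x : T) s : x \in s -> exists p q, s = p ++ x :: q.
Proof. by case/splitPr=> p q; exists p, q. Qed.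

Lemma cat_eq_cat_strict (T : eqType) (a b c d : seq T) : a ++ b = c ++ d ->
  (exists e, c = a ++ e /\ b = e ++ d) \/
  (exists e, e != [::] /\ a = c ++ e /\ d = e ++ b).
Proof.
move/cat_eq_cat=> [[[|x e] [-> ->]]|[e [-> ->]]].
- by left; exists [::]; rewrite !cats0.
- by right; exists (x :: e).
- by left; exists e.
Qed.

Definition ekind_code (k : ekind) : nat :=
  match k with LL => 0 | LR => 1 | UR => 2 | UL => 3 end.
Definition ekind_decode (n : nat) : ekind :=
  match n with 0 => LL | 1 => LR | 2 => UR | _ => UL end.
Lemma ekind_codeK : cancel ekind_code ekind_decode. Proof. by case. Qed.
HB.instance Definition _ := Equality.copy ekind (can_type ekind_codeK).

Inductive fishword : seq ekind -> Prop :=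
| fw_head : fishword [:: LL; LR; UR; UL]
| fw_a p q : fishword (p ++ UR :: q) -> fishword (p ++ [:: LR, UR, UL & q])
| fw_b p q : fishword (p ++ LR :: q) -> fishword (p ++ [:: LL, LR, UR & q])
| fw_c p q : fishword (p ++ [:: UR, LR & q]) -> fishword (p ++ [:: LR, UR & q]).

Lemma fishword_ends w d : fishword w -> head d w = LL /\ last d w = UL.
Proof.
elim=> [|p q _ [h l]|p q _ [h l]|p q _ [h l]] //; rewrite !last_cat /= in l *.
- by case: (p) h => [|x p'] //= ->; split=> //; case: (q) l.
- by case: (p) h => [|x p'] //= ->; split=> //; case: (q) l.
- by case: (p) h => [|x p'] //= ->; split=> //; case: (q) l.
Qed.

Lemma fishword_neq0 p x q : fishword (p ++ x :: q) -> x != LL -> p != [::].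
Proof. by move=> /(fishword_ends LL) []; case: p => //= ->; rewrite eqxx. Qed.

Lemma fishword_lastE p x q : fishword (p ++ x :: q) -> x != UL ->
  exists q', q = rcons q' UL.
Proof.
move=> /(fishword_ends LL) [_]; rewrite last_cat /=; case/lastP: q => [|q z] /=.
  by move=> ->.
by rewrite last_rcons => -> _; exists q.
Qed.

Definition lower (f : seq ekind) : bool := all (mem [:: LL; LR]) f.

(** Half of the composition of two fish: [fishword_glue] then puts any [y] in the place of the new
    [N]. A rule applied inside [h] commutes with the insertion, so only cuts at or inside the
    rewritten letters need a new derivation. *)
Lemma fishword_strip w f h : fishword w -> w = f ++ h -> lower f -> f != [::] ->
  fishword (f ++ LR :: rcons h UL).
Proof.
move=> Hw; elim: Hw f h => [|p q Hp IH|p q Hp IH|p q Hp IH] f h.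
- have H2 : fishword [:: LL; LR; LR; UR; UL; UL].
    by apply: (@fw_a [:: LL; LR] [:: UL]); apply: fw_head.
  by case: f => [|a [|b [|c f]]] //=; [case=> <- <-|case=> <- <- <-|case=> <- <- <- _].
- have p0 := fishword_neq0 Hp isT.
  move=> /cat_eq_cat [[e [Ep Eh]]|[e [Ef Eq]]] Hf f0.
    subst p h; rewrite -?catA in Hp IH *.
    have := IH f (e ++ UR :: q); rewrite catA => /(_ erefl Hf f0).
    by rewrite !rcons_cat /= -!cat_cons !catA => /fw_a.
  subst f; have Lp : lower p by move: Hf; rewrite /lower all_cat => /andP[].
  have {IH} := IH p (UR :: q) erefl Lp p0.
  case: e Eq Hf f0 => [|a [|b e]] /=.
  + by move=> <- _ _; rewrite cats0 /= -cat_rcons => /fw_a; rewrite cat_rcons.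
  + by case=> <- <- _ _; rewrite -!catA /= -cat_rcons => /fw_a; rewrite cat_rcons.
  + by case=> <- <- _; rewrite /lower all_cat /= andbF.
- have p0 := fishword_neq0 Hp isT.
  move=> /cat_eq_cat [[e [Ep Eh]]|[e [Ef Eq]]] Hf f0.
    subst p h; rewrite -?catA in Hp IH *.
    have := IH f (e ++ LR :: q); rewrite catA => /(_ erefl Hf f0).
    by rewrite !rcons_cat /= -!cat_cons !catA => /fw_b.
  subst f; have Lp : lower p by move: Hf; rewrite /lower all_cat => /andP[].
  have {IH} H1 := IH p (LR :: q) erefl Lp p0.
  (* Expanding the first of the two [N] and moving its [W] over the second serves both the cut after
     [E] and the cut after [EN]. *)
  have H2 : fishword (p ++ [:: LL, LR, LR, UR & rcons q UL]).
    move: H1 => /= /fw_b.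
    by rewrite -[LL :: _]/([:: LL; LR] ++ _) catA => /fw_c; rewrite -catA.
  case: e Eq Hf f0 => [|a [|b [|c e]]] /=.
  + by move=> <- _ _; rewrite cats0 /= -cat_rcons; apply: fw_b; rewrite cat_rcons.
  + by case=> <- <- _ _; rewrite -!catA.
  + by case=> <- <- <- _ _; rewrite -!catA.
  + by case=> <- <- <- _; rewrite /lower all_cat /= andbF.
- have p0 := fishword_neq0 Hp isT.
  move=> /cat_eq_cat [[e [Ep Eh]]|[e [Ef Eq]]] Hf f0.
    subst p h; rewrite -?catA in Hp IH *.
    have := IH f (e ++ UR :: LR :: q); rewrite catA => /(_ erefl Hf f0).
    by rewrite !rcons_cat /= -!cat_cons !catA => /fw_c.
  subst f; have Lp : lower p by move: Hf; rewrite /lower all_cat => /andP[].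
  have {IH} := IH p (UR :: LR :: q) erefl Lp p0.
  rewrite -[p ++ LR :: _]cat_rcons /= => /fw_c; rewrite cat_rcons => H1.
  case: e Eq Hf f0 => [|a [|b e]] /=.
  + by move=> <- _ _; rewrite cats0.
  + by case=> <- <- _ _; rewrite -!catA.
  + by case=> <- <- _; rewrite /lower all_cat /= andbF.
Qed.

(** No rule rewrites the final [S], so a derivation of [y S] can be replayed in the place of an [N];
    its starting point [ENW] is there the result of [fw_b]. *)
Lemma fishword_glue p q y : fishword (p ++ LR :: q) -> fishword (rcons y UL) ->
  fishword (p ++ y ++ q).
Proof.
move=> Hpq Hy; move Ew: (rcons y UL) Hy => w Hw.
elim: Hw y Ew => [|a b Hab IH|a b Hab IH|a b Hab IH] y.
- rewrite -[RHS]/(rcons [:: LL; LR; UR] UL) => /rcons_inj [->].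
  exact: fw_b.
- have [b' Eb] := fishword_lastE Hab isT; subst b.
  rewrite -!rcons_cons -rcons_cat => /rcons_inj [->].
  have /= := IH (a ++ UR :: b'); rewrite -!catA rcons_cat => /(_ erefl).
  by rewrite catA => /fw_a; rewrite -catA.
- have [b' Eb] := fishword_lastE Hab isT; subst b.
  rewrite -!rcons_cons -rcons_cat => /rcons_inj [->].
  have /= := IH (a ++ LR :: b'); rewrite -!catA rcons_cat => /(_ erefl).
  by rewrite catA => /fw_b; rewrite -catA.
- rewrite -cat_rcons in Hab; have [b' Eb] := fishword_lastE Hab isT; subst b.
  rewrite -!rcons_cons -rcons_cat => /rcons_inj [->].
  have /= := IH (a ++ UR :: LR :: b'); rewrite -!catA rcons_cat => /(_ erefl).
  by rewrite catA => /fw_c; rewrite -catA.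
Qed.

(** This fills a concave corner of the lower boundary, which is not one of the gluing rules. A later
    [E] arises only from [N -> ENW], and an [N] in front of it is then already present; expanding
    that [N] instead and moving its [W] over the second [N] gives the exchanged word. *)
Lemma fishword_shift w p q : fishword w -> w = p ++ [:: LR, LL & q] ->
  fishword (p ++ [:: LL, LR & q]).
Proof.
move=> Hw; elim: Hw p q => [|a b Hab IH|a b Hab IH|a b Hab IH] p q.
- by case: p => [|? [|? [|? [|? [|? p]]]]].
- move=> /cat_eq_cat [[e [Ea Eh]]|[e [-> Eq]]]; last first.
    case: e Eq => [|? [|? [|? e]]] //= [<- <- <- E].
    subst b; rewrite -!catA /=; apply: fw_a.
    have /= := IH (a ++ UR :: e) q; rewrite -!catA /=; exact.
  subst; case: e Eh IH Hab => [|? [|? e]] //= [<- <- ->] IH Hab.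
  have /= := IH p (e ++ UR :: b); rewrite -!catA /= => /(_ erefl).
  by have := @fw_a (p ++ [:: LL, LR & e]) b; rewrite -!catA /=; apply.
- move=> /cat_eq_cat [[e [Ea Eh]]|[e [-> Eq]]]; last first.
    case: e Eq => [|? [|? [|? e]]] //= [<- <- <- E].
    subst b; rewrite -!catA /=; apply: fw_b.
    have /= := IH (a ++ LR :: e) q; rewrite -!catA /=; exact.
  subst; case: e Eh IH Hab => [|? [|? e]] //= .
    case=> <- -> IH; rewrite -catA /= => /fw_b.
    by rewrite -[LL :: _]/([:: LL; LR] ++ _) catA => /fw_c; rewrite -catA.
  case=> <- <- -> IH Hab.
  have /= := IH p (e ++ LR :: b); rewrite -!catA /= => /(_ erefl).
  by have := @fw_b (p ++ [:: LL, LR & e]) b; rewrite -!catA /=; apply.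
- move=> /cat_eq_cat [[e [Ea Eh]]|[e [-> Eq]]]; last first.
    case: e Eq => [|? [|? e]] //= [<- <- E].
    subst b; rewrite -!catA /=; apply: fw_c.
    have /= := IH (a ++ UR :: LR :: e) q; rewrite -!catA /=; exact.
  subst; case: e Eh IH Hab => [|? [|? e]] //= [<- <- ->] IH Hab.
  have /= := IH p (e ++ UR :: LR :: b); rewrite -!catA /= => /(_ erefl).
  by have := @fw_c (p ++ [:: LL, LR & e]) b; rewrite -!catA /=; apply.
Qed.

Lemma fishword_shifts p f q : fishword (p ++ LR :: f ++ q) -> lower f ->
  fishword (p ++ f ++ LR :: q).
Proof.
elim: f p => [|k f IH] p //=.
rewrite /lower /= !inE => H /andP[/orP[] /eqP e Lf]; subst k.
  by have := IH (rcons p LL); rewrite !cat_rcons; apply; first exact: fishword_shift H erefl.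
by have := IH (rcons p LR); rewrite !cat_rcons; apply.
Qed.

(** * Balanced factors and irreducibility *)

Notation nLL := (count_mem LL).
Notation nLR := (count_mem LR).
Notation nUR := (count_mem UR).
Notation nUL := (count_mem UL).

(** Closed lattice paths that stay in the quadrant of their starting point. *)
Definition balanced (s : seq ekind) : Prop :=
  [/\ nLL s = nUR s, nLR s = nUL s &
      forall p q, s = p ++ q -> nUR p <= nLL p /\ nUL p <= nLR p].

Lemma balanced_suffix s p q : balanced s -> s = p ++ q ->
  nLL q <= nUR q /\ nLR q <= nUL q.
Proof.
case=> h1 h2 H E; have := H _ _ E; move: h1 h2; rewrite E !count_cat; lia.
Qed.

Lemma balanced_insert f v h : balanced (f ++ h) -> balanced v -> balanced (f ++ v ++ h).
Proof.
move=> [a1 a2 A] [b1 b2 B]; split; rewrite ?count_cat; try by rewrite !count_cat in a1 a2; lia.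
move=> p q /cat_eq_cat [[e [Ef Eq]]|[e [Ep E]]].
  by have := A p (e ++ h); rewrite Ef -catA => /(_ erefl).
subst p; move: E => /cat_eq_cat [[e' [Ev _]]|[e' [-> Eh]]].
  have := B _ _ Ev; have := A _ _ erefl; rewrite !count_cat; lia.
have := A (f ++ e') q; rewrite Eh -catA => /(_ erefl); rewrite !count_cat; lia.
Qed.

Lemma balanced_delete f v h : balanced (f ++ v ++ h) -> balanced v -> balanced (f ++ h).
Proof.
move=> [a1 a2 A] [b1 b2 B]; split; rewrite ?count_cat; try by rewrite !count_cat in a1 a2; lia.
move=> p q /cat_eq_cat [[e [Ef Eq]]|[e [Ep E]]].
  by have := A p (e ++ v ++ h); rewrite Ef -catA => /(_ erefl).
subst p h; have := A (f ++ v ++ e) q; rewrite -!catA => /(_ erefl); rewrite !count_cat; lia.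
Qed.

Definition irreducible (x : seq ekind) : Prop :=
  forall s z t, x = s ++ z ++ t -> balanced z -> z = [::] \/ (s = [::] /\ t = [::]).

Lemma balanced_size s : balanced s -> size s = (nLL s + nLR s).*2.
Proof.
case=> h1 h2 _; suff: size s = nLL s + nLR s + nUR s + nUL s by lia.
by elim: s {h1 h2} => [|[] s IH] //=; rewrite IH /=; lia.
Qed.

(** Sufficient for replacing [v] by [u] inside a balanced word. The two coordinates may be compared
    with different prefixes of [v]: for the exchange of [W] and [N] no single prefix serves both. *)
Definition dominates (v u : seq ekind) : Prop :=
  [/\ nLL u + nUR v = nLL v + nUR u, nLR u + nUL v = nLR v + nUL u &
  forall u1 u2, u = u1 ++ u2 -> u2 != [::] ->
     exists v1 v2 v3 v4, [/\ v = v1 ++ v2, v = v3 ++ v4,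
         nUR u1 + nLL v1 <= nLL u1 + nUR v1 & nUL u1 + nLR v3 <= nLR u1 + nUL v3]].

Lemma balanced_replace p u v q : dominates v u ->
  balanced (p ++ v ++ q) -> balanced (p ++ u ++ q).
Proof.
move=> [cx cy Hu] [b1 b2 b3]; rewrite !count_cat in b1 b2 b3.
split; rewrite ?count_cat; try lia.
move=> a b Eab; have [[e4 [Ee Eb]]|[e4 [_ [-> Eu]]]] := cat_eq_cat_strict (esym Eab).
  by apply: (b3 a (e4 ++ v ++ q)); rewrite Ee -catA.
have [[e5 [Ee Eb]]|[e5 [e50 [Ee Eb]]]] := cat_eq_cat_strict Eu.
  have := b3 (p ++ v ++ e5) b; rewrite Eb Ee -!catA => /(_ erefl).
  by rewrite !count_cat; lia.
have [v1 [v2 [v3 [v4 [Ev Ev' h1 h2]]]]] := Hu _ _ Ee e50.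
have := b3 (p ++ v1) (v2 ++ q); rewrite -catA (catA v1) -Ev => /(_ erefl).
have := b3 (p ++ v3) (v4 ++ q); rewrite -catA (catA v3) -Ev' => /(_ erefl).
by rewrite !count_cat; lia.
Qed.

(* A balanced factor meeting the new block [v] contains all of it, so undoing
   the step inside the factor leaves a balanced factor. *)
Lemma irreducible_step (u v p q : seq ekind) :
  u != [::] -> v != [::] -> size v <= 3 ->
  dominates v u ->
  (forall v1 v2, v = v1 ++ v2 -> v1 != [::] -> v2 != [::] ->
     (nUR v1 < nLL v1) || (nUL v1 < nLR v1)) ->
  (forall v1 v2, v = v1 ++ v2 -> v1 != [::] -> v2 != [::] ->
     (nLL v2 < nUR v2) || (nLR v2 < nUL v2)) ->
  irreducible (p ++ u ++ q) -> irreducible (p ++ v ++ q).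
Proof.
move=> u0 v0 sv Huv Hp Hs IH s z t E bz.
have [[e [Ep Et]]|[e [e0 [Es Et]]]] := cat_eq_cat_strict (esym E).
  have [[e2 [Ee Et2]]|[e2 [e20 [Ez Et2]]]] := cat_eq_cat_strict Et.
    have := IH s z (e2 ++ u ++ q); rewrite Ep Ee -!catA => /(_ erefl bz) [->|[_]]; first by left.
    by case: (e2) => //=; case: (u) u0 => //=.
  have [[e3 [Ee Et3]]|[e3 [e30 [Ee Et3]]]] := cat_eq_cat_strict Et2; last first.
    by have [] := balanced_suffix bz Ez; have := Hp _ _ Ee e20 e30; lia.
  subst; have bz' := balanced_replace Huv bz.
  have := IH s (e ++ u ++ e3) t; rewrite -!catA => /(_ erefl bz') [|[-> ->]].
    by case: (e) => //=; case: (u) u0 => //=.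
  by right.
have [[e3 [Ev Eq]]|[e3 [e30 [Ev Eq]]]] := cat_eq_cat_strict Et.
  subst; have := IH (p ++ u ++ e3) z t; rewrite -!catA => /(_ erefl bz) [->|[]]; first by left.
  by case: (p) => //=; case: (u) u0 => //=.
have [[e4 [Ez _]]|[e4 [e40 [Ez _]]]] := cat_eq_cat_strict (esym Eq).
  by case: bz => _ _ /(_ _ _ Ez); have := Hs _ _ Ev e0 e30; lia.
(* Here [z] lies strictly inside [v], so it has at most one letter, while a balanced word has even
   length. *)
left; have := balanced_size bz; move: sv; rewrite Ev Ez !size_cat.
by case: (e) e0 => // ? ? _; case: (e4) e40 => // ? ? _; case: (z) => //= ? ?; lia.
Qed.

Lemma irreducible_base : irreducible [:: LL; LR; UR; UL].
Proof.
by case=> [|? [|? [|? [|? [|? s]]]]] [|? [|? [|? [|? [|? z]]]]] t //=;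
  try (by left); case=> *; subst; try (by right);
  match goal with H : balanced _ |- _ => by case: H end.
Qed.

Lemma fishword_irreducible w : fishword w -> irreducible w.
Proof.
elim=> [|p q _|p q _|p q _]; first exact: irreducible_base.
- apply: (@irreducible_step [:: UR] [:: LR; UR; UL]) => //.
  + split=> //; move=> [|? [|? u1]] u2 //= [*]; subst => //.
    by exists [::], [:: LR; UR; UL], [::], [:: LR; UR; UL].
  + by move=> [|? [|? [|? [|? u1]]]] u2 //= [*]; subst.
  + by move=> [|? [|? [|? [|? u1]]]] u2 //= [*]; subst.
- apply: (@irreducible_step [:: LR] [:: LL; LR; UR]) => //.
  + split=> //; move=> [|? [|? u1]] u2 //= [*]; subst => //.
    by exists [::], [:: LL; LR; UR], [::], [:: LL; LR; UR].
  + by move=> [|? [|? [|? [|? u1]]]] u2 //= [*]; subst.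
  + by move=> [|? [|? [|? [|? u1]]]] u2 //= [*]; subst.
- apply: (@irreducible_step [:: UR; LR] [:: LR; UR]) => //.
  + split=> //; move=> [|? [|? [|? u1]]] u2 //= [*]; subst => //.
      by exists [::], [:: LR; UR], [::], [:: LR; UR].
    by exists [:: LR; UR], [::], [::], [:: LR; UR].
  + by move=> [|? [|? [|? u1]]] u2 //= [*]; subst.
  + by move=> [|? [|? [|? u1]]] u2 //= [*]; subst.
Qed.

(** Here the old block must dominate the new one, the reverse of what undoing a rule requires. *)
Lemma fishword_balanced w : fishword w -> balanced w.
Proof.
elim=> [|p q _|p q _|p q _].
- split=> //; by move=> [|? [|? [|? [|? [|? u1]]]]] u2 //= [*]; subst.
- apply: (@balanced_replace p [:: LR; UR; UL] [:: UR]); split=> //.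
  move=> [|? [|? [|? [|? u1]]]] u2 //= [*]; subst => //.
  + by exists [::], [:: UR], [::], [:: UR].
  + by exists [::], [:: UR], [::], [:: UR].
  + by exists [:: UR], [::], [::], [:: UR].
- apply: (@balanced_replace p [:: LL; LR; UR] [:: LR]); split=> //.
  move=> [|? [|? [|? [|? u1]]]] u2 //= [*]; subst => //;
  by exists [::], [:: LR], [::], [:: LR].
- apply: (@balanced_replace p [:: LR; UR] [:: UR; LR]); split=> //.
  move=> [|? [|? [|? u1]]] u2 //= [*]; subst => //;
  by exists [::], [:: UR; LR], [::], [:: UR; LR].
Qed.

Lemma fishword_noNS p q : fishword (p ++ [:: LR, UL & q]) -> False.
Proof.
move=> H; have p0 := fishword_neq0 H isT.
case: (fishword_irreducible H (erefl (p ++ [:: LR; UL] ++ q))) => // [|[p1 _]].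
  split=> //; by move=> [|? [|? [|? u1]]] u2 //= [*]; subst.
by rewrite p1 in p0.
Qed.

Lemma fishword_noEW p q : fishword (p ++ [:: LL, UR & q]) -> False.
Proof.
move=> H; have [q' Eq] : exists q', q = rcons q' UL.
  by apply: (@fishword_lastE (rcons p LL) UR); rewrite ?cat_rcons.
case: (fishword_irreducible H (erefl (p ++ [:: LL; UR] ++ q))) => // [|[_]].
  split=> //; by move=> [|? [|? [|? u1]]] u2 //= [*]; subst.
by rewrite Eq; case: (q').
Qed.

(** Describes [y] when [fw_c] acts on the last letter of [y] and the first of [h]. With the outer
    [E] and [W] stripped off, the derivation becomes one that starts from the single edge [N], whose
    expansion yields the head. *)
Lemma fishword_endW w y : fishword w -> w = rcons (rcons y UR) UL ->
  exists y', y = LL :: y' /\ (y' = [:: LR] \/ fishword (rcons y' UL)).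
Proof.
move=> Hw; elim: Hw y => [|a b Hab IH|a b Hab IH|a b Hab IH] y.
- by move=> /(@rcons_inj _ [:: LL; LR; UR]) [/(@rcons_inj _ [:: LL; LR])] [<-]; exists [:: LR]; split; [|left].
- have a0 := fishword_neq0 Hab isT.
  have [b' Eb] := fishword_lastE Hab isT; subst b.
  case/lastP: b' Hab IH => [|b' z] Hab IH.
    by rewrite -[_ :: _]/(rcons [:: LR; UR; UL] UL) -rcons_cat => /rcons_inj []; rewrite -[_ :: _]/(rcons [:: LR; UR] UL) -rcons_cat => /rcons_inj [].
  rewrite -!rcons_cons -!rcons_cat => /rcons_inj [] /rcons_inj [Ey Ez]; subst.
  have := IH (a ++ UR :: b'); rewrite -!rcons_cons -!rcons_cat => /(_ erefl) [y' [E H]].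
  case: a a0 E Hab {IH} => // k a _ [-> E] _.
  exists (a ++ [:: LR, UR, UL & b']); split=> //; right.
  case: H => [E2|]; first by rewrite E2 in E; case: (a) E => [|? []].
  by rewrite -E !rcons_cat /=; apply: fw_a.
- have a0 := fishword_neq0 Hab isT.
  have [b' Eb] := fishword_lastE Hab isT; subst b.
  case/lastP: b' Hab IH => [|b' z] Hab IH; first by case: (fishword_noNS Hab).
  rewrite -!rcons_cons -!rcons_cat => /rcons_inj [] /rcons_inj [Ey Ez]; subst.
  have := IH (a ++ LR :: b'); rewrite -!rcons_cons -!rcons_cat => /(_ erefl) [y' [E H]].
  case: a a0 E Hab {IH} => // k a _ [-> E] _.
  exists (a ++ [:: LL, LR, UR & b']); split=> //; right.
  case: H => [E2|].
    by rewrite E2 in E; case: (a) E => [|? []] //= [->]; apply: fw_head.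
  by rewrite -E !rcons_cat /=; apply: fw_b.
- have a0 := fishword_neq0 Hab isT.
  have [b' Eb] : exists b', b = rcons b' UL.
    by apply: (@fishword_lastE (rcons a UR) LR); rewrite ?cat_rcons.
  subst b; case/lastP: b' Hab IH => [|b' z] Hab IH.
    by case: (@fishword_noNS (rcons a UR) [::]); rewrite cat_rcons.
  rewrite -!rcons_cons -!rcons_cat => /rcons_inj [] /rcons_inj [Ey Ez]; subst.
  have := IH (a ++ [:: UR, LR & b']); rewrite -!rcons_cons -!rcons_cat => /(_ erefl) [y' [E H]].
  case: a a0 E Hab {IH} => // k a _ [-> E] _.
  exists (a ++ [:: LR, UR & b']); split=> //; right.
  case: H => [E2|]; first by rewrite E2 in E; case: (a) E => [|? []].
  by rewrite -E !rcons_cat /=; apply: fw_c.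
Qed.

(** * Existence of the factorization *)

Definition decomposed (w f y h : seq ekind) : Prop :=
  [/\ w = f ++ y ++ rcons h UL, lower f && (f != [::]),
      fishword (f ++ h) \/ f = [:: LL] /\ h = [:: UR] &
      fishword (rcons y UL) \/ y = [:: LR] /\ exists h', h = UR :: h'].

Lemma lower_cat f g : lower (f ++ g) = lower f && lower g.
Proof. exact: all_cat. Qed.

Lemma decomposed_split p x q f y h : decomposed (p ++ x :: q) f y h -> x != UL ->
  [\/ exists e, f = p ++ x :: e /\ q = e ++ y ++ rcons h UL,
      exists e e', [/\ p = f ++ e, y = e ++ x :: e' & q = e' ++ rcons h UL]
    | exists e q', [/\ p = f ++ y ++ e, h = e ++ x :: q' & q = rcons q' UL]].
Proof.
case=> E _ _ _ xUL.
have [[e [-> Ey]]|[e [e0 [-> Eq]]]] := cat_eq_cat_strict (esym E); last first.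
  by apply: Or31; case: e e0 Eq => //= a e _ [<- ->]; exists e.
have [[e2 [-> Eh]]|[e2 [e20 [-> Eq]]]] := cat_eq_cat_strict Ey; last first.
  by apply: Or32; case: e2 e20 Eq => //= a e2 _ [<- ->]; exists e, e2.
apply: Or33; exists e2; case/lastP: q Eh {E Ey} => [|q z].
  by rewrite cats1 => /rcons_inj [_ ex]; rewrite -ex in xUL.
by rewrite -rcons_cons -rcons_cat => /rcons_inj [-> <-]; exists q.
Qed.

(** Most rules act inside [y] or [h] and keep the factorization. Three situations change it. An [N]
    of [f] that is expanded becomes the new [y], and what followed it in [f] moves to [h] together
    with the old [y]. When [y = N] and the [W] opening [h] is rewritten, [f] absorbs an [N]. When
    [WN] straddles [y] and [h], [f] absorbs the initial [E] of [y], and also the next [N] if nothing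
    else would remain. *)
Lemma fishword_decompose w : fishword w -> exists f y h, decomposed w f y h.
Proof.
elim=> {w} [|p q _ [f [y [h D]]]|p q _ [f [y [h D]]]|p q _ [f [y [h D]]]].
- exists [:: LL], [:: LR], [:: UR]; split=> //; first by right.
  by right; split=> //; exists [::].
- have [E /andP[Hf f0] Hx Hy] := D.
  have [[e [Ef Eq]]|[e [e' [Ep Ey Eq]]]|[e [q' [Ep Eh Eq]]]] := decomposed_split D isT; subst.
  + by move: Hf; rewrite lower_cat /= andbF.
  + exists f, (e ++ [:: LR, UR, UL & e']), h; split; rewrite -?catA ?Hf //; left.
    case: Hy => [|[]]; last by case: (e) => [|? []].
    by rewrite !rcons_cat /=; apply: fw_a.
  + have Hx' : fishword (f ++ e ++ [:: LR, UR, UL & q']).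
      case: Hx => [|[-> ]]; first by rewrite !catA; apply: fw_a.
      by case: (e) => [|? []] // [->]; apply: fw_head.
    case: Hy => [Hy|[Ey [h' Eh]]].
      exists f, y, (e ++ [:: LR, UR, UL & q']).
      by split; rewrite -?catA ?rcons_cat ?Hf //; left.
    case: e Hx Hx' Eh {E D} => [|a e] Hx Hx'.
      move=> _; exists (rcons f LR), y, [:: UR, UL & q'].
      rewrite /decomposed !cat_rcons Ey /=; split=> //; try by left.
          by rewrite -catA.
        by rewrite -cats1 lower_cat Hf; case: (f).
      by right; split=> //; exists (UL :: q').
    case=> Ea _; subst a; exists f, y, (UR :: e ++ [:: LR, UR, UL & q']).
    rewrite /decomposed -!catA /= rcons_cat Hf f0 Ey; split=> //; first by left.
    by right; split=> //; exists (e ++ [:: LR, UR, UL & q']).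
- have [E /andP[Hf f0] Hx Hy] := D.
  have [[e [Ef Eq]]|[e [e' [Ep Ey Eq]]]|[e [q' [Ep Eh Eq]]]] := decomposed_split D isT; subst.
  + move: Hf; rewrite lower_cat /= => /andP[Lp Le].
    case: Hx => [Hx|[]]; last by case: (p) => [|? []].
    rewrite -catA /= in Hx; have p0 := fishword_neq0 Hx isT.
    exists p, [:: LL; LR; UR], (e ++ y ++ h).
    split; rewrite ?rcons_cat ?Lp ?p0 //; last by left; apply: fw_head.
    (* Moving the expanded [N] behind [e] and then gluing [y] in its place shows that [p e y h] is a
       fish word. *)
    left; have {Hx} := fishword_shifts Hx Le.
    by case: Hy => [Hy|[-> _]] //; rewrite !catA -(catA _ y) => /fishword_glue; apply.
  + exists f, (e ++ [:: LL, LR, UR & e']), h; split; rewrite -?catA ?Hf //; left.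
    case: Hy => [|[]].
      by rewrite !rcons_cat /=; apply: fw_b.
    by case: (e) => [|? []] // [->] _; apply: fw_head.
  + have Hx' : fishword (f ++ e ++ [:: LL, LR, UR & q']).
      case: Hx => [|[_ ]]; first by rewrite !catA; apply: fw_b.
      by case: (e) => [|? []].
    exists f, y, (e ++ [:: LL, LR, UR & q']).
    split; rewrite -?catA ?rcons_cat ?Hf //; first by left.
    case: Hy => [Hy|[Ey [h' Eh]]]; [by left|right; split=> //].
    by case: (e) Eh => //= _ e' [-> _]; exists (e' ++ [:: LL, LR, UR & q']).
- have [E /andP[Hf f0] Hx Hy] := D.
  have [[e [Ef Eq]]|[e [e' [Ep Ey Eq]]]|[e [q' [Ep Eh Eq]]]] := decomposed_split D isT; subst.
  + by move: Hf; rewrite lower_cat /= andbF.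
  + case: Hy => [Hy|[]]; last by case: (e) => [|? []].
    case: e' Eq Hy {D E} => [|a e'] /= Eq Hy.
      case: h Hx Eq => [|b h] Hx //= [Eb Eq]; subst.
      case: Hx => [Hx|[] //].
      rewrite cats1 in Hy.
      have [y1 [-> [->|Hy1]]] := fishword_endW Hy erefl.
        exists (f ++ [:: LL; LR]), [:: LR], (UR :: h).
        split; rewrite -?catA ?lower_cat ?Hf //=; first by case: (f).
          by left; apply: fw_b.
        by right; split=> //; exists h.
      exists (f ++ [:: LL]), y1, [:: LR, UR & h].
      split; rewrite -?catA ?lower_cat ?Hf //=; first by case: (f).
        by left; apply: fw_b.
      by left.
    case: Eq => Ea ->; subst a.
    exists f, (e ++ [:: LR, UR & e']), h; split; rewrite -?catA ?Hf //; left.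
    by move: Hy; rewrite !rcons_cat /=; apply: fw_c.
  + have [b E2] : exists b, q' = LR :: b.
      by case: (q') Eq => [|? b] //= [<-]; exists b.
    subst; have Eq' : q = rcons b UL by case: Eq.
    subst; have Hx' : fishword (f ++ e ++ [:: LR, UR & b]).
      case: Hx => [|[_ ]]; first by rewrite !catA; apply: fw_c.
      by case: (e) => [|? []].
    case: Hy => [Hy|[Ey [h' Eh]]].
      exists f, y, (e ++ [:: LR, UR & b]).
      by split; rewrite -?catA ?rcons_cat ?Hf //; left.
    case: e Hx Hx' Eh {E D} => [|a e] Hx Hx'.
      move=> _; exists (rcons f LR), y, (UR :: b).
      rewrite /decomposed !cat_rcons Ey /=; split=> //; try by left.
          by rewrite -catA.
        by rewrite -cats1 lower_cat Hf; case: (f).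
      by right; split=> //; exists b.
    case=> Ea _; subst a; exists f, y, (UR :: e ++ [:: LR, UR & b]).
    rewrite /decomposed -!catA /= rcons_cat Hf f0 Ey; split=> //; first by left.
    by right; split=> //; exists (e ++ [:: LR, UR & b]).
Qed.

(** * Decomposition trees *)

Inductive tree := Leaf | Node of nat & tree & tree.

Definition is_leaf (t : tree) : bool := if t is Leaf then true else false.

(** One less than the length of the fin of [closed_word t]; on the permutation side, the number of
    left-to-right maxima after one pass. *)
Fixpoint fin_size (t : tree) : nat :=
  if t is Node j l _ then (j + fin_size l).+1 else 0.

(** The prefix [f] has [j.+1] edges and must fit into the fin of [closed_word r], which has
    [(fin_size r).+1]. The last clause lets [y = N] follow only a whole fin. *)
Fixpoint valid (t : tree) : bool :=
  if t is Node j l r then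
    [&& valid l, valid r, j <= fin_size r & is_leaf l ==> (j == fin_size r)]
  else true.

(* The word of a fish without its final [UL]; a leaf stands for a single free edge. *)
Fixpoint open_word (t : tree) : seq ekind :=
  if t is Node j l r then
    let x := if r is Leaf then [:: LL; UR] else rcons (open_word r) UL in
    take j.+1 x ++ open_word l ++ drop j.+1 x
  else [:: LR].

Definition closed_word (t : tree) : seq ekind :=
  if t is Leaf then [:: LL; UR] else rcons (open_word t) UL.

(* [open_word t] without the last edge of its fin, which makes it balanced. *)
Fixpoint bare_word (t : tree) : seq ekind :=
  if t is Node j l r then
    take j.+1 (closed_word r) ++ bare_word l ++ drop j.+1 (closed_word r)
  else [::].

Lemma open_wordE j l r : open_word (Node j l r) =
  take j.+1 (closed_word r) ++ open_word l ++ drop j.+1 (closed_word r).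
Proof. by case: r. Qed.

Definition fin_split (w : seq ekind) (n : nat) : Prop :=
  exists f g, [/\ w = f ++ UR :: g, lower f & size f = n].

Lemma lower_split_inj f g f' g' : lower f -> lower f' ->
  f ++ UR :: g = f' ++ UR :: g' -> f = f' /\ g = g'.
Proof.
elim: f f' => [|a f IH] [|a' f'] //=.
- by move=> _ _ [->].
- by move=> _ /andP[+ _] [E _]; rewrite -E.
- by move=> /andP[+ _] _ [E _]; rewrite E.
by move=> /andP[_ /IH H] /andP[_ /H h] [-> /h [-> ->]].
Qed.

Lemma fin_split_cut w n m : fin_split w n -> m <= n ->
  exists f1 f2 g, [/\ take m w = f1, drop m w = f2 ++ UR :: g, lower (f1 ++ f2),
                      size f1 = m & size f2 = n - m].
Proof.
move=> [f [g [-> Lf sf]]] mn.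
exists (take m f), (drop m f), g; rewrite cat_take_drop size_drop sf; split=> //.
- by rewrite takel_cat // sf.
- rewrite drop_cat sf; case: ltnP => // nm.
  have -> : m = n by lia.
  by rewrite subnn drop0 drop_oversize // sf.
- by rewrite size_takel // sf.
Qed.

(** The fin of an open word ends in [N], just before the first [W]; this [N] is the edge missing
    from [bare_word]. *)
Definition open_split t :=
  exists f g, [/\ open_word t = f ++ [:: LR, UR & g], bare_word t = f ++ UR :: g,
                  lower f & size f = fin_size t].

Lemma open_split_closed t : is_leaf t \/ open_split t ->
  fin_split (closed_word t) (fin_size t).+1.
Proof.
case=> [|[f [g [E _ Lf sf]]]]; first by case: t => // _; exists [:: LL], [::].
exists (rcons f LR), (rcons g UL); split.
- case: t E sf => [|j l r] E sf; first by case: (f) E => [|? []].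
  by rewrite /closed_word E cat_rcons rcons_cat.
- by rewrite -cats1 lower_cat Lf.
- by rewrite size_rcons sf.
Qed.

Lemma open_word_fin t : valid t -> is_leaf t \/ open_split t.
Proof.
elim: t => [|j l IHl r IHr]; first by left.
rewrite /open_split open_wordE /= => /and4P[vl vr jr jl]; right.
have Hr := open_split_closed (IHr vr).
have [f1 [f2 [g [-> -> L12 s1 s2]]]] := fin_split_cut (m := j.+1) Hr jr.
move: L12; rewrite lower_cat => /andP[L1 L2].
case: (IHl vl) => [ll|[fl [gl [-> -> Ll sl]]]].
  case: l ll {IHl vl} jl => //= _ /eqP Ej; exists f1, g.
  have -> : f2 = [::] by apply/nilP; rewrite /nilp s2 Ej subnn.
  by split; rewrite // addn0.
exists (f1 ++ fl), (gl ++ f2 ++ UR :: g); split; rewrite -?catA //.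
- by rewrite lower_cat L1.
- by rewrite size_cat s1 sl.
Qed.

Lemma closed_word_fin t : valid t -> fin_split (closed_word t) (fin_size t).+1.
Proof. by move=> vt; apply: open_split_closed; apply: open_word_fin. Qed.

(** The two subfish are composed in two steps: [fishword_strip] turns [f h] into [f N h S], and
    [fishword_glue] turns that into [f y h S]. *)
Lemma fishword_closed t : valid t -> ~~ is_leaf t -> fishword (closed_word t).
Proof.
elim: t => [|j l IHl r IHr] // v _; have /and4P[vl vr jr jl] := v.
rewrite /closed_word open_wordE.
have [f1 [f2 [g [E1 E2 L12 s1 s2]]]] := fin_split_cut (m := j.+1) (closed_word_fin vr) jr.
have E : closed_word r = f1 ++ f2 ++ UR :: g by rewrite -E1 -E2 cat_take_drop.
have H : fishword (f1 ++ LR :: rcons (f2 ++ UR :: g) UL).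
  case: (boolP (is_leaf r)) => [lr|nlr].
    case: r lr {IHr vr v jl} jr E {E1 E2 s2} => //= _ jr.
    have {}jr : j = 0 by lia.
    subst j; case: f1 s1 {L12} => [|a [|]] //= _ [<-].
    case: f2 => [|? [|? f2]] //= [<-]; exact: fw_head.
  apply: (fishword_strip (IHr vr nlr) E).
    by move: L12; rewrite lower_cat => /andP[].
  by case: (f1) s1.
rewrite E1 E2 !rcons_cat; rewrite rcons_cat in H; case: (boolP (is_leaf l)) => [ll|nll].
  by case: l ll {IHl vl v jl}.
apply: (fishword_glue H); have := IHl vl nll.
by case: (l) nll.
Qed.

Lemma fishword_tree w : fishword w -> exists t, [/\ valid t, ~~ is_leaf t & closed_word t = w].
Proof.
have [n] := ubnP (size w); elim: n w => // n IH w sw Hw.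
have [f [y [h [E /andP[Lf f0] Hx Hy]]]] := fishword_decompose Hw.
have sw' : size w = size f + size y + (size h).+1 by rewrite E !size_cat size_rcons; lia.
have sf : 0 < size f by case: (f) f0.
have [r [vr Er]] : exists r, valid r /\ closed_word r = f ++ h.
  case: Hx => [Hx|[-> ->]]; last by exists Leaf.
  have sy : 0 < size y.
    case: Hy => [/(fishword_ends LL) [] |[-> //]].
    by case: (y).
  have [|r [vr _ Er]] := IH _ _ Hx; first by rewrite size_cat; lia.
  by exists r.
have [fr [gr [Er2 Lr sr]]] := closed_word_fin vr.
have sfr : size f <= (fin_size r).+1.
  move: Er; rewrite Er2 => /cat_eq_cat [[e [Ef _]]|[[|a e] [Ef Eh]]].
  - by rewrite -sr Ef size_cat leq_addr.
  - by rewrite Ef cats0 sr leqnn.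
  - by case: Eh => Ea _; move: Lf; rewrite Ef -Ea lower_cat /= andbF.
have [l [vl El Hl]] : exists l, [/\ valid l, open_word l = y & is_leaf l -> size f = (fin_size r).+1].
  case: Hy => [Hy|[-> [h' Eh]]].
    have [|l [vl nl El]] := IH _ _ Hy; first by rewrite size_rcons; lia.
    exists l; split=> //; last by rewrite (negPf nl).
    by case: (l) nl El => // j l1 l2 _ /rcons_inj [].
  exists Leaf; split=> // _; move: Er; rewrite Er2 Eh => /lower_split_inj [] // <- _.
  by rewrite sr.
exists (Node (size f).-1 l r); split=> //.
  by rewrite /= vl vr /=; apply/andP; split; [lia|apply/implyP => ll; rewrite (Hl ll)].
rewrite /closed_word open_wordE El Er prednK // E.
by rewrite take_size_cat // drop_size_cat // !rcons_cat.
Qed.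

Lemma closed_word_irreducible t : valid t -> irreducible (closed_word t).
Proof.
case: (boolP (is_leaf t)) => [|nl vt]; last exact: fishword_irreducible (fishword_closed vt nl).
case: t => // _ _.
case=> [|? [|? [|? s]]] [|? [|? [|? z]]] t //=;
  try (by left); case=> *; subst; try (by right);
  match goal with H : balanced _ |- _ => by case: H end.
Qed.

Lemma closed_word_balanced t : valid t -> balanced (closed_word t).
Proof.
case: (boolP (is_leaf t)) => [|nl vt]; last exact: fishword_balanced (fishword_closed vt nl).
case: t => // _ _; split=> //.
by move=> [|? [|? [|? u1]]] u2 //= [*]; subst.
Qed.

Lemma bare_word_balanced t : valid t -> balanced (bare_word t).
Proof.
elim: t => [_|j l IHl r _ /= /and4P[vl vr _ _]]; first by split=> //; case.
by apply: balanced_insert (IHl vl); rewrite cat_take_drop; apply: closed_word_balanced.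
Qed.

(* Two balanced factors of the same word overlap in a balanced factor, so a
   balanced factor whose complement is irreducible is unique. *)
Lemma irreducible_complement_le f v h f' v' h' :
  balanced v -> balanced v' -> f != [::] -> v' != [::] ->
  irreducible (f ++ h) -> irreducible (f' ++ h') ->
  f ++ v ++ h = f' ++ v' ++ h' -> size f <= size f' -> f = f' /\ v = v'.
Proof.
move=> bv bv' f0 v0' ir ir' E sf.
have {E} [e [Ef E]] : exists e, f' = f ++ e /\ v ++ h = e ++ v' ++ h'.
  case/cat_eq_cat: E => [[[|a e] [Ef E]]|//].
    by exists [::]; rewrite Ef !cats0.
  by rewrite Ef size_cat /= in sf; lia.
have [[e2 [Ee Eh]]|[e2 [_ [Ev E2]]]] := cat_eq_cat_strict E.
  move: ir; rewrite Eh catA => /(_ _ _ _ erefl bv') [v0|[fe _]].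
    by rewrite v0 in v0'.
  by case: (f) fe f0.
have [[e3 [Ev' Eh]]|[e3 [e30 [Ee2 Eh]]]] := cat_eq_cat_strict (esym E2).
  (* A genuine overlap [e2] of [v = e e2] and [v' = e2 e3] is balanced. Removing it leaves [e] and
     [e3] balanced; they are factors of [f' h'] and of [f h], hence empty. *)
  have b2 : balanced e2.
    have [x1 y1] := balanced_suffix bv Ev.
    case: bv' => _ _ bp; have [x2 y2] := bp _ _ Ev'.
    split; [lia|lia|move=> p q Ep].
    by apply: (bp p (q ++ e3)); rewrite Ev' Ep catA.
  have be : balanced e.
    by rewrite -(cats0 e); apply: balanced_delete b2; rewrite cats0 -Ev.
  have be3 : balanced e3.
    by apply: (@balanced_delete [::] e2) b2; rewrite -Ev'.
  have e0 : e = [::].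
    move: ir'; rewrite Ef -catA => /(_ _ _ _ erefl be) [//|[f1]].
    by rewrite f1 in f0.
  have e30 : e3 = [::].
    move: ir; rewrite Eh => /(_ _ _ _ erefl be3) [//|[f1]].
    by rewrite f1 in f0.
  by rewrite Ef Ev Ev' e0 e30 !cats0.
(* Now [v'] lies inside [v], and the rest of [v] is a balanced factor of [f' h']. *)
have be : balanced (e ++ e3).
  by apply: (@balanced_delete _ v'); rewrite // -Ee2 -Ev.
move: ir'; rewrite Ef Eh -catA (catA e) => /(_ _ _ _ erefl be) [|[f1]].
  by case: (e) => //= e3'; rewrite e3' in e30.
by rewrite f1 in f0.
Qed.

Lemma irreducible_complement_unique f v h f' v' h' :
  balanced v -> balanced v' -> f != [::] -> f' != [::] ->
  v != [::] -> v' != [::] -> irreducible (f ++ h) -> irreducible (f' ++ h') ->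
  f ++ v ++ h = f' ++ v' ++ h' -> [/\ f = f', v = v' & h = h'].
Proof.
move=> bv bv' f0 f0' v0 v0' ir ir' E.
have [Ef Ev] : f = f' /\ v = v'.
  case: (leqP (size f) (size f')) => sf.
    exact: irreducible_complement_le E sf.
  by have [-> ->] := irreducible_complement_le bv' bv f0' v0 ir' ir (esym E) (ltnW sf).
split=> //; move: E; rewrite Ef Ev => /(congr1 (drop (size f' + size v'))).
by rewrite !catA -!size_cat !drop_size_cat.
Qed.

Lemma bare_word_nil t : valid t -> (bare_word t == [::]) = is_leaf t.
Proof.
move=> vt; case: (open_word_fin vt) => [|[f [g [E -> _ sf]]]]; first by case: t vt.
case: t {vt} E sf => [|j l r] /= E sf; last by case: (f).
by case: f E sf => [|? []].
Qed.

(** The deleted edge is the letter before the first [W], so its place is determined by the word. *)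
Lemma closed_word_bare t t' : valid t -> valid t' -> closed_word t = closed_word t' ->
  bare_word t = bare_word t'.
Proof.
move=> vt vt'.
case: (open_word_fin vt) => [|[f [g [Eo -> Lf _]]]]; case: (open_word_fin vt') => [|[f' [g' [Eo' Eb' Lf' _]]]].
- by case: (t) => //; case: (t').
- case: t' {vt'} Eo' Eb' => [|j' l' r'] Eo' Eb'; first by case: (f') Eo' => [|? []].
  case: (t) => // _; rewrite /closed_word -[_ :: _]/(rcons [:: LL] UR) => /rcons_inj [] //.
- case: t {vt} Eo => [|j l r] Eo; first by case: (f) Eo => [|? []].
  by case: (t') => // _; rewrite /closed_word -[[:: _; _]]/(rcons [:: LL] UR) => /rcons_inj [].
- case: t {vt} Eo => [|j l r] Eo; first by case: (f) Eo => [|? []].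
  case: t' {vt'} Eo' Eb' => [|j' l' r'] Eo' Eb'; first by case: (f') Eo' => [|? []].
  rewrite /closed_word Eo Eo' Eb' => /rcons_inj []; rewrite -(cat_rcons LR f) -(cat_rcons LR f') => /lower_split_inj [].
  + by rewrite -cats1 lower_cat Lf.
  + by rewrite -cats1 lower_cat Lf'.
  + by move/rcons_inj=> [->] ->.
Qed.

(** The middle factor [bare_word l] is balanced and its complement [closed_word r] is irreducible,
    so the factorization is unique when both middle factors are nonempty. If [l] is a leaf, the
    whole word is [closed_word r], and its irreducibility excludes the mixed cases. *)
Lemma bare_word_inj t t' : valid t -> valid t' -> bare_word t = bare_word t' -> t = t'.
Proof.
elim: t t' => [|j l IHl r IHr] t' vt vt' E.
  by move: (bare_word_nil vt'); rewrite -E; case: (t').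
case: t' vt' E => [vt' E|j' l' r' vt'].
  by move: (bare_word_nil vt); rewrite E.
have [/and4P[vl vr jr jl] /and4P[vl' vr' jr' jl']] := (vt, vt').
have [f1 [f2 [g [E1 E2 _ s1 _]]]] := fin_split_cut (m := j.+1) (closed_word_fin vr) jr.
have [f1' [f2' [g' [E1' E2' _ s1' _]]]] := fin_split_cut (m := j'.+1) (closed_word_fin vr') jr'.
have Er : closed_word r = f1 ++ f2 ++ UR :: g by rewrite -E1 -E2 cat_take_drop.
have Er' : closed_word r' = f1' ++ f2' ++ UR :: g' by rewrite -E1' -E2' cat_take_drop.
have ir := closed_word_irreducible vr; have ir' := closed_word_irreducible vr'.
rewrite /= E1 E1' E2 E2'; move: ir ir'; rewrite Er Er' => ir ir' E.
have f0 : f1 != [::] by case: (f1) s1.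
have f0' : f1' != [::] by case: (f1') s1'.
have [bl bl'] := (bare_word_balanced vl, bare_word_balanced vl').
have fin_eq : r = r' -> fin_size r = fin_size r' by move->.
have clr : f1 ++ f2 ++ UR :: g = f1' ++ f2' ++ UR :: g' -> r = r'.
  by rewrite -Er -Er' => H; apply: IHr => //; apply: closed_word_bare.
case: (boolP (is_leaf l)) => ll; case: (boolP (is_leaf l')) => ll'.
- have El : l = Leaf by case: (l) ll.
  have El' : l' = Leaf by case: (l') ll'.
  subst l l'; rewrite /= in E; have Er2 := clr E.
  by move: jl jl'; rewrite /= => /eqP -> /eqP ->; rewrite Er2.
- have El : bare_word l = [::] by apply/eqP; rewrite bare_word_nil.
  rewrite El /= in E; move: ir; rewrite E => /(_ _ _ _ erefl bl') [/eqP|[f1n]].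
    by rewrite bare_word_nil // (negPf ll').
  by rewrite f1n in f0'.
- have El : bare_word l' = [::] by apply/eqP; rewrite bare_word_nil.
  rewrite El /= in E; move: ir'; rewrite -E => /(_ _ _ _ erefl bl) [/eqP|[f1n]].
    by rewrite bare_word_nil // (negPf ll).
  by rewrite f1n in f0.
rewrite -bare_word_nil // in ll; rewrite -bare_word_nil // in ll'.
have [Ef Eb Eh] := irreducible_complement_unique bl bl' f0 f0' ll ll' ir ir' E.
have -> : j = j' by move: s1 s1'; rewrite Ef => -> [].
by rewrite (IHl _ vl vl' Eb) clr // Ef Eh.
Qed.

Lemma closed_word_inj t t' : valid t -> valid t' -> closed_word t = closed_word t' -> t = t'.
Proof. by move=> vt vt' E; apply: bare_word_inj => //; apply: closed_word_bare. Qed.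

(** * Statistics of boundary words read off the trees *)

Fixpoint peaks (w : seq ekind) : nat :=
  if w is a :: w' then ((a == LR) && (ohead w' == Some UR)) + peaks w' else 0.

Fixpoint nodes (t : tree) : nat := if t is Node _ l r then (nodes l + nodes r).+1 else 0.

Fixpoint asc_count (t : tree) : nat :=
  if t is Node _ l r then asc_count l + asc_count r + ~~ is_leaf l else 0.

Fixpoint des_count (t : tree) : nat :=
  if t is Node _ l r then des_count l + des_count r + ~~ is_leaf r else 0.

(** Counts the nodes at which [f] is not the whole fin; on the permutation side, those at which [B1]
    is nonempty. *)
Fixpoint cross_count (t : tree) : nat :=
  if t is Node j l r then cross_count l + cross_count r + (j < fin_size r) else 0.

Lemma count_open_word (a : pred ekind) j l r :
  count a (open_word (Node j l r)) = count a (closed_word r) + count a (open_word l).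
Proof.
rewrite open_wordE !count_cat -[in RHS](cat_take_drop j.+1 (closed_word r)) count_cat; lia.
Qed.

Lemma nLL_word t : nLL (closed_word t) = (asc_count t).+1 /\
  nLL (open_word t) = asc_count t + ~~ is_leaf t.
Proof.
elim: t => [|j l [_ IHl] r [IHr _]] //.
rewrite /closed_word -cats1 count_cat count_open_word IHl IHr /=; lia.
Qed.

Lemma nLR_word t : nLR (closed_word t) = des_count t + ~~ is_leaf t /\
  nLR (open_word t) = (des_count t).+1.
Proof.
elim: t => [|j l [_ IHl] r [IHr _]] //.
rewrite /closed_word -cats1 count_cat count_open_word IHl IHr /=; lia.
Qed.

Lemma peaks_cat a b : peaks (a ++ b) =
  peaks a + peaks b + ((last LL a == LR) && (ohead b == Some UR)).
Proof.
elim: a => [|k a IH] //=; first by rewrite addn0.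
rewrite IH; case: a {IH} => [|k' a] /=; last lia.
by rewrite andbF; lia.
Qed.

Lemma peaks_lower f : lower f -> peaks f = 0.
Proof.
rewrite /lower; elim: f => [|k f IH] //= /andP[_ Lf]; rewrite IH // addn0.
by case: f Lf {IH} => [|k' f] /=; rewrite ?andbF // => /andP[+ _]; case: k' => //=; rewrite andbF.
Qed.

(** Inserting [y] keeps the peaks of [y] and of [f h] unless the cut is at the end of the fin, where
    the first peak of [f h], if there is one, is destroyed. The single edge [y = N] forms a new peak
    with the following [W]; a longer [y] begins with [E] and does not end in [N], so it forms none
    at its ends. *)
Lemma peaks_word t : valid t -> peaks (closed_word t) = cross_count t + ~~ is_leaf t /\
  peaks (open_word t) = cross_count t + ~~ is_leaf t.
Proof.
elim: t => [|j l IHl r IHr] // v; have /and4P[vl vr jr jl] := v.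
rewrite /closed_word -cats1 peaks_cat !andbF !addn0; suff H : peaks (open_word (Node j l r)) =
  cross_count (Node j l r) + ~~ is_leaf (Node j l r) by [].
have [f1 [f2 [g [E1 E2 L12 s1 s2]]]] := fin_split_cut (m := j.+1) (closed_word_fin vr) jr.
have Er : closed_word r = f1 ++ f2 ++ UR :: g by rewrite -E1 -E2 cat_take_drop.
have [IHr1 _] := IHr vr; have [_ IHl2] := IHl vl.
move: L12; rewrite lower_cat => /andP[L1 L2].
rewrite open_wordE E1 E2 (peaks_cat f1) (peaks_cat (open_word l)) IHl2 (peaks_lower L1).
move: IHr1; rewrite Er (peaks_cat f1) (peaks_lower L1).
have hU : (ohead (f2 ++ UR :: g) == Some UR) = (j == fin_size r).
  rewrite /lower in L2; case: (f2) s2 L2 => [|k f2'] s2'.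
    by move=> _; rewrite /= eqxx eqn_leq jr -subn_eq0 -subSS -s2'.
  have -> : (j == fin_size r) = false.
    by apply/eqP => jE; move: s2'; rewrite jE subnn.
  by case/andP; case: k {s2'}.
have lL : j == fin_size r -> (last LL f1 == LR) = ~~ is_leaf r.
  move=> /eqP jE; have f20 : f2 = [::] by apply: size0nil; rewrite s2 jE subnn.
  rewrite f20 /= in Er.
  case: (boolP (is_leaf r)) => [lr|nlr].
    case: (r) lr Er => //= _; case: f1 s1 {L1 E1} => [|a f1] //= _ [<-].
    by case: f1 => [|? []].
  move: (fishword_closed vr nlr) L1; rewrite Er.
  case/lastP: f1 s1 {E1 Er} => [|f1 k] // _; rewrite cat_rcons last_rcons => H.
  rewrite -cats1 lower_cat /= andbT => /andP[_]; rewrite !inE => /orP[] /eqP Ek.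
    by rewrite Ek in H; case: (fishword_noEW H).
  by rewrite Ek.
have hO : (ohead (open_word l ++ f2 ++ UR :: g) == Some UR) = false.
  case: (boolP (is_leaf l)) => [|nl]; first by case: (l).
  have := fishword_ends LL (fishword_closed vl nl).
  case: (l) nl => // j' l' r' _; rewrite /closed_word.
  by case: (open_word _) => [|k w] /= [] // -> _.
have lO : (last LL (open_word l) == LR) = is_leaf l.
  case: (boolP (is_leaf l)) => [|nl]; first by case: (l).
  apply/negbTE/negP => /eqP E; have := fishword_closed vl nl.
  case: (l) nl E => // j' l' r' _; rewrite /closed_word.
  case/lastP: (open_word _) => // w k; rewrite last_rcons => -> .
  by rewrite -cats1 cat_rcons => /fishword_noNS.
rewrite hO hU lO /= andbF !addn0 !add0n.
have ll : is_leaf l -> j == fin_size r by move: jl; case: (is_leaf l).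
have rl : is_leaf r -> j == fin_size r by move: jr; case: (r) => //=; rewrite leqn0.
rewrite /= ltn_neqAle jr andbT.
move: lL ll rl; case: (j == _) => /= [/(_ isT) -> _ _|_ ll rl].
  rewrite andbT; clear; lia.
have -> : is_leaf l = false by apply/negbTE/negP => /ll.
have -> : is_leaf r = false by apply/negbTE/negP => /rl.
rewrite andbF /=; clear; lia.
Qed.

(** * Fish as labelled boundary words *)

(* Every cell of a fish is named by the way it was glued; [CC c b] is glued to
   the upper-right edge of [c] and to the lower-right edge of [b]. *)
Inductive cell := Head | CA of cell | CB of cell | CC of cell & cell.

Fixpoint cell_code (c : cell) : GenTree.tree nat :=
  match c with
  | Head => GenTree.Leaf 0
  | CA c => GenTree.Node 0 [:: cell_code c]
  | CB c => GenTree.Node 1 [:: cell_code c]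
  | CC c b => GenTree.Node 2 [:: cell_code c; cell_code b]
  end.
Fixpoint cell_decode (t : GenTree.tree nat) : cell :=
  match t with
  | GenTree.Node 0 [:: c] => CA (cell_decode c)
  | GenTree.Node 1 [:: c] => CB (cell_decode c)
  | GenTree.Node _ [:: c; b] => CC (cell_decode c) (cell_decode b)
  | _ => Head
  end.
Lemma cell_codeK : cancel cell_code cell_decode.
Proof. by elim=> [|c /= ->|c /= ->|c /= -> b ->]. Qed.
HB.instance Definition _ := Equality.copy cell (can_type cell_codeK).

Definition below (y : cell) : option cell :=
  match y with CA c => Some c | CC c _ => Some c | _ => None end.
Definition above (y : cell) : option cell :=
  match y with CB b => Some b | CC _ b => Some b | _ => None end.

Lemma below_above_inj x y : below x = below y -> above x = above y -> x = y.
Proof. by case: x => [|?|?|? ?]; case: y => [|?|?|? ?] //=; congruence. Qed.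

Definition edge : eqType := (cell * ekind)%type.

(* [e'] follows [e] on the boundary: the gluings crossed when turning around their common
   vertex are read off the names. Up to four may occur, since fish can overlap themselves. *)
Definition adj (e e' : edge) : bool :=
  let: (c, k) := e in let: (d, k') := e' in
  match k, k' with
  | LL, LL => above d == Some c
  | LL, LR | LR, UR | UR, UL => c == d
  | LR, LR => below d == Some c
  | LR, LL => obind below (above d) == Some c
  | UR, UR => above c == Some d
  | UR, LR => isSome (above c) && (above c == below d)
  | UR, LL => isSome (above c) && (above c == obind below (above d))
  | UL, UL => below c == Some d
  | UL, UR => obind above (below c) == Some d
  | UL, LR => isSome (obind above (below c)) && (obind above (below c) == below d)
  | UL, LL => isSome (obind above (below c)) &&
              (obind above (below c) == obind below (above d))
  | _, _ => false
  end.

(** Derivations of boundary words in which each edge carries the name of its cell; the second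
    argument collects the cells glued so far, the latest first. *)
Inductive growth : seq edge -> seq cell -> Prop :=
| gr_head : growth [:: (Head, LL); (Head, LR); (Head, UR); (Head, UL)] [:: Head]
| gr_a p c q X : growth (p ++ (c, UR) :: q) X ->
    growth (p ++ [:: (CA c, LR), (CA c, UR), (CA c, UL) & q]) (CA c :: X)
| gr_b p b q X : growth (p ++ (b, LR) :: q) X ->
    growth (p ++ [:: (CB b, LL), (CB b, LR), (CB b, UR) & q]) (CB b :: X)
| gr_c p c b q X : growth (p ++ [:: (c, UR), (b, LR) & q]) X ->
    growth (p ++ [:: (CC c b, LR), (CC c b, UR) & q]) (CC c b :: X).

Lemma adj_path_replace u u' v v' p q (m m' : seq edge) :
  (forall e, adj e u -> adj e v) -> (forall e, adj u' e -> adj v' e) ->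
  last u m = u' -> last v m' = v' -> path adj v m' ->
  sorted adj (p ++ u :: m ++ q) -> sorted adj (p ++ v :: m' ++ q).
Proof.
move=> Hl Hr lm lm' pm'.
have aux : path adj u (m ++ q) -> path adj v (m' ++ q).
  rewrite !cat_path pm' lm lm' /= => /andP[_].
  by case: q => //= e q /andP[/Hr -> ->].
case: p => [|e p] //=; rewrite !cat_path /= => /andP[-> /andP[/Hl -> /aux ->]] //.
Qed.

Lemma growth_sorted l X : growth l X -> sorted adj l.
Proof.
elim=> [|p c q {}X _ IH|p b q {}X _ IH|p c b q {}X _ IH]; first by [].
- apply: (@adj_path_replace (c, UR) (c, UR) (CA c, LR) (CA c, UL) p q [::] [:: (CA c, UR); (CA c, UL)]) IH => //=; rewrite ?eqxx //;
  by move=> [d [|||]] //= /eqP ->; rewrite /= ?eqxx.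
- apply: (@adj_path_replace (b, LR) (b, LR) (CB b, LL) (CB b, UR) p q [::] [:: (CB b, LR); (CB b, UR)]) IH => //=; rewrite ?eqxx //;
  by move=> [d [|||]] //= /eqP ->; rewrite /= ?eqxx.
- apply: (@adj_path_replace (c, UR) (b, LR) (CC c b, LR) (CC c b, UR) p q [:: (b, LR)] [:: (CC c b, UR)]) IH => //=; rewrite ?eqxx //;
  by move=> [d [|||]] //= /eqP ->; rewrite /= ?eqxx.
Qed.

Definition free (X : seq cell) (e : edge) : bool :=
  (e.1 \in X) && match e.2 with
    | LL => below e.1 == None
    | UL => above e.1 == None
    | LR => all (fun d => above d != Some e.1) X
    | UR => all (fun d => below d != Some e.1) X
    end.

(** The invariant of a growth: the boundary visits each free edge once, every gluing recorded in a
    name stays within [X], and no edge is used by two gluings. *)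
Record boundary (l : seq edge) (X : seq cell) : Prop := Boundary {
  bd_uniq : uniq l;
  bd_mem : forall e, (e \in l) = free X e;
  bd_below : forall c d, d \in X -> below d = Some c -> c \in X;
  bd_above : forall c d, d \in X -> above d = Some c -> c \in X;
  bd_below_inj : forall c d d', d \in X -> d' \in X ->
    below d = Some c -> below d' = Some c -> d = d';
  bd_above_inj : forall c d d', d \in X -> d' \in X ->
    above d = Some c -> above d' = Some c -> d = d' }.

Fixpoint cell_size (c : cell) : nat :=
  match c with
  | Head => 0 | CA c => (cell_size c).+1 | CB c => (cell_size c).+1
  | CC c b => (cell_size c + cell_size b).+1 end.

Lemma below_lt c d : below d = Some c -> cell_size c < cell_size d.
Proof. by case: d => [|d|d|d d'] //= [->]; lia. Qed.
Lemma above_lt c d : above d = Some c -> cell_size c < cell_size d.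
Proof. by case: d => [|d|d|d d'] //= [->]; lia. Qed.

(** Common to the three rules: [old] holds the edges along which [y] is glued, [new] the free edges
    of [y]. *)
Lemma boundary_step (p old new q : seq edge) (X : seq cell) (y : cell) :
  boundary (p ++ old ++ q) X -> y != Head ->
  (forall d k, ((d, k) \in old) =
     match k with UR => below y == Some d | LR => above y == Some d | _ => false end) ->
  (forall d k, ((d, k) \in new) = (d == y) &&
     match k with LL => below y == None | UL => above y == None | _ => true end) ->
  uniq new -> y \notin X /\ boundary (p ++ new ++ q) (y :: X).
Proof.
move=> [ul ml bX aX biX aiX] yH Ho Hn un.
have oldl e : e \in old -> free X e by rewrite -ml !mem_cat => ->; rewrite orbT.
have freeU d : below y = Some d -> free X (d, UR) by move=> E; apply: oldl; rewrite Ho E.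
have freeL d : above y = Some d -> free X (d, LR) by move=> E; apply: oldl; rewrite Ho E.
(* A cell of this name would already occupy the free edges to which [y] is being glued. [Head] is
   glued to nothing, so it has to be excluded. *)
have yX : y \notin X.
  apply/negP => yX; case Eb: (below y) => [d|].
    by have /andP[_ /allP /(_ _ yX)] := freeU d Eb; rewrite Eb eqxx.
  case Ea: (above y) => [d|].
    by have /andP[_ /allP /(_ _ yX)] := freeL d Ea; rewrite Ea eqxx.
  by case: (y) yH Eb Ea => //=.
split=> //.
have fy k : free X (y, k) = false by rewrite /free (negPf yX).
have mpq d k : ((d, k) \in p ++ q) = free X (d, k) && ((d, k) \notin old).
  rewrite -ml !mem_cat; case: (boolP ((d, k) \in old)) => H; rewrite ?orbT ?andbF ?andbT //=.
  move: ul; rewrite uniq_catCA cat_uniq => /and3P[_ /hasPn /(_ (d, k))].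
  rewrite mem_cat; case: (_ || _) => // /(_ isT) /=; by rewrite H.
have by_ : below y != Some y by apply/eqP => /below_lt; rewrite ltnn.
have ay : above y != Some y by apply/eqP => /above_lt; rewrite ltnn.
split.
- rewrite uniq_catCA cat_uniq un /=; apply/andP; split.
    apply/hasPn => -[d k] H; rewrite /= Hn; apply/negP => /andP[/eqP dy _].
    by move: H; rewrite mpq dy fy.
  by move: ul; rewrite uniq_catCA cat_uniq => /and3P[].
- move=> [d k]; have -> : ((d, k) \in p ++ new ++ q) = ((d, k) \in p ++ q) || ((d, k) \in new).
    by rewrite !mem_cat -!orbA; congr orb; rewrite orbC.
  rewrite mpq Ho Hn /free /= inE; have [->|dy] /= := eqVneq d y.
    rewrite (negPf yX) /=; case: k => //=.
      by rewrite ay /=; apply/esym/allP => z zX; apply/eqP => /(aX _ _ zX); apply/negP.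
    by rewrite by_ /=; apply/esym/allP => z zX; apply/eqP => /(bX _ _ zX); apply/negP.
  by rewrite orbF; case: k => //=; rewrite ?andbT // -andbA; congr andb; rewrite andbC.
- move=> c d; rewrite !inE => /orP[/eqP ->|dX] E.
    by have /andP[/= -> _] := freeU _ E; rewrite orbT.
  by rewrite (bX _ _ dX E) orbT.
- move=> c d; rewrite !inE => /orP[/eqP ->|dX] E.
    by have /andP[/= -> _] := freeL _ E; rewrite orbT.
  by rewrite (aX _ _ dX E) orbT.
- move=> c d d'; rewrite !inE => /orP[/eqP ->|dX] /orP[/eqP ->|dX'] E E' //.
  + by have /andP[_ /allP /(_ _ dX')] := freeU _ E; rewrite E' eqxx.
  + by have /andP[_ /allP /(_ _ dX)] := freeU _ E'; rewrite E eqxx.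
  + exact: biX E E'.
- move=> c d d'; rewrite !inE => /orP[/eqP ->|dX] /orP[/eqP ->|dX'] E E' //.
  + by have /andP[_ /allP /(_ _ dX')] := freeL _ E; rewrite E' eqxx.
  + by have /andP[_ /allP /(_ _ dX)] := freeL _ E'; rewrite E eqxx.
  + exact: aiX E E'.
Qed.

Lemma grow_a p c q X y : y = CA c -> boundary (p ++ (c, UR) :: q) X ->
  y \notin X /\ boundary (p ++ [:: (y, LR), (y, UR), (y, UL) & q]) (y :: X).
Proof.
move=> -> B; apply: (boundary_step (old := [:: (c, UR)]) (new := [:: (CA c, LR); (CA c, UR); (CA c, UL)]) B) => //.
- by move=> d k; rewrite inE xpair_eqE; case: k; rewrite ?andbF ?andbT //= eq_sym.
- by move=> d k; rewrite !inE !xpair_eqE; case: eqP => // _; case: k.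
- by rewrite /= !inE !xpair_eqE !andbF.
Qed.

Lemma grow_b p b q X y : y = CB b -> boundary (p ++ (b, LR) :: q) X ->
  y \notin X /\ boundary (p ++ [:: (y, LL), (y, LR), (y, UR) & q]) (y :: X).
Proof.
move=> -> B; apply: (boundary_step (old := [:: (b, LR)]) (new := [:: (CB b, LL); (CB b, LR); (CB b, UR)]) B) => //.
- by move=> d k; rewrite inE xpair_eqE; case: k; rewrite ?andbF ?andbT //= eq_sym.
- by move=> d k; rewrite !inE !xpair_eqE; case: eqP => // _; case: k.
- by rewrite /= !inE !xpair_eqE !andbF.
Qed.

Lemma grow_c p c b q X y : y = CC c b -> boundary (p ++ [:: (c, UR), (b, LR) & q]) X ->
  y \notin X /\ boundary (p ++ [:: (y, LR), (y, UR) & q]) (y :: X).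
Proof.
move=> -> B; apply: (boundary_step (old := [:: (c, UR); (b, LR)]) (new := [:: (CC c b, LR); (CC c b, UR)]) B) => //.
- by move=> d k; rewrite !inE !xpair_eqE; case: k; rewrite ?andbF ?andbT ?orbF //= eq_sym.
- by move=> d k; rewrite !inE !xpair_eqE; case: eqP => // _; case: k.
- by rewrite /= !inE !xpair_eqE !andbF.
Qed.

Lemma boundary_head : boundary [:: (Head, LL); (Head, LR); (Head, UR); (Head, UL)] [:: Head].
Proof.
split=> //.
- by move=> [d k]; rewrite !inE !xpair_eqE /free inE /=; case: eqP => // ->; case: k.
- by move=> c d; rewrite inE => /eqP ->.
- by move=> c d; rewrite inE => /eqP ->.
- by move=> c d d'; rewrite !inE => /eqP -> /eqP ->.
- by move=> c d d'; rewrite !inE => /eqP -> /eqP ->.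
Qed.

Lemma growth_boundary l X : growth l X -> boundary l X.
Proof.
elim=> [|p c q {}X _ IH|p b q {}X _ IH|p c b q {}X _ IH]; first exact: boundary_head.
- by have [] := grow_a erefl IH.
- by have [] := grow_b erefl IH.
- by have [] := grow_c erefl IH.
Qed.

Definition kinds (l : seq edge) : seq ekind := [seq e.2 | e <- l].

Lemma growth_fishword l X : growth l X -> fishword (kinds l).
Proof.
rewrite /kinds; elim=> [|p c q {}X _|p b q {}X _|p c b q {}X _]; first exact: fw_head;
rewrite !map_cat /=; [exact: fw_a|exact: fw_b|exact: fw_c].
Qed.

Lemma kinds_split l p q : kinds l = p ++ q ->
  exists p' q', [/\ l = p' ++ q', kinds p' = p & kinds q' = q].
Proof.
move=> E; exists (take (size p) l), (drop (size p) l).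
by rewrite cat_take_drop /kinds map_take map_drop -/(kinds l) E take_size_cat // drop_size_cat.
Qed.

Lemma fishword_growth w : fishword w -> exists l X, growth l X /\ kinds l = w.
Proof.
elim=> [|p q _ [l [X [G /kinds_split [p' [q' [El <- Eq]]]]]]|p q _ [l [X [G /kinds_split [p' [q' [El <- Eq]]]]]]|p q _ [l [X [G /kinds_split [p' [q' [El <- Eq]]]]]]].
- by do 2!eexists; split; first exact: gr_head.
- case: q' El Eq => [|[c k] q'] //= El [Ek <-]; subst.
  by do 2!eexists; split; [exact: gr_a G|rewrite /kinds map_cat].
- case: q' El Eq => [|[c k] q'] //= El [Ek <-]; subst.
  by do 2!eexists; split; [exact: gr_b G|rewrite /kinds map_cat].
- case: q' El Eq => [|[c k] [|[b k'] q']] //= El [Ek Ek' <-]; subst.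
  by do 2!eexists; split; [exact: gr_c G|rewrite /kinds map_cat].
Qed.

Lemma growth_first l X : growth l X -> exists m, l = (Head, LL) :: m.
Proof.
elim=> [|p c q {}X _ [m]|p b q {}X _ [m]|p c b q {}X _ [m]]; first by eexists.
all: by case: p => [|e p] //= [-> _]; eexists.
Qed.

(** * Retraction of tails *)

Lemma adj_tail p y z q : sorted adj (p ++ [:: (y, LR), (z, UR) & q]) -> y = z.
Proof.
case: p => [|e p] /=; first by case/andP=> /eqP.
by rewrite cat_path /= => /and4P[_ _ /eqP].
Qed.

(** Here [p] and [q] surround the edges [N] and [W] of a tail [y], and undoing the gluing recorded
    in its name must leave a growth. Cells are compared as sets because the order of gluing changes.
    A tail at [Head] occurs only in the fish with a single cell. *)
Definition retract (X : seq cell) (p : seq edge) (y : cell) (q : seq edge) : Prop :=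
  match y with
  | Head => [/\ p = [:: (Head, LL)], q = [:: (Head, UL)] & X =i [:: Head]]
  | CA c => exists q' X', [/\ q = (y, UL) :: q', growth (p ++ (c, UR) :: q') X' & X =i y :: X']
  | CB b => exists p' X', [/\ p = rcons p' (y, LL), growth (p' ++ (b, LR) :: q) X' & X =i y :: X']
  | CC c b => exists X', growth (p ++ [:: (c, UR), (b, LR) & q]) X' /\ X =i y :: X'
  end.

Definition glues (old new : seq edge) (y : cell) : Prop :=
  forall p q X, growth (p ++ old ++ q) X -> growth (p ++ new ++ q) (y :: X).

Lemma eq_mem_swap (X X' : seq cell) y z : X =i y :: X' -> z :: X =i y :: z :: X'.
Proof. by move=> E x; rewrite !inE E inE orbCA. Qed.

(** Gluing [z] to the left of the tail [y] commutes with retracting [y]. The condition on the kinds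
    in [old] protects the edge [(y, LL)], which may end the left part and disappears together with
    [y]. *)
Lemma retract_glue_left a old new e z X y q : glues old new z ->
  old != [::] -> all (fun f => f.2 != LL) old ->
  retract X (a ++ old ++ e) y q -> retract (z :: X) (a ++ new ++ e) y q.
Proof.
move=> gl o0 okind; case: y => [|c|b|c b] /=.
- case: a => [|? a] /= [E].
    by case: (old) o0 okind E => //= f old2 _ /andP[fk _] [Ef _]; rewrite Ef in fk.
  by case: E => _; case: (a) => //=; case: (old) o0.
- move=> [q' [X' [-> G EX]]]; exists q', (z :: X'); split=> //.
    by rewrite -!catA; apply: gl; rewrite !catA in G *.
  exact: eq_mem_swap.
- move=> [p' [X' [Ep G EX]]].
  case/lastP: e Ep => [|e f].
    case/lastP: old o0 okind {gl} => // old f _; rewrite all_rcons => /andP[fk _].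
    by rewrite cats0 -rcons_cat => /rcons_inj [_ Ef]; rewrite Ef in fk.
  rewrite -!rcons_cat => /rcons_inj [Ep ->].
  exists (a ++ new ++ e), (z :: X'); split=> //; last exact: eq_mem_swap.
  by rewrite -!catA; apply: gl; rewrite -Ep in G; rewrite !catA in G *.
- move=> [X' [G EX]]; exists (z :: X'); split; last exact: eq_mem_swap.
  by rewrite -!catA; apply: gl; rewrite !catA in G *.
Qed.

Lemma retract_glue_right p old new e b z X y : glues old new z ->
  old != [::] -> all (fun f => f.2 != UL) old ->
  retract X p y (e ++ old ++ b) -> retract (z :: X) p y (e ++ new ++ b).
Proof.
move=> gl o0 okind; case: y => [|c|d|c d] /=.
- case: e => [|? e] /= [_ E].
    by case: (old) o0 okind E => //= f old2 _ /andP[fk _] [Ef _]; rewrite Ef in fk.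
  by case: E => _; case: (e) => //=; case: (old) o0.
- move=> [q' [X' [Eq G EX]]].
  case: e Eq => [|f e] /=.
    by case: old o0 okind {gl} => //= f old _ /andP[fk _] [Ef]; rewrite Ef in fk.
  move=> [-> Eq]; exists (e ++ new ++ b), (z :: X'); split=> //; last exact: eq_mem_swap.
  rewrite -Eq in G; have := gl (p ++ (c, UR) :: e) b X'; rewrite -!catA; exact.
- move=> [p' [X' [Ep G EX]]]; exists p', (z :: X'); split=> //; last exact: eq_mem_swap.
  have := gl (p' ++ (d, LR) :: e) b X'; rewrite -!catA; exact.
- move=> [X' [G EX]]; exists (z :: X'); split=> //; last exact: eq_mem_swap.
  have := gl (p ++ (c, UR) :: (d, LR) :: e) b X'; rewrite -!catA; exact.
Qed.

(* A tail of a fish other than its head may always be assumed to be the last glued cell. *)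
Lemma growth_retract l X p y q : growth l X -> l = p ++ [:: (y, LR), (y, UR) & q] ->
  retract X p y q.
Proof.
move=> G; elim: G p q => [|a c b {}X G IH|a d b {}X G IH|a c d b {}X G IH] p q.
- move=> E; have sp : size p + size q = 2.
    by move/(congr1 size): (E); rewrite size_cat /=; lia.
  by case: p E sp => [|? [|? [|? p]]] //= [*]; subst => //; lia.
- have gl : glues [:: (c, UR)] [:: (CA c, LR); (CA c, UR); (CA c, UL)] (CA c).
    by move=> ? ? ?; apply: gr_a.
  move=> E; have [[e [Ep Eq]]|[e [e0 [Ea Eq]]]] := cat_eq_cat_strict E.
    case: e Ep Eq => [|e1 [|e2 [|e3 e]]] //= Ep [].
      by rewrite cats0 in Ep; move=> <- _ <-; rewrite Ep; exists b, X.
    move=> E1 E2 E3 Eb; rewrite Ep -E1 -E2 -E3.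
    apply: (retract_glue_left (old := [:: (c, UR)]) (new := [:: (CA c, LR); (CA c, UR); (CA c, UL)]) gl) => //.
    by apply: IH; rewrite Eb -!catA.
  case: e e0 Ea Eq => [|e1 [|e2 e]] // _ Ea [E1 E2 ->]; subst e1 e2.
  apply: (retract_glue_right (old := [:: (c, UR)]) gl) => //.
  by apply: IH; rewrite Ea -!catA.
- have gl : glues [:: (d, LR)] [:: (CB d, LL); (CB d, LR); (CB d, UR)] (CB d).
    by move=> ? ? ?; apply: gr_b.
  move=> E; have [[e [Ep Eq]]|[e [e0 [Ea Eq]]]] := cat_eq_cat_strict E.
    case: e Ep Eq => [|e1 [|e2 [|e3 e]]] //= Ep [].
      by move=> E1 <- _ <-; rewrite Ep -E1; exists a, X; rewrite cats1.
    move=> E1 E2 E3 Eb; rewrite Ep -E1 -E2 -E3.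
    apply: (retract_glue_left (old := [:: (d, LR)]) (new := [:: (CB d, LL); (CB d, LR); (CB d, UR)]) gl) => //.
    by apply: IH; rewrite Eb -!catA.
  case: e e0 Ea Eq => [|e1 [|e2 e]] // _ Ea [E1 E2 ->]; subst e1 e2.
  apply: (retract_glue_right (old := [:: (d, LR)]) gl) => //.
  by apply: IH; rewrite Ea -!catA.
- have gl : glues [:: (c, UR); (d, LR)] [:: (CC c d, LR); (CC c d, UR)] (CC c d).
    by move=> ? ? ?; apply: gr_c.
  move=> E; have [[e [Ep Eq]]|[e [e0 [Ea Eq]]]] := cat_eq_cat_strict E.
    case: e Ep Eq => [|e1 [|e2 e]] //= Ep [].
      by rewrite cats0 in Ep; move=> <- _ <-; rewrite Ep; exists X.
    move=> E1 E2 Eb; rewrite Ep -E1 -E2.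
    apply: (retract_glue_left (old := [:: (c, UR); (d, LR)]) (new := [:: (CC c d, LR); (CC c d, UR)]) gl) => //.
    by apply: IH; rewrite Eb -!catA.
  case: e e0 Ea Eq => [|e1 [|e2 e]] // _ Ea [E1 E2 ->]; subst e1 e2.
  apply: (retract_glue_right (old := [:: (c, UR); (d, LR)]) gl) => //.
  by apply: IH; rewrite Ea -!catA.
Qed.

Lemma kinds_cat p q : kinds (p ++ q) = kinds p ++ kinds q.
Proof. exact: map_cat. Qed.

Lemma growth_noNS l X p q : growth l X -> kinds l = p ++ [:: LR, UL & q] -> False.
Proof. by move=> /growth_fishword + E; rewrite E; apply: fishword_noNS. Qed.

Lemma growth_noEW l X p q : growth l X -> kinds l = p ++ [:: LL, UR & q] -> False.
Proof. by move=> /growth_fishword + E; rewrite E; apply: fishword_noEW. Qed.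

Lemma kinds_cat_inj (p q p' q' : seq edge) : kinds p = kinds p' ->
  p ++ q = p' ++ q' -> p = p' /\ q = q'.
Proof.
by move=> /(congr1 size); rewrite !size_map => sp /eqP; rewrite eqseq_cat // => /andP[/eqP -> /eqP ->].
Qed.

Lemma eq_mem_cons (X X' Y : seq cell) y : X =i X' -> Y =i y :: X' -> y :: X =i Y.
Proof. by move=> E EY z; rewrite EY !inE E. Qed.

(** The last cell of the first growth is a tail, and the second growth has a tail at the same place,
    which can be retracted as well. Both tails were glued in the same way, since otherwise one of
    the retracted words would have a factor [NS] or [EW], or wrong end letters. Induction applies to
    what remains. *)
Lemma growth_kinds_inj l1 X1 l2 X2 : growth l1 X1 -> growth l2 X2 ->
  kinds l1 = kinds l2 -> l1 = l2 /\ X1 =i X2.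
Proof.
move=> G1; elim: G1 l2 X2 => [|p c q X G IH|p c q X G IH|p c d q X G IH] l2 X2 G2.
- case: l2 G2 => [|[e1 k1] [|[e2 k2] [|[e3 k3] [|[e4 k4] [|? ?]]]]] // G2 [] *; subst.
  have [m [E1 _]] := growth_first G2.
  have /= := growth_sorted G2; rewrite andbT => /and3P[/eqP E2 /eqP E3 /eqP E4].
  subst; have [_ _ EX] := growth_retract (p := [:: (Head, LL)]) G2 erefl.
  by split.
- rewrite kinds_cat => /esym /kinds_split [p2 [q2 [El Ep]]].
  case: q2 El => [|[y k1] [|[z k2] [|[t k3] q2]]] // El [K1 K2 K3 Hq]; subst l2 k1 k2 k3.
  have Ez := adj_tail (growth_sorted G2); subst z.
  have := growth_retract G2 erefl; case: y G2 => [|c'|c'|c' d'] G2 /=.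
  + case=> Ep2 [_ Eq] _; subst.
    have := growth_fishword G; rewrite kinds_cat -Ep /=.
    by case: (q) Hq => // _ /(fishword_ends LL) [].
  + move=> [q' [X' [[Et Eq] G' EX]]]; subst q' t.
    have [|/(kinds_cat_inj (esym Ep)) [-> [-> ->]] EX'] := IH _ _ G'.
      by rewrite !kinds_cat /= Ep Hq.
    by split=> //; exact: eq_mem_cons EX' EX.
  + move=> [p' [X' [_ G' _]]].
    by case: (growth_noNS G' (kinds_cat _ _)).
  + move=> [X' [G' _]].
    by case: (@growth_noNS _ _ (rcons (kinds p2) UR) (kinds q2) G'); rewrite kinds_cat cat_rcons.
- rewrite kinds_cat => /esym /kinds_split [p2 [q2 [El Ep]]].
  case: q2 El => [|[s k0] [|[y k1] [|[z k2] q2]]] // El [K1 K2 K3 Hq]; subst l2 k0 k1 k2.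
  rewrite -cat_rcons in G2; have Ez := adj_tail (growth_sorted G2); subst z.
  have := growth_retract G2 erefl; case: y G2 => [|c'|c'|c' d'] G2 /=.
  + case=> Ep2 Eq _; case: p2 Ep2 {G2} Ep => [|? [|? ?]] // _ Ep.
    by move: (growth_fishword G); rewrite kinds_cat -Ep => /(fishword_ends LL) [].
  + move=> [q' [X' [_ G' _]]].
    by case: (@growth_noEW _ _ (kinds p2) (kinds q') G'); rewrite cat_rcons kinds_cat.
  + move=> [p' [X' [/rcons_inj [Ep2 Es] G' EX]]]; subst p' s.
    have [|/(kinds_cat_inj (esym Ep)) [-> [-> ->]] EX'] := IH _ _ G'.
      by rewrite !kinds_cat /= Ep Hq.
    by split=> //; exact: eq_mem_cons EX' EX.
  + move=> [X' [G' _]].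
    by case: (@growth_noEW _ _ (kinds p2) (LR :: kinds q2) G'); rewrite cat_rcons kinds_cat.
- rewrite kinds_cat => /esym /kinds_split [p2 [q2 [El Ep]]].
  case: q2 El => [|[y k1] [|[z k2] q2]] // El [K1 K2 Hq]; subst l2 k1 k2.
  have Ez := adj_tail (growth_sorted G2); subst z.
  have := growth_retract G2 erefl; case: y G2 => [|c'|c'|c' d'] G2 /=.
  + case=> Ep2 Eq _; subst.
    by case: (@growth_noEW _ _ [::] (LR :: kinds q) G); rewrite kinds_cat -Ep.
  + move=> [q' [X' [Eq _ _]]]; subst q2.
    by case: (@growth_noNS _ _ (rcons (kinds p) UR) (kinds q') G); rewrite kinds_cat /= -Hq cat_rcons.
  + move=> [p' [X' [Ep2 _ _]]]; subst p2.
    case: (@growth_noEW _ _ (kinds p') (LR :: kinds q) G); rewrite kinds_cat -Ep /=.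
    by rewrite /kinds map_rcons cat_rcons.
  + move=> [X' [G' EX]].
    have [|/(kinds_cat_inj (esym Ep)) [-> [-> -> ->]] EX'] := IH _ _ G'.
      by rewrite !kinds_cat /= Ep Hq.
    by split=> //; exact: eq_mem_cons EX' EX.
Qed.

Lemma liftcP n (z : 'I_n.+1) : z = ord_max \/ exists z', z = liftc z'.
Proof.
case: (unliftP ord_max z) => [z' ->|->]; [right; exists z'|by left].
by apply: val_inj; rewrite /= /bump leqNgt ltn_ord.
Qed.

Lemma liftc_neq n (z : 'I_n) : liftc z != ord_max.
Proof. by rewrite -val_eqE /= neq_ltn ltn_ord. Qed.

Lemma liftc_inj n : injective (@liftc n).
Proof. by move=> x y /(congr1 val) /= /val_inj. Qed.

Lemma unlift_liftc n (z : 'I_n) : unlift ord_max (liftc z) = Some z.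
Proof.
case: unliftP => [z' /(congr1 val) /= E|/eqP]; last by rewrite (negPf (liftc_neq z)).
by congr Some; apply: val_inj; rewrite /= E /bump leqNgt ltn_ord.
Qed.

Lemma ext_liftc n (g : 'I_n -> option 'I_n) z : ext g (liftc z) = omap (@liftc n) (g z).
Proof. by rewrite /ext unlift_liftc. Qed.

Lemma ext_max n (g : 'I_n -> option 'I_n) : ext g ord_max = None.
Proof. by rewrite /ext unlift_none. Qed.

Lemma ext_set_liftc n (g : 'I_n -> option 'I_n) x z :
  ext_set g x (liftc z) = if z == x then Some ord_max else omap (@liftc n) (g z).
Proof. by rewrite /ext_set (inj_eq (@liftc_inj n)) ext_liftc. Qed.

Lemma ext_set_max n (g : 'I_n -> option 'I_n) x : ext_set g x ord_max = None.
Proof. by rewrite /ext_set eq_sym (negPf (liftc_neq x)) ext_max. Qed.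

(** * Fish data *)

(** The gluings of [F] must be those that the names record. Names live in one fixed type, so fish
    with different index sets become comparable. *)
Record labelled (F : FishData) (lam : 'I_(fsize F) -> cell) (X : seq cell) : Prop := Labelled {
  lab_inj : injective lam;
  lab_img : forall c, c \in X <-> exists x, lam x = c;
  lab_head : lam (fhead F) = Head;
  lab_ur : forall x y, fur F x = Some y <-> below (lam y) = Some (lam x);
  lab_dr : forall x y, fdr F x = Some y <-> above (lam y) = Some (lam x) }.

Definition extend_label n (lam : 'I_n -> cell) (y : cell) (z : 'I_n.+1) : cell :=
  if unlift ord_max z is Some z' then lam z' else y.

Lemma extend_label_liftc n (lam : 'I_n -> cell) y z : extend_label lam y (liftc z) = lam z.
Proof. by rewrite /extend_label unlift_liftc. Qed.

Lemma extend_label_max n (lam : 'I_n -> cell) y : extend_label lam y ord_max = y.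
Proof. by rewrite /extend_label unlift_none. Qed.

Lemma label_step (F : FishData) lam X y (gu gd : 'I_(fsize F).+1 -> option 'I_(fsize F).+1) l l' :
  labelled lam X -> boundary l X -> y \notin X -> boundary l' (y :: X) ->
  (forall z, gu (liftc z) = if below y == Some (lam z) then Some ord_max
                            else omap (@liftc _) (fur F z)) -> gu ord_max = None ->
  (forall z, gd (liftc z) = if above y == Some (lam z) then Some ord_max
                            else omap (@liftc _) (fdr F z)) -> gd ord_max = None ->
  @labelled (@MkFish (fsize F).+1 gu gd (liftc (fhead F))) (extend_label lam y) (y :: X).
Proof.
move=> [li lim lh lu ld] B yX B' gu1 gu2 gd1 gd2.
have mX z : lam z \in X by apply/lim; exists z.
have by_ : below y != Some y by apply/eqP => /below_lt; rewrite ltnn.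
have ay : above y != Some y by apply/eqP => /above_lt; rewrite ltnn.
split=> /=.
- move=> z z'; case: (liftcP z) => [->|[w ->]]; case: (liftcP z') => [->|[w' ->]];
  rewrite ?extend_label_max ?extend_label_liftc //.
  + by move=> E; move: yX; rewrite E mX.
  + by move=> E; move: yX; rewrite -E mX.
  + by move=> /li ->.
- move=> c; rewrite inE; split.
    case/orP=> [/eqP ->|/lim [x <-]]; first by exists ord_max; rewrite extend_label_max.
    by exists (liftc x); rewrite extend_label_liftc.
  case=> z <-; case: (liftcP z) => [->|[w ->]];
  by rewrite ?extend_label_max ?extend_label_liftc ?eqxx ?mX ?orbT.
- by rewrite extend_label_liftc.
- move=> z z'; case: (liftcP z) => [->|[w ->]]; last first.
    rewrite gu1 extend_label_liftc; case: eqP => [E|E]; case: (liftcP z') => [->|[w' ->]];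
    rewrite ?extend_label_max ?extend_label_liftc //; split=> // E'.
    + by move/Some_inj/eqP: E'; rewrite eq_sym (negPf (liftc_neq w')).
    + have := bd_below_inj B' (mem_head _ _) _ E E'.
      by rewrite inE mX orbT => /(_ isT) Ey; rewrite Ey mX in yX.
    + by case: (fur F w) E' => //= a /Some_inj/eqP; rewrite (negPf (liftc_neq a)).
    + by case Ef: (fur F w) E' => [a|] //= /Some_inj/liftc_inj <-; apply/lu.
    + by move/lu: E' => ->.
  rewrite gu2 extend_label_max; split=> // /eqP; case: (liftcP z') => [->|[w' ->]].
    by rewrite extend_label_max (negPf by_).
  by rewrite extend_label_liftc => /eqP /(bd_below B (mX _)); rewrite (negPf yX).
- move=> z z'; case: (liftcP z) => [->|[w ->]]; last first.
    rewrite gd1 extend_label_liftc; case: eqP => [E|E]; case: (liftcP z') => [->|[w' ->]];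
    rewrite ?extend_label_max ?extend_label_liftc //; split=> // E'.
    + by move/Some_inj/eqP: E'; rewrite eq_sym (negPf (liftc_neq w')).
    + have := bd_above_inj B' (mem_head _ _) _ E E'.
      by rewrite inE mX orbT => /(_ isT) Ey; rewrite Ey mX in yX.
    + by case: (fdr F w) E' => //= a /Some_inj/eqP; rewrite (negPf (liftc_neq a)).
    + by case Ef: (fdr F w) E' => [a|] //= /Some_inj/liftc_inj <-; apply/ld.
    + by move/ld: E' => ->.
  rewrite gd2 extend_label_max; split=> // /eqP; case: (liftcP z') => [->|[w' ->]].
    by rewrite extend_label_max (negPf ay).
  by rewrite extend_label_liftc => /eqP /(bd_above B (mX _)); rewrite (negPf yX).
Qed.

Lemma lab_ur_None F lam l X x : @labelled F lam X -> boundary l X ->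
  fur F x = None <-> (lam x, UR) \in l.
Proof.
move=> [li lim lh lu ld] B; rewrite (bd_mem B) /free /=.
have -> /= : lam x \in X by apply/lim; exists x.
split=> [E|/allP H].
  by apply/allP => d /lim [y <-]; apply/eqP => /lu; rewrite E.
case E: (fur F x) => [y|] //; move/lu: E => E.
have: lam y \in X by apply/lim; exists y.
by move/H; rewrite E eqxx.
Qed.

Lemma lab_dr_None F lam l X x : @labelled F lam X -> boundary l X ->
  fdr F x = None <-> (lam x, LR) \in l.
Proof.
move=> [li lim lh lu ld] B; rewrite (bd_mem B) /free /=.
have -> /= : lam x \in X by apply/lim; exists x.
split=> [E|/allP H].
  by apply/allP => d /lim [y <-]; apply/eqP => /ld; rewrite E.
case E: (fdr F x) => [y|] //; move/ld: E => E.
have: lam y \in X by apply/lim; exists y.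
by move/H; rewrite E eqxx.
Qed.

Lemma grow_label_a F lam p q X x : @labelled F lam X -> growth (p ++ (lam x, UR) :: q) X ->
  @labelled (@MkFish (fsize F).+1 (ext_set (fur F) x) (ext (fdr F)) (liftc (fhead F)))
    (extend_label lam (CA (lam x))) (CA (lam x) :: X).
Proof.
move=> L G; have B := growth_boundary G; have [yX B'] := grow_a erefl B.
apply: (label_step L B yX B') => [z||z|].
- by rewrite ext_set_liftc /= (inj_eq (@Some_inj _)) (inj_eq (lab_inj L)) eq_sym.
- by rewrite ext_set_max.
- by rewrite ext_liftc.
- by rewrite ext_max.
Qed.

Lemma grow_label_b F lam p q X x : @labelled F lam X -> growth (p ++ (lam x, LR) :: q) X ->
  @labelled (@MkFish (fsize F).+1 (ext (fur F)) (ext_set (fdr F) x) (liftc (fhead F)))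
    (extend_label lam (CB (lam x))) (CB (lam x) :: X).
Proof.
move=> L G; have B := growth_boundary G; have [yX B'] := grow_b erefl B.
apply: (label_step L B yX B') => [z||z|].
- by rewrite ext_liftc.
- by rewrite ext_max.
- by rewrite ext_set_liftc /= (inj_eq (@Some_inj _)) (inj_eq (lab_inj L)) eq_sym.
- by rewrite ext_set_max.
Qed.

Lemma grow_label_c F lam p q X c b : @labelled F lam X ->
  growth (p ++ [:: (lam c, UR), (lam b, LR) & q]) X ->
  @labelled (@MkFish (fsize F).+1 (ext_set (fur F) c) (ext_set (fdr F) b) (liftc (fhead F)))
    (extend_label lam (CC (lam c) (lam b))) (CC (lam c) (lam b) :: X).
Proof.
move=> L G; have B := growth_boundary G; have [yX B'] := grow_c erefl B.
by apply: (label_step L B yX B') => [z||z|];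
  rewrite ?ext_set_liftc ?ext_set_max //= (inj_eq (@Some_inj _)) (inj_eq (lab_inj L)) eq_sym.
Qed.

(** The rule [fg_c] speaks of a common neighbour [a], whereas [gr_c] needs its two edges to be
    consecutive on the boundary. They are: among the edges that [adj] allows after [(c, UR)], every
    one other than [(b, LR)] contradicts the freeness of some edge. *)
Lemma fish_gen_growth F : fish_gen F -> exists lam l X, @labelled F lam X /\ growth l X.
Proof.
elim=> [|{}F x _ [lam [l [X [L G]]]] E|{}F x _ [lam [l [X [L G]]]] E|{}F a b c _ [lam [l [X [L G]]]] Eb Ec Eb' Ec'].
- exists (fun=> Head), [:: (Head, LL); (Head, LR); (Head, UR); (Head, UL)], [:: Head].
  split; last exact: gr_head.
  split=> //=.
  + by move=> x y _; rewrite !ord1.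
  + move=> c; rewrite inE; split=> [/eqP ->|[_ <-]] //; by exists ord0.
- have [p [q El]] := mem_split ((lab_ur_None x L (growth_boundary G)).1 E); subst l.
  exists (extend_label lam (CA (lam x))); do 2!eexists; split; last exact: gr_a G.
  exact: grow_label_a L G.
- have [p [q El]] := mem_split ((lab_dr_None x L (growth_boundary G)).1 E); subst l.
  exists (extend_label lam (CB (lam x))); do 2!eexists; split; last exact: gr_b G.
  exact: grow_label_b L G.
- have B := growth_boundary G.
  have lc := (lab_ur_None c L B).1 Ec'; have lb := (lab_dr_None b L B).1 Eb'.
  have {}Eb := (lab_ur L _ _).1 Eb; have {}Ec := (lab_dr L _ _).1 Ec.
  have [p [q El]] := mem_split lc; subst l.
  have [e [q' Eq]] : exists e q', q = e :: q'.
    have := growth_fishword G; rewrite kinds_cat => /fishword_lastE /(_ isT) [k].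
    by case: (q) => [|e q'] ; [case: k|exists e, q'].
  subst q; have Ae : adj (lam c, UR) e.
    have := growth_sorted G; case: (p) => [|e0 p0] /=; first by case/andP.
    by rewrite cat_path /= => /and4P[].
  have me : free X e by rewrite -(bd_mem B) mem_cat !inE eqxx !orbT.
  have mX z : lam z \in X by apply/(lab_img L); exists z.
  have Ee : e = (lam b, LR).
    have [aX bI] := (bd_above B, bd_below_inj B).
    case: e Ae me {G lb B lc} => d [] /=; rewrite /free ?Ec /=.
    + case Ed: (above d) => [x|] //= /eqP Ex /andP[dX _].
      have Exb : x = lam b by apply: bI Eb => //; apply: aX Ed.
      rewrite Exb in Ed.
      move/(lab_img L): dX => [z Ez]; rewrite -Ez in Ed.
      by move/(lab_dr L): Ed; rewrite Eb'.
    + move=> /eqP /esym Ex /andP[dX _]; congr pair; exact: bI Eb.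
    + move=> /eqP [<-] /andP[_ /allP /(_ _ (mX b))].
      by rewrite Eb eqxx.
    + by move=> /eqP <- /andP[_]; rewrite Ec.
  subst e.
  exists (extend_label lam (CC (lam c) (lam b))); do 2!eexists; split; last exact: gr_c G.
  exact: grow_label_c L G.
Qed.

(** Conversely, the common neighbour required by [fg_c] is read off from the adjacency of the two
    consecutive edges. *)
Lemma growth_fish_gen l X : growth l X -> exists F lam, fish_gen F /\ @labelled F lam X.
Proof.
elim=> [|p c q {}X G [F [lam [Fg L]]]|p b q {}X G [F [lam [Fg L]]]|p c b q {}X G [F [lam [Fg L]]]].
- exists (@MkFish 1 (fun _ => None) (fun _ => None) ord0), (fun=> Head).
  split; first exact: fg_head.
  split=> //=.
  + by move=> x y _; rewrite !ord1.
  + move=> c; rewrite inE; split=> [/eqP ->|[_ <-]] //; by exists ord0.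
- have B := growth_boundary G.
  have lc : (c, UR) \in p ++ (c, UR) :: q by rewrite mem_cat mem_head orbT.
  have /(lab_img L) [x Ex] : c \in X by move: lc; rewrite (bd_mem B) => /andP[].
  subst c; do 2!eexists; split; last exact: grow_label_a L G.
  by apply: fg_a => //; apply/(lab_ur_None x L B).
- have B := growth_boundary G.
  have lc : (b, LR) \in p ++ (b, LR) :: q by rewrite mem_cat mem_head orbT.
  have /(lab_img L) [x Ex] : b \in X by move: lc; rewrite (bd_mem B) => /andP[].
  subst b; do 2!eexists; split; last exact: grow_label_b L G.
  by apply: fg_b => //; apply/(lab_dr_None x L B).
- have B := growth_boundary G.
  have lc : (c, UR) \in p ++ [:: (c, UR), (b, LR) & q] by rewrite mem_cat mem_head orbT.
  have lb : (b, LR) \in p ++ [:: (c, UR), (b, LR) & q].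
    by rewrite mem_cat !inE eqxx !orbT.
  have cX : c \in X by move: lc; rewrite (bd_mem B) => /andP[].
  have bX : b \in X by move: lb; rewrite (bd_mem B) => /andP[].
  have : adj (c, UR) (b, LR).
    have := growth_sorted G; case: (p) => [|e0 p0] /=; first by case/andP.
    by rewrite cat_path /= => /and4P[].
  rewrite /=; case Ec: (above c) => [a|] //= /eqP /esym Eb.
  have /(lab_img L) [z Ez] := bd_above B cX Ec.
  have /(lab_img L) [x Ex] := cX; have /(lab_img L) [y Ey] := bX.
  subst a c b; do 2!eexists; split; last exact: grow_label_c L G.
  apply: (@fg_c F z) => //.
  + by apply/(lab_ur L).
  + by apply/(lab_dr L).
  + by apply/(lab_dr_None y L B).
  + by apply/(lab_ur_None x L B).
Qed.

Lemma labelled_iso F F' lam lam' X X' : @labelled F lam X -> @labelled F' lam' X' ->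
  X =i X' -> fish_iso F F'.
Proof.
move=> L L' EX.
have tr : forall x, exists x', lam' x' = lam x.
  by move=> x; apply/(lab_img L'); rewrite -EX; apply/(lab_img L); exists x.
have rt : forall x', exists x, lam x = lam' x'.
  by move=> x'; apply/(lab_img L); rewrite EX; apply/(lab_img L'); exists x'.
pose f x := odflt (fhead F') [pick x' | lam' x' == lam x].
pose g x' := odflt (fhead F) [pick x | lam x == lam' x'].
have fE x : lam' (f x) = lam x.
  rewrite /f; case: pickP => [x' /eqP //|H]; have [x' Ex] := tr x.
  by have := H x'; rewrite Ex eqxx.
have gE x' : lam (g x') = lam' x'.
  rewrite /g; case: pickP => [x /eqP //|H]; have [x Ex] := rt x'.
  by have := H x; rewrite Ex eqxx.
have fK : cancel f g by move=> x; apply: (lab_inj L); rewrite gE fE.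
have gK : cancel g f by move=> x; apply: (lab_inj L'); rewrite fE gE.
exists f; split.
- by exists g.
- by apply: (lab_inj L'); rewrite fE (lab_head L) (lab_head L').
- move=> x; case E: (fur F x) => [y|] /=.
    by apply/(lab_ur L'); rewrite !fE; apply/(lab_ur L).
  case E': (fur F' (f x)) => [y'|] //; move/(lab_ur L'): E'; rewrite fE -gE.
  by move/(lab_ur L); rewrite E.
- move=> x; case E: (fdr F x) => [y|] /=.
    by apply/(lab_dr L'); rewrite !fE; apply/(lab_dr L).
  case E': (fdr F' (f x)) => [y'|] //; move/(lab_dr L'): E'; rewrite fE -gE.
  by move/(lab_dr L); rewrite E.
Qed.

(** A name is determined by the names of the lower-left and upper-left neighbours, which are smaller
    terms. An isomorphism respects these neighbours and, being bijective, also their absence. *)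
Lemma iso_label F F' lam lam' X X' l l' (f : 'I_(fsize F) -> 'I_(fsize F')) :
  @labelled F lam X -> @labelled F' lam' X' -> boundary l X -> boundary l' X' ->
  bijective f -> f (fhead F) = fhead F' ->
  (forall x, fur F' (f x) = omap f (fur F x)) ->
  (forall x, fdr F' (f x) = omap f (fdr F x)) ->
  forall x, lam' (f x) = lam x.
Proof.
move=> L L' B B' [g fK gK] fh fu fd x.
have [n] := ubnP (cell_size (lam x)); elim: n x => // n IH x sx.
have mX z : lam z \in X by apply/(lab_img L); exists z.
have mX' z : lam' z \in X' by apply/(lab_img L'); exists z.
apply: below_above_inj.
- case E: (below (lam x)) => [c|].
    have /(lab_img L) [z Ez] := bd_below B (mX x) E; subst c.
    rewrite -IH; last by have := below_lt E; lia.
    by apply/(lab_ur L'); rewrite fu ((lab_ur L _ _).2 E).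
  case E': (below _) => [c|] //.
  have /(lab_img L') [z Ez] := bd_below B' (mX' _) E'; subst c.
  move/(lab_ur L'): E'; rewrite -(gK z) fu; case Ez: (fur F (g z)) => [y|] //= /Some_inj.
  by move/(can_inj fK) => Ey; move/(lab_ur L): Ez; rewrite Ey E.
- case E: (above (lam x)) => [c|].
    have /(lab_img L) [z Ez] := bd_above B (mX x) E; subst c.
    rewrite -IH; last by have := above_lt E; lia.
    by apply/(lab_dr L'); rewrite fd ((lab_dr L _ _).2 E).
  case E': (above _) => [c|] //.
  have /(lab_img L') [z Ez] := bd_above B' (mX' _) E'; subst c.
  move/(lab_dr L'): E'; rewrite -(gK z) fd; case Ez: (fdr F (g z)) => [y|] //= /Some_inj.
  by move/(can_inj fK) => Ey; move/(lab_dr L): Ez; rewrite Ey E.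
Qed.

(** * The boundary walk *)

Section Walk.
Local Arguments outgoing : simpl never.
Variables (F : FishData) (lam : 'I_(fsize F) -> cell) (X : seq cell) (l : seq edge).
Hypotheses (L : @labelled F lam X) (B : boundary l X).

Let mX z : lam z \in X. Proof. by apply/(lab_img L); exists z. Qed.

Lemma glued_LR x y : above (lam y) = Some (lam x) -> @glued F (x, LR) = Some (y, UL).
Proof. by move/(lab_dr L) => /= ->. Qed.

Lemma glued_UR x y : below (lam y) = Some (lam x) -> @glued F (x, UR) = Some (y, LL).
Proof. by move/(lab_ur L) => /= ->. Qed.

Lemma glued_UL x y : above (lam y) = Some (lam x) -> @glued F (y, UL) = Some (x, LR).
Proof.
move=> E /=; case: pickP => [z /eqP/(lab_dr L)|/(_ x)]; last first.
  by move/(lab_dr L): E => ->; rewrite eqxx.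
by rewrite E => /Some_inj/(lab_inj L) ->.
Qed.

Lemma glued_LL x y : below (lam y) = Some (lam x) -> @glued F (y, LL) = Some (x, UR).
Proof.
move=> E /=; case: pickP => [z /eqP/(lab_ur L)|/(_ x)]; last first.
  by move/(lab_ur L): E => ->; rewrite eqxx.
by rewrite E => /Some_inj/(lab_inj L) ->.
Qed.

Lemma glued_free x k : (lam x, k) \in l -> @glued F (x, k) = None.
Proof.
case: k => H /=.
- case: pickP => //= z /eqP /(lab_ur L) E; move: H; rewrite (bd_mem B) => /andP[_ /=].
  by rewrite E.
- by rewrite ((lab_dr_None x L B).2 H).
- by rewrite ((lab_ur_None x L B).2 H).
- case: pickP => //= z /eqP /(lab_dr L) E; move: H; rewrite (bd_mem B) => /andP[_ /=].
  by rewrite E.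
Qed.

Lemma outgoingS n x k : @outgoing F n.+1 (x, k) =
  if glued (x, k) is Some (x', k') then outgoing n (x', nextk k') else (x, k).
Proof. by []. Qed.

Lemma outgoing_free n x k : (lam x, k) \in l -> @outgoing F n (x, k) = (x, k).
Proof. by case: n => // n /glued_free E; rewrite outgoingS E. Qed.

Lemma outgoing_glued n x k x' k' : @glued F (x, k) = Some (x', k') ->
  @outgoing F n.+1 (x, k) = outgoing n (x', nextk k').
Proof. by move=> E; rewrite outgoingS E. Qed.

Lemma bsucc_adj x k x' k' : (lam x', k') \in l -> adj (lam x, k) (lam x', k') ->
  @bsucc F (x, k) = (x', k').
Proof.
(* The longest turn, from a [UL] edge to an [LL] edge, crosses four gluings; the cell [x] shows that
   [F] is nonempty, so the fuel suffices. *)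
have fuel : exists m, 4 * fsize F = m.+4.
  by exists (4 * fsize F - 4); have := ltn_ord x; lia.
rewrite /bsucc; case: fuel => m ->; move=> H.
case: k; case: k' H => H; rewrite /adj //.
- move=> /eqP E; rewrite (outgoing_glued _ (glued_LR E)); exact: outgoing_free.
- move=> /eqP/(lab_inj L) ->; exact: outgoing_free.
- case E1: (above (lam x')) => [c|] //= E2.
  have /(lab_img L) [z Ez] := bd_above B (mX x') E1; subst c.
  rewrite (outgoing_glued _ (glued_UR (eqP E2))) (outgoing_glued _ (glued_LR E1)).
  exact: outgoing_free.
- move=> /eqP E; rewrite (outgoing_glued _ (glued_UR E)); exact: outgoing_free.
- move=> /eqP/(lab_inj L) ->; exact: outgoing_free.
- case E1: (above (lam x)) => [a|] //=; case E2: (above (lam x')) => [c|] //= /eqP/esym E3.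
  have /(lab_img L) [z Ez] := bd_above B (mX x') E2.
  have /(lab_img L) [z' Ez'] := bd_above B (mX x) E1; subst a c.
  rewrite (outgoing_glued _ (glued_UL E1)) (outgoing_glued _ (glued_UR E3)).
  rewrite (outgoing_glued _ (glued_LR E2)); exact: outgoing_free.
- case E1: (above (lam x)) => [a|] //= /eqP/esym E3.
  have /(lab_img L) [z' Ez'] := bd_above B (mX x) E1; subst a.
  rewrite (outgoing_glued _ (glued_UL E1)) (outgoing_glued _ (glued_UR E3)).
  exact: outgoing_free.
- move=> /eqP E; rewrite (outgoing_glued _ (glued_UL E)); exact: outgoing_free.
- move=> /eqP/(lab_inj L) ->; exact: outgoing_free.
- case E0: (below (lam x)) => [b|] //=; case E1: (above b) => [a|] //=.
  case E2: (above (lam x')) => [c|] //= /eqP/esym E3.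
  have /(lab_img L) [z Ez] := bd_above B (mX x') E2.
  have /(lab_img L) [y Ey] := bd_below B (mX x) E0; subst b.
  have /(lab_img L) [z' Ez'] := bd_above B (mX y) E1; subst a c.
  rewrite (outgoing_glued _ (glued_LL E0)) (outgoing_glued _ (glued_UL E1)).
  rewrite (outgoing_glued _ (glued_UR E3)) (outgoing_glued _ (glued_LR E2)).
  exact: outgoing_free.
- case E0: (below (lam x)) => [b|] //=; case E1: (above b) => [a|] //= /eqP/esym E3.
  have /(lab_img L) [y Ey] := bd_below B (mX x) E0; subst b.
  have /(lab_img L) [z' Ez'] := bd_above B (mX y) E1; subst a.
  rewrite (outgoing_glued _ (glued_LL E0)) (outgoing_glued _ (glued_UL E1)).
  rewrite (outgoing_glued _ (glued_UR E3)); exact: outgoing_free.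
- case E0: (below (lam x)) => [b|] //= /eqP E1.
  have /(lab_img L) [y Ey] := bd_below B (mX x) E0; subst b.
  rewrite (outgoing_glued _ (glued_LL E0)) (outgoing_glued _ (glued_UL E1)).
  exact: outgoing_free.
- move=> /eqP E; rewrite (outgoing_glued _ (glued_LL E)); exact: outgoing_free.
Qed.

Definition lab_edge (e : 'I_(fsize F) * ekind) : edge := (lam e.1, e.2).

Lemma lab_edge_onto e : e \in l -> exists e', lab_edge e' = e.
Proof.
case: e => c k; rewrite (bd_mem B) => /andP[/= /(lab_img L) [x <-] _].
by exists (x, k).
Qed.

Lemma walk_adj m e : sorted adj (lab_edge e :: m) -> {subset m <= l} ->
  lab_edge e :: m = [seq lab_edge e' | e' <- traject (@bsucc F) e (size m).+1].
Proof.
elim: m e => [|e1 m IH] //= e /andP[A P] sub.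
have [e' Ee] := lab_edge_onto (sub _ (mem_head _ _)); subst e1.
have -> : bsucc e = e'.
  case: e A {P} => x k A; case: e' A sub => x' k' A sub.
  by apply: bsucc_adj A; apply: sub; rewrite mem_head.
have -> := IH e' P; last by move=> z zm; apply: sub; rewrite inE zm orbT.
by [].
Qed.

End Walk.

(** Since the word is produced by iterating [bsucc], it does not depend on the order of gluing; this
    is what makes it an invariant of the fish. *)
Lemma growth_walk F lam X l : @labelled F lam X -> growth l X ->
  l = [seq lab_edge lam e | e <- traject (@bsucc F) (fin_start F) (size l)].
Proof.
move=> L G; have B := growth_boundary G; have [m El] := growth_first G.
have hl : (Head, LL) \in l by rewrite El mem_head.
have E0 : (Head, LL) = lab_edge lam (fin_start F).
  rewrite /fin_start (outgoing_free L B) /lab_edge /= ?(lab_head L) //.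
rewrite {1 2}El E0 /=; apply: (walk_adj L B).
  by rewrite -E0 -El; apply: growth_sorted G.
by move=> e em; rewrite El inE em orbT.
Qed.

(** An isomorphism preserves names, so [lam] also labels [F] by [X']. Both words are then walks on
    [F] from the same edge, of equal length because the length is the number of free edges. *)
Lemma iso_kinds F F' lam lam' X X' l l' :
  @labelled F lam X -> growth l X -> @labelled F' lam' X' -> growth l' X' ->
  fish_iso F F' -> kinds l = kinds l'.
Proof.
move=> L G L' G' [f [bf fh fu fd]].
have [B B'] := (growth_boundary G, growth_boundary G').
have E := iso_label L L' B B' bf fh fu fd; case: bf => g fK gK.
have EX : X =i X'.
  move=> c; apply/idP/idP => [/(lab_img L) [x <-]|/(lab_img L') [x <-]].
    by rewrite -E; apply/(lab_img L'); exists (f x).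
  by rewrite -(gK x) E; apply/(lab_img L); exists (g x).
have LF : labelled lam X'.
  split; [exact: lab_inj L| |exact: lab_head L|exact: lab_ur L|exact: lab_dr L].
  by move=> c; rewrite -EX; exact: (lab_img L).
have sl : size l = size l'.
  apply/perm_size/uniq_perm; [exact: bd_uniq B|exact: bd_uniq B'|].
  move=> [c k]; rewrite (bd_mem B) (bd_mem B') /free EX; congr andb.
  by case: k => //; apply: eq_all_r.
by rewrite (growth_walk L G) (growth_walk LF G') sl.
Qed.

(** * Statistics of a fish read off its boundary word *)

Lemma card_edges F lam X l (k : ekind) (Q : pred cell) : @labelled F lam X -> boundary l X ->
  #|[pred x | ((lam x, k) \in l) && Q (lam x)]| = count (fun e => (e.2 == k) && Q e.1) l.
Proof.
move=> L B; rewrite -size_filter -(size_map fst) cardE -(size_map lam).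
apply/perm_size/uniq_perm.
- by rewrite map_inj_uniq ?enum_uniq //; apply: lab_inj L.
- rewrite map_inj_in_uniq ?filter_uniq ?(bd_uniq B) //.
  move=> [c k1] [d k2]; rewrite !mem_filter /=.
  by move=> /andP[/andP[/eqP -> _] _] /andP[/andP[/eqP -> _] _] ->.
move=> c; apply/mapP/mapP.
  move=> [x]; rewrite mem_enum inE => /andP[xl Qx] ->.
  by exists (lam x, k); rewrite // mem_filter eqxx Qx.
move=> [[d k']]; rewrite mem_filter /= => /andP[/andP[/eqP -> Qd] dl] ->.
move: (dl); rewrite (bd_mem B) => /andP[/= /(lab_img L) [x Ex] _].
by exists x; rewrite // mem_enum inE Ex dl.
Qed.

Lemma count_kinds k l : count (fun e : edge => (e.2 == k) && true) l = count_mem k (kinds l).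
Proof. by rewrite count_map; apply: eq_count => e /=; rewrite andbT. Qed.

Lemma left_lower_free_count F lam X l : @labelled F lam X -> growth l X ->
  left_lower_free F = nLL (kinds l).
Proof.
move=> L G; have B := growth_boundary G.
rewrite -count_kinds -(card_edges LL xpredT L B); apply: eq_card => x; rewrite !inE andbT.
rewrite (bd_mem B) /free /=; have -> /= : lam x \in X by apply/(lab_img L); exists x.
apply/idP/eqP.
  move=> /existsPn H; case E: (below (lam x)) => [c|] //.
  have xX : lam x \in X by apply/(lab_img L); exists x.
  have /(lab_img L) [z Ez] := bd_below B xX E; subst c.
  by have := H z; rewrite ((lab_ur L _ _).2 E) eqxx.
by move=> E; apply/existsPn => a; apply/eqP => /(lab_ur L); rewrite E.
Qed.

Lemma right_lower_free_count F lam X l : @labelled F lam X -> growth l X ->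
  right_lower_free F = nLR (kinds l).
Proof.
move=> L G; have B := growth_boundary G.
rewrite -count_kinds -(card_edges LR xpredT L B); apply: eq_card => x; rewrite !inE andbT.
by have [h1 h2] := lab_dr_None x L B; apply/eqP/idP.
Qed.

(** If the boundary does not pass from [(c, LR)] to [(c, UR)], then turning at their common vertex
    meets a cell glued to [(c, UR)]. Hence the tails are the factors [NW] of the word. *)
Lemma peak_adj l X c d k : boundary l X -> (c, LR) \in l -> (d, k) \in l ->
  adj (c, LR) (d, k) -> ((c, UR) \in l) = (k == UR).
Proof.
move=> B; rewrite !(bd_mem B) => /andP[/= cX _] dl A; rewrite /free /= cX /=.
move: A dl; case: k => //=.
- case Ed: (above d) => [x|] //= /eqP Ex /andP[dX _].
  by apply/negbTE/allPn; exists x; [exact: bd_above B _ _ _ Ed|rewrite Ex eqxx].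
- by move=> /eqP Ed /andP[dX _]; apply/negbTE/allPn; exists d; rewrite // Ed eqxx.
- by move=> /eqP -> /andP[_ ->].
Qed.

Lemma tails_count F lam X l : @labelled F lam X -> growth l X -> tails F = peaks (kinds l).
Proof.
move=> L G; have B := growth_boundary G.
have -> : tails F = count (fun e => (e.2 == LR) && ((e.1, UR) \in l)) l.
  rewrite -(card_edges LR (fun c => (c, UR) \in l) L B); apply: eq_card => x; rewrite !inE.
  have [[h1 h2] [h3 h4]] := (lab_dr_None x L B, lab_ur_None x L B).
  by rewrite andbC; congr andb; apply/eqP/idP.
suff aux p m : l = p ++ m -> count (fun e => (e.2 == LR) && ((e.1, UR) \in l)) m = peaks (kinds m).
  exact: (aux [::]).
elim: m p => [|[c k] m IH] p // El.
rewrite [LHS]/= (IH (rcons p (c, k))) ?cat_rcons //=; congr (nat_of_bool _ + _).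
case: eqP => //= kE; subst k; case: m El {IH} => [|[d k'] m] El /=.
  by have /(fishword_ends LL) [_] := growth_fishword G; rewrite El kinds_cat last_cat.
have A : adj (c, LR) (d, k').
  have := growth_sorted G; rewrite El; case: (p) => [|e0 p0] /=; first by case/andP.
  by rewrite cat_path /= => /and3P[_ _ /andP[]].
by rewrite (peak_adj B _ _ A) // El mem_cat !inE eqxx !orbT.
Qed.

Lemma fin_length_kinds F lam X l f g : @labelled F lam X -> growth l X ->
  kinds l = f ++ UR :: g -> lower f -> fin_length F (size f).
Proof.
move=> L G El Lf; have B := growth_boundary G.
pose e j := iter j (@bsucc F) (fin_start F).
pose x0 := lab_edge lam (fin_start F).
have nthE j : j < size l -> nth x0 l j = lab_edge lam (e j).
  move=> jl; rewrite {1}(growth_walk L G) (nth_map (fin_start F)) ?size_traject //.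
  by rewrite nth_traject.
have kindE j : j < size l -> (e j).2 = nth LL (kinds l) j.
  by move=> jl; rewrite /kinds (nth_map x0) // nthE.
have adjE j : j.+1 < size l -> adj (lab_edge lam (e j)) (lab_edge lam (e j.+1)).
  move=> jl; rewrite -!nthE //; last exact: ltnW.
  by move/(sortedP x0): (growth_sorted G); apply.
have sl : size l = size f + (size g).+1.
  by rewrite -(size_map snd l) -/(kinds l) El size_cat.
have tailE j : j.+1 < size l ->
    ends_at_tail (e j) = ((e j).2 == LR) && ((e j.+1).2 == UR).
  move=> jl; have A := adjE j jl; move: A.
  have jl' := ltnW jl.
  have := mem_nth x0 jl'; have := mem_nth x0 jl; rewrite !nthE //.
  case: (e j) => c k; case: (e j.+1) => d k'; rewrite /lab_edge /= => dl cl A.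
  case: k cl A => //= cl A; rewrite /ends_at_tail /=.
  rewrite ((lab_dr_None c L B).2 cl) eqxx andbT -(peak_adj B cl dl A).
  by have [h1 h2] := lab_ur_None c L B; apply/eqP/idP.
have kf j : j < size f -> nth LL (kinds l) j \in [:: LL; LR].
  by move=> jf; rewrite El nth_cat jf; apply: (allP Lf); apply: mem_nth.
have f0 : 0 < size f.
  by have [m Em] := growth_first G; case: (f) El => //; rewrite Em.
have kUR : nth LL (kinds l) (size f) = UR by rewrite El nth_cat ltnn subnn.
split=> //.
- have pf : (size f).-1.+1 = size f by rewrite prednK.
  have A := adjE (size f).-1; have K := kf (size f).-1.
  have kl := kindE (size f).-1; have kr := kindE (size f).
  rewrite kUR in kr; rewrite -/(e _) tailE pf; last by lia.
  rewrite pf sl in A; have {}A := A ltac:(lia); have {}K := K ltac:(lia).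
  rewrite sl in kl kr; have {}kl := kl ltac:(lia); have {}kr := kr ltac:(lia).
  move: A K kr; rewrite -kl /lab_edge => A K kr; rewrite kr in A *.
  (* The last edge of [f] is not [LL], since [adj] allows no passage from [LL] to [UR]. *)
  by move: K A; rewrite !inE => /orP[] /eqP ->.
- move=> j jf; rewrite -/(e _) tailE; last by lia.
  have kj := kindE j.+1 ltac:(lia); have K := kf j.+1 ltac:(lia).
  by rewrite kj negb_and orbC; move: K; rewrite !inE => /orP[] /eqP ->.
Qed.

(** * Stack sorting *)

Lemma stack_sort_fuelE k s : size s <= k -> stack_sort_fuel k s = stack_sort s.
Proof.
rewrite /stack_sort; have [n] := ubnP (size s); elim: n s k => // n IH s k.
case: s k => [|x s] [|k] //; rewrite [size _]/= !ltnS => sn sk.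
pose m := foldr maxn 0 (x :: s); pose i := index m (x :: s).
have i_le : i <= size s.
  have : m \in x :: s.
    rewrite /m /=; elim: (s) (x) => [|y t IHt] z /=; first by rewrite maxn0 mem_head.
    by rewrite {1}/maxn; case: ifP => _; rewrite inE ?IHt ?orbT ?eqxx.
  by rewrite -index_mem ltnS.
have st : size (take i (x :: s)) <= size s by rewrite size_take /=; case: ltnP => // ?; lia.
have sd : size (drop i.+1 (x :: s)) <= size s by rewrite size_drop /=; lia.
have E j : stack_sort_fuel j.+1 (x :: s) = stack_sort_fuel j (take i (x :: s)) ++
  stack_sort_fuel j (drop i.+1 (x :: s)) ++ [:: m] by [].
rewrite !E; move: (take _ _) (drop _ _) st sd => a b sa sb.
by rewrite !(IH _ k) ?(IH _ (size s)) //; lia.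
Qed.

Lemma foldr_max_cat m a b : all (gtn m) a -> all (geq m) b ->
  foldr maxn 0 (a ++ m :: b) = m.
Proof.
elim: a => [|x a IH] /=.
  move=> _; elim: b => [|y b IHb] /=; first by rewrite maxn0.
  by case/andP=> ym /IHb; lia.
by case/andP=> xm /IH H /H ->; lia.
Qed.

Lemma stack_sort_cat m a b : all (gtn m) a -> all (geq m) b ->
  stack_sort (a ++ m :: b) = stack_sort a ++ stack_sort b ++ [:: m].
Proof.
move=> ha hb; rewrite {1}/stack_sort.
have -> : size (a ++ m :: b) = (size a + size b).+1 by rewrite size_cat /= addnS.
rewrite /=; case E: (a ++ m :: b) => [|x s]; first by case: (a) E.
rewrite -E foldr_max_cat // index_cat ifF; last first.
  by apply/negP => /(allP ha) /=; rewrite ltnn.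
have D : drop (size a).+1 (a ++ m :: b) = b.
  by rewrite drop_cat ltnNge leqnSn /= subSnn /= drop0.
by rewrite /= eqxx addn0 take_size_cat // D !stack_sort_fuelE ?leq_addr ?leq_addl.
Qed.

Lemma split_max s : s != [::] -> exists a m b,
  [/\ s = a ++ m :: b, all (gtn m) a & all (geq m) b].
Proof.
elim: s => // x s IH _; have [->|/IH [a [m [b [-> ha hb]]]]] := eqVneq s [::].
  by exists [::], x, [::].
case: (ltnP x m) => xm.
  by exists (x :: a), m, b; rewrite /= xm.
exists [::], x, (a ++ m :: b); split=> //=; rewrite all_cat /= xm /=; apply/andP; split.
  by apply: sub_all ha => y /= ?; lia.
by apply: sub_all hb => y /= ?; lia.
Qed.

Lemma perm_stack_sort s : perm_eq (stack_sort s) s.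
Proof.
have [n] := ubnP (size s); elim: n s => // n IH s.
have [->//|/split_max [a [m [b [-> ha hb]]]]] := eqVneq s [::].
rewrite size_cat /= => sn; rewrite stack_sort_cat //.
rewrite perm_sym -cat_rcons -cats1 -catA; apply: perm_cat.
  by rewrite perm_sym IH //; lia.
by rewrite perm_catC; apply: perm_cat => //; rewrite perm_sym IH //; lia.
Qed.

Lemma split_max_uniq (s : seq nat) : uniq s -> s != [::] -> exists (a : seq nat) (m : nat) (b : seq nat),
  [/\ s = a ++ m :: b, all (gtn m) a & all (gtn m) b].
Proof.
move=> us /split_max [a [m [b [Es ha hb]]]]; exists a, m, b; split=> //.
move: us; rewrite Es cat_uniq /= => /and3P[_ _ /andP[mb _]].
apply/allP => x xb /=; have /= xm := allP hb x xb; rewrite ltn_neqAle xm andbT.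
by apply: contra mb => /eqP <-.
Qed.

Fixpoint avoids231 (s : seq nat) : bool :=
  if s is x :: s' then
    pairwise (fun y z => ~~ ((z < x) && (x < y))) s' && avoids231 s'
  else true.

Lemma avoids231_catr a b : avoids231 (a ++ b) -> avoids231 b.
Proof. by elim: a => //= x a IH /andP[_ /IH]. Qed.

Lemma avoids231_catl a b : avoids231 (a ++ b) -> avoids231 a.
Proof.
elim: a => //= x a IH /andP[]; rewrite pairwise_cat => /and3P[_ -> _] /IH ->.
by [].
Qed.

Lemma avoids231_mid a y b x z : avoids231 (a ++ y :: b) -> uniq (a ++ b) ->
  x \in a -> x < y -> z \in b -> x < z.
Proof.
move=> av ua /mem_split [u [v Ea]] xy zb; move: av ua; rewrite Ea -catA => /avoids231_catr /=.
rewrite pairwise_cat pairwise_cons => /andP[/and3P[_ _ /andP[/allP /(_ z zb) /= H _]] _].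
move: H; rewrite xy andbT -leqNgt leq_eqVlt => /orP[/eqP xz|//].
rewrite -catA cat_uniq /= mem_cat => /and3P[_ _ /andP[]].
by rewrite negb_or xz zb andbF.
Qed.

Lemma avoids231_cat a b : allrel ltn a b -> avoids231 (a ++ b) = avoids231 a && avoids231 b.
Proof.
elim: a => //= x a IH; rewrite allrel_consl => /andP[xb /IH ->].
rewrite pairwise_cat; have -> : allrel (fun y z => ~~ ((z < x) && (x < y))) a b.
  by apply/allrelP => y z _ /(allP xb) /= h; rewrite negb_and -leqNgt ltnW.
have -> : pairwise (fun y z => ~~ ((z < x) && (x < y))) b.
  elim: b xb {IH} => //= y b IHb /andP[xy xb]; rewrite IHb // andbT.
  by apply/allP => z /(allP xb) /= h; rewrite negb_and -leqNgt ltnW.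
by rewrite andbT /= andbA.
Qed.

Lemma pairwise_below x m s : all (gtn m) s ->
  pairwise (fun y z => ~~ ((z < x) && (m < y))) s.
Proof.
elim: s => //= y s IH /andP[ym /IH ->]; rewrite andbT.
by apply/allP => z _; rewrite negb_and -(leqNgt y) (ltnW ym) orbT.
Qed.

Lemma pairwise_above x m s : all (ltn m) s ->
  pairwise (fun y z => ~~ ((z < m) && (x < y))) s.
Proof.
elim: s => //= y s IH /andP[ym] ms; rewrite IH // andbT.
by apply/allP => z /(allP ms) /= mz; rewrite negb_and -leqNgt ltnW.
Qed.

Lemma avoids231_max (a : seq nat) (m : nat) (b : seq nat) : uniq (a ++ m :: b) -> all (gtn m) a -> all (gtn m) b ->
  avoids231 (a ++ m :: b) = [&& allrel ltn a b, avoids231 a & avoids231 b].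
Proof.
move=> u ha hb; have uab : uniq (a ++ b).
  by move: u; rewrite -cat_rcons -cats1 -catA uniq_catCA cat_uniq => /and3P[].
apply/idP/and3P => [av|[hab ava avb]].
  split; [|exact: avoids231_catl av|].
    apply/allrelP => x y xa yb; apply: (avoids231_mid av uab xa _ yb).
    exact: (allP ha).
  by have /= /andP[] := avoids231_catr av.
rewrite avoids231_cat ?ava /= ?avb ?andbT ?pairwise_below //.
by rewrite allrel_consr hab andbT; apply/allP => x /(allP ha).
Qed.

(** Knuth's criterion. The output consists of the two sorted parts followed by the maximum, so it
    increases exactly when both parts become sorted and the left one lies below the right one, which
    is the recursion of [avoids231_max]. *)
Lemma sorted_stack_sort (s : seq nat) : uniq s -> sorted ltn (stack_sort s) = avoids231 s.
Proof.
have [n] := ubnP (size s); elim: n s => // n IH s sn us.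
have [->//|/(split_max_uniq us) [a [m [b [Es ha hb]]]]] := eqVneq s [::].
rewrite Es in us sn *; have hb' : all (geq m) b by apply: sub_all hb => x /= /ltnW.
rewrite stack_sort_cat // avoids231_max //.
move: sn; rewrite size_cat /= => sn.
move: (us); rewrite cat_uniq /= => /and3P[ua _ /andP[_ ub]].
rewrite -(IH a) ?ua -?(IH b) ?ub //; try by lia.
rewrite !(sorted_pairwise ltn_trans) pairwise_cat [pairwise _ (_ ++ [:: m])]pairwise_cat /= andbT.
have -> : allrel ltn (stack_sort a) (stack_sort b ++ [:: m]) = allrel ltn a b.
  apply/allrelP/allrelP => H x y.
    by move=> xa yb; apply: H; rewrite ?mem_cat !(perm_mem (perm_stack_sort _)) ?xa ?yb.
  rewrite mem_cat inE !(perm_mem (perm_stack_sort _)) => xa /orP[yb|/eqP ->]; first exact: H.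
  exact: (allP ha).
have -> : allrel ltn (stack_sort b) [:: m].
  apply/allrelP => x y; rewrite inE (perm_mem (perm_stack_sort _)) => xb /eqP ->.
  exact: (allP hb).
by [].
Qed.

(** Serves the ascents and descents of a permutation and, applied to the increasing list of values,
    the values that precede their predecessor. *)
Fixpoint steps (r : rel nat) (s : seq nat) : nat :=
  if s is x :: s' then nat_of_bool (if s' is y :: _ then r x y else false) + steps r s' else 0.

Lemma count_steps r s :
  count (fun i => r (nth 0 s i) (nth 0 s i.+1)) (iota 0 (size s).-1) = steps r s.
Proof.
elim: s => [|x [|y s] IH] //; rewrite -[RHS]/(r x y + steps r (y :: s)) -IH.
rewrite [_.-1]/= -[iota 0 _]/(0 :: iota (1 + 0) (size s)) iotaDl /= count_map.
by congr addn; apply: eq_count.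
Qed.

Lemma steps_cat r a x b : steps r (a ++ x :: b) =
  steps r a + steps r (x :: b) + nat_of_bool (if a is y :: a' then r (last y a') x else false).
Proof.
elim: a => [|y a IH]; first by rewrite addn0.
rewrite cat_cons [LHS]/= IH; case: a {IH} => [|z a] /=; lia.
Qed.

Lemma steps_max r a m b : steps r (a ++ m :: b) =
  steps r a + steps r b + nat_of_bool (if a is y :: a' then r (last y a') m else false)
  + nat_of_bool (if b is y :: _ then r m y else false).
Proof. by rewrite steps_cat /=; lia. Qed.

(** The places where [s] splits as a direct sum. The end of [s] is always one of them, whence the
    extra cut in [ltr_maxima_cuts]. *)
Definition cut (s : seq nat) (c : nat) : bool := allrel ltn (take c s) (drop c s).

Definition cut_positions (s : seq nat) : seq nat := filter (cut s) (iota 0 (size s).+1).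

Lemma ltr_maxima_cuts s : uniq s -> avoids231 s ->
  (ltr_maxima s).+1 = size (cut_positions s).
Proof.
move=> us av; rewrite /cut_positions -(addn1 (size s)) iotaD filter_cat size_cat add0n /=.
have -> : cut s (size s) by rewrite /cut take_size drop_size allrel0r.
rewrite addn1; congr _.+1.
rewrite size_filter /ltr_maxima; apply: eq_in_count => i; rewrite mem_iota /= add0n => si.
have Es : s = take i s ++ nth 0 s i :: drop i.+1 s by rewrite -drop_nth // cat_take_drop.
rewrite /cut (drop_nth 0 si) allrel_consr.
have -> : all (fun j => nth 0 s j < nth 0 s i) (iota 0 i) = all (ltn^~ (nth 0 s i)) (take i s).
  rewrite -[in RHS](map_nth_iota0 0 (ltnW si)) all_map; exact: eq_all.
(* An earlier entry lies below the left-to-right maximum at [i], and avoidance of 231 puts it below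
   all later entries too. *)
case: allP => //= H; apply/esym/allrelP => x y xs ys.
have u2 : uniq (take i s ++ drop i.+1 s).
  by move: us; rewrite {1}Es -cat_rcons -cats1 -catA uniq_catCA cat_uniq => /and3P[].
rewrite Es in av; apply: (avoids231_mid av u2 xs _ ys); exact: H.
Qed.

(** * Permutations of trees *)

(* The cut positions of the sequence [q] of [tree_perm]: for [Node j l r] it is
   [a ++ m1 :: b1 ++ b2 ++ [:: m]] with [a < b1 < m1 < b2 < m], where [b1 ++ b2] comes
   from [r] and [b2] has [j] left-to-right maxima. *)
Fixpoint cuts (t : tree) : seq nat :=
  if t is Node j l r then
    take (fin_size l) (cuts l) ++
    [seq nodes l + c | c <- drop (fin_size r - j) (cuts r)] ++ [:: (nodes l + nodes r).+1]
  else [:: 0].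

(* [tree_perm t V p q]: [p] arranges the sorted values [V] according to [t], and [q] is
   the sequence obtained from [p] by one pass through the stack. *)
Inductive tree_perm : tree -> seq nat -> seq nat -> seq nat -> Prop :=
| tree_perm_leaf : tree_perm Leaf [::] [::] [::]
| tree_perm_right r V p q m : tree_perm r V p q -> all (gtn m) V ->
    tree_perm (Node (fin_size r) Leaf r) (rcons V m) (m :: p) (rcons q m)
| tree_perm_node j l r A m1 B1 B2 m pl ql pr qr :
    tree_perm l (rcons A m1) pl ql -> tree_perm r (B1 ++ B2) pr qr -> j <= fin_size r ->
    size B1 = nth 0 (cuts r) (fin_size r - j) ->
    sorted ltn (A ++ B1 ++ m1 :: rcons B2 m) ->
    tree_perm (Node j l r) (A ++ B1 ++ m1 :: rcons B2 m) (pl ++ m :: pr) (ql ++ rcons qr m).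

Lemma sorted_parts A B1 m1 B2 m : sorted ltn (A ++ B1 ++ m1 :: rcons B2 m) ->
  [/\ allrel ltn A (B1 ++ B2), all (gtn m1) A, all (gtn m1) B1, all (ltn m1) B2
    & all (gtn m) (A ++ B1 ++ m1 :: B2)].
Proof.
rewrite (sorted_pairwise ltn_trans) -cats1.
have -> : A ++ B1 ++ m1 :: B2 ++ [:: m] = (A ++ B1 ++ m1 :: B2) ++ [:: m] by rewrite -!catA.
rewrite pairwise_cat allrel1r => /and3P[hm h _]; move: h.
rewrite pairwise_cat => /and3P[hA _ h]; move: h.
rewrite pairwise_cat pairwise_cons allrel_consr => /and4P[/andP[hB _] _ hm1 _].
move: hA; rewrite allrel_catr allrel_consr => /and3P[a1 a2 a3].
by split=> //; rewrite allrel_catr a1.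
Qed.

Lemma tree_perm_perm_eq t V p q : tree_perm t V p q -> perm_eq p V /\ perm_eq q V.
Proof.
elim=> // {t V p q} [r V p q m _ [/permP IHp /permP IHq] _|j l r A m1 B1 B2 m pl ql pr qr _ [/permP IHlp /permP IHlq] _ [/permP IHrp /permP IHrq] _ _ _].
  by split; apply/permP => a; move: (IHp a) (IHq a); rewrite -!cats1 !count_cat /=; lia.
split; apply/permP => a; move: (IHlp a) (IHlq a) (IHrp a) (IHrq a);
rewrite -!cats1 ?count_cat /= ?count_cat /=; lia.
Qed.

Lemma tree_perm_sorted t V p q : tree_perm t V p q -> sorted ltn V.
Proof.
elim=> // {t V p q} r V p q m _ sV hm.
rewrite (sorted_pairwise ltn_trans) -cats1 pairwise_cat allrel1r -(sorted_pairwise ltn_trans) sV /= andbT.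
exact: hm.
Qed.

Lemma tree_perm_size t V p q : tree_perm t V p q -> size V = nodes t.
Proof.
elim=> // {t V p q} [r V p q m _ IH _|j l r A m1 B1 B2 m pl ql pr qr _ IHl _ IHr _ _ _].
  by rewrite size_rcons IH.
move: IHl IHr; rewrite /= !(size_cat, size_rcons) /= ?(size_cat, size_rcons); lia.
Qed.

Lemma tree_perm_uniq t V p q : tree_perm t V p q -> uniq V /\ uniq p /\ uniq q.
Proof.
move=> H; have [/perm_uniq -> /perm_uniq ->] := tree_perm_perm_eq H.
by have := sorted_uniq ltn_trans ltnn (tree_perm_sorted H).
Qed.

Lemma tree_perm_valid t V p q : tree_perm t V p q -> valid t.
Proof.
elim=> // {t V p q} [r V p q m _ IH _|j l r A m1 B1 B2 m pl ql pr qr Hl IHl _ IHr jr _ _] /=.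
  by rewrite IH leqnn eqxx.
by rewrite IHl IHr jr /=; case: (l) (tree_perm_size Hl) => //=; rewrite size_rcons.
Qed.

Lemma tree_perm_last t A m p q : tree_perm t (rcons A m) p q ->
  exists q', q = rcons q' m /\ perm_eq q' A.
Proof.
move EV: (rcons A m) => V H; have [_ pq] := tree_perm_perm_eq H.
have [q' Eq] : exists q', q = rcons q' m.
  case: H EV {pq} => [|r W p' q' m' _ _|j l r A' m1 B1 B2 m' pl ql pr qr _ _ _ _ _].
  - by case: (A).
  - by move=> /rcons_inj [_ ->]; exists q'.
  - by rewrite -rcons_cons -!rcons_cat => /rcons_inj [_ ->]; exists (ql ++ qr).
exists q'; split=> //; move: pq; rewrite Eq -EV -!cats1 perm_cat2r //.
Qed.

Lemma tree_perm_stack_sort t V p q : tree_perm t V p q -> q = stack_sort p.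
Proof.
elim=> // {t V p q} [r V p q m H IH hm|j l r A m1 B1 B2 m pl ql pr qr Hl IHl Hr IHr _ _ so].
  rewrite -[m :: p]cat0s stack_sort_cat ?IH ?cats1 //.
  by have [/perm_all -> _] := tree_perm_perm_eq H; apply: sub_all hm => x /= /ltnW.
have [_ _ _ _] := sorted_parts so; rewrite !all_cat /= => /and4P[hA hB1 hm1 hB2].
rewrite stack_sort_cat ?IHl ?IHr ?cats1 //.
  have [/perm_all -> _] := tree_perm_perm_eq Hl; by rewrite all_rcons /= hm1 hA.
have [/perm_all -> _] := tree_perm_perm_eq Hr; rewrite all_cat.
by apply/andP; split; [apply: sub_all hB1|apply: sub_all hB2] => x /= /ltnW.
Qed.

(** Sorting the two sides of a cut separately sorts the whole of [q], so the sorted list [V] is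
    divided at the same place. *)
Lemma cut_perm c q V : cut q c -> c <= size q -> perm_eq q V -> sorted ltn V ->
  perm_eq (take c q) (take c V) /\ perm_eq (drop c q) (drop c V).
Proof.
move=> cq cs pq sV; pose a := sort leq (take c q); pose b := sort leq (drop c q).
have EV : V = a ++ b.
  apply: (sorted_eq leq_trans anti_leq); first by apply: sub_sorted sV => x y /ltnW.
    rewrite (sorted_pairwise leq_trans) pairwise_cat -!(sorted_pairwise leq_trans).
    rewrite !sort_sorted ?andbT; try exact: leq_total.
    apply/allrelP => x y; rewrite !mem_sort => xa yb.
    by apply/ltnW/(allrelP cq).
  by rewrite -(permPl pq) -{1}(cat_take_drop c q); apply: perm_cat; rewrite perm_sym perm_sort.
have sa : size a = c by rewrite size_sort size_takel.
rewrite EV take_size_cat // drop_size_cat //.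
by split; rewrite perm_sym perm_sort.
Qed.

Lemma cut_cat A B c : allrel ltn A B -> c <= size (A ++ B) ->
  cut (A ++ B) c = if c <= size A then cut A c else cut B (c - size A).
Proof.
move=> hAB; rewrite size_cat => cs; rewrite /cut take_cat drop_cat.
case: (ltngtP c (size A)) => cA.
- rewrite allrel_catr; apply/andP/idP => [[] //|h]; split=> //.
  apply/allrelP => x y /mem_take xA yB; exact: (allrelP hAB).
- rewrite allrel_catl; apply/andP/idP => [[] //|h]; split=> //.
  apply/allrelP => x y xA /mem_drop yB; exact: (allrelP hAB).
- rewrite cA subnn take0 drop0 cats0 hAB take_size drop_size allrel0r //.
Qed.

(** A cut behind [m1] must come after all of [B1], whose entries are smaller than [m1]; this is the
    origin of the [drop] in [cuts]. *)
Lemma cut_block m1 B1 B2 c : all (gtn m1) B1 -> all (ltn m1) B2 ->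
  allrel ltn B1 B2 -> c <= size (B1 ++ B2) ->
  cut (m1 :: B1 ++ B2) c.+1 = (size B1 <= c) && cut (B1 ++ B2) c.
Proof.
move=> h1 h2 h12 cs; rewrite /cut [take _ _]/= [drop _ _]/= allrel_consl; congr andb.
rewrite drop_cat; case: ltnP => cB; last first.
  by apply/allP => x /mem_drop /(allP h2).
apply/negbTE/allPn; exists (nth 0 B1 c).
  by rewrite mem_cat; apply/orP; left; rewrite (drop_nth 0 cB) mem_head.
by rewrite -leqNgt ltnW //; apply: (allP h1); apply: mem_nth.
Qed.

Lemma cut0 s : cut s 0. Proof. by rewrite /cut take0. Qed.

Lemma cut_size s : cut s (size s).
Proof. by rewrite /cut take_size drop_size allrel0r. Qed.

Lemma filter_geq_nth s i : sorted ltn s -> i < size s ->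
  filter (leq (nth 0 s i)) s = drop i s.
Proof.
move=> ss si; rewrite -{2}(cat_take_drop i s) filter_cat.
have := ss; rewrite -{1}(cat_take_drop i s) (drop_nth 0 si) (sorted_pairwise ltn_trans).
rewrite pairwise_cat pairwise_cons allrel_consr => /and4P[/andP[h _] _ h' _].
rewrite (_ : filter _ (take i s) = [::]); last first.
  apply/eqP; rewrite -(negbK (_ == _)) -has_filter; apply/hasPn => x /(allP h).
  by rewrite -ltnNge.
by rewrite /= leqnn; congr cons; apply/all_filterP; apply: sub_all h' => x /= /ltnW.
Qed.

Lemma cut_positions_sorted s : sorted ltn (cut_positions s).
Proof. exact/(sorted_filter ltn_trans)/iota_ltn_sorted. Qed.

Lemma filter_iota_shift (a b : pred nat) n m :
  (forall c, c < m -> a (n + c) = b c) ->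
  filter a (iota n m) = [seq n + c | c <- filter b (iota 0 m)].
Proof.
move=> H; rewrite -{1}(addn0 n) iotaDl filter_map; congr map.
by apply: eq_in_filter => c; rewrite mem_iota add0n => /andP[_ /H].
Qed.

Lemma size_cuts t : valid t -> size (cuts t) = (fin_size t).+1.
Proof.
elim: t => // j l IHl r IHr /= /and4P[/IHl sl /IHr sr jr _].
rewrite !size_cat size_map size_drop size_takel ?sl // sr /=; lia.
Qed.

Lemma cut_positionsE s n : size s = n ->
  cut_positions s = filter (cut s) (iota 0 n) ++ [:: n].
Proof.
by move=> <-; rewrite /cut_positions -addn1 iotaD filter_cat add0n /= cut_size.
Qed.

Lemma cuts_node j l r : cuts (Node j l r) = take (fin_size l) (cuts l) ++
  [seq nodes l + c | c <- drop (fin_size r - j) (cuts r)] ++ [:: (nodes l + nodes r).+1].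
Proof. by []. Qed.

(** The cuts before [m1] are those of the left part except its last, the later ones are the cuts of
    the right part from [b1] on, shifted, followed by the end. The place just after [m1] is a cut
    only if [b1] is empty, and it is then counted as the cut 0 of the right part. *)
Lemma tree_perm_cuts t V p q : tree_perm t V p q -> cut_positions q = cuts t /\ avoids231 q.
Proof.
elim=> // {t V p q} [r V p q m H [IHc IHa] hm|j l r A m1 B1 B2 m pl ql pr qr Hl [IHlc IHla] Hr [IHrc IHra] jr sB so].
  have hq : all (gtn m) q by have [_ /perm_all ->] := tree_perm_perm_eq H.
  have sq : size q = nodes r by rewrite -(tree_perm_size H); have [_ /perm_size] := tree_perm_perm_eq H.
  split; last first.
    by rewrite -cats1 avoids231_cat ?IHa ?allrel1r.
  rewrite (@cut_positionsE _ (size q).+1) ?size_rcons // cuts_node subnn drop0 -IHc add0n -sq.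
  rewrite [take _ _]/= cat0s /cut_positions; congr (_ ++ _); apply: (@filter_iota_shift _ _ 0) => c cs.
  rewrite add0n -cats1 cut_cat ?allrel1r // ?size_cat ?addn1; last by lia.
  by rewrite (_ : c <= size q).
have [hAB hA hB1 hB2 hm] := sorted_parts so.
have [al [Eal pal]] := tree_perm_last Hl.
have [_ pqr] := tree_perm_perm_eq Hr.
have vl := tree_perm_valid Hl; have vr := tree_perm_valid Hr.
have sqr : size qr = nodes r by rewrite (perm_size pqr) (tree_perm_size Hr).
have sal : (size al).+1 = nodes l by rewrite (perm_size pal) -(tree_perm_size Hl) size_rcons.
have jc : fin_size r - j < size (cuts r) by rewrite size_cuts // ltnS leq_subr.
have : size B1 \in cuts r by rewrite sB; apply: mem_nth.
rewrite -IHrc mem_filter mem_iota add0n ltnS => /andP[cB /andP[_ sB']].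
have [pb1 pb2] := cut_perm cB sB' pqr (tree_perm_sorted Hr).
rewrite take_size_cat // in pb1; rewrite drop_size_cat // in pb2.
move: cB pb1 pb2; rewrite /cut; move: (take _ _) (drop _ _) (cat_take_drop (size B1) qr) => b1 b2 Eqr h12 pb1 pb2.
have hb1 : all (gtn m1) b1 by rewrite (perm_all _ pb1).
have hb2 : all (ltn m1) b2 by rewrite (perm_all _ pb2).
have sb1 : size b1 = size B1 := perm_size pb1.
have hal1 : allrel ltn al [:: m1].
  by rewrite allrel1r; rewrite -(perm_all _ pal) in hA.
have hal : allrel ltn al (m1 :: rcons qr m).
  move: hm; rewrite all_cat -(perm_all _ pal) => /andP[hm _].
  rewrite allrel_consr -cats1 allrel_catr allrel1r hm andbT; apply/andP; split.
    by rewrite allrel1r in hal1.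
  apply/allrelP => x y; rewrite (perm_mem pal) (perm_mem pqr) => xA yB; exact: (allrelP hAB).
have hqr : allrel ltn (m1 :: qr) [:: m].
  move: hm; rewrite allrel1r /= (perm_all _ pqr) !all_cat /= => /and4P[_ h1 h2 h3].
  by rewrite h1 h2 h3.
have EX : ql ++ rcons qr m = al ++ m1 :: rcons qr m by rewrite Eal cat_rcons.
split; last first.
  rewrite EX avoids231_cat //= -cats1 avoids231_cat ?IHra; last first.
    by move: hqr; rewrite allrel_consl => /andP[].
  rewrite -Eqr pairwise_cat !pairwise_cat /= !allrel1r.
  move: IHla; rewrite Eal -cats1 => /avoids231_catl ->; rewrite /= !andbT.
  apply/and4P; split; [| |exact: pairwise_below hb1|exact: pairwise_above hb2].
    have m1m : m1 < m by move: hqr; rewrite allrel_consl allrel1r => /andP[/andP[]].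
    by apply/allP => x _; rewrite ltnNge (ltnW m1m).
  by apply/allrelP => y z /(allP hb1) /= h _; rewrite negb_and -(leqNgt y) (ltnW h) orbT.
have sX : size (ql ++ rcons qr m) = nodes l + (nodes r).+1.
  by rewrite EX size_cat /= size_rcons -sal sqr addSn !addnS.
rewrite (cut_positionsE sX) cuts_node iotaD filter_cat -catA add0n addnS; congr (_ ++ (_ ++ _)).
- have El : cuts l = [seq c <- iota 0 (nodes l) | cut ql c] ++ [:: nodes l].
    by rewrite -IHlc; apply: cut_positionsE; rewrite Eal size_rcons.
  have := size_cuts vl; rewrite El size_cat addn1 => -[sl]; rewrite take_size_cat //.
  apply: eq_in_filter => c; rewrite mem_iota add0n -sal ltnS => /andP[_ cs].
  have le b : c <= size (al ++ b) by rewrite size_cat; apply: leq_trans cs (leq_addr _ _).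
  by rewrite EX Eal -(cats1 al) (cut_cat hal) // (cut_cat hal1) // cs.
rewrite -filter_geq_nth ?jc //; last by rewrite -IHrc; apply: cut_positions_sorted.
rewrite -sB -IHrc /cut_positions -filter_predI sqr; apply: filter_iota_shift => c cs.
have sal' : nodes l = (size al).+1 by rewrite sal.
rewrite EX cut_cat //; last first.
  by rewrite size_cat /= size_rcons; move: sal' sqr cs; clear; lia.
have -> : (nodes l + c <= size al) = false by move: sal'; clear; lia.
have -> : nodes l + c - size al = c.+1 by move: sal'; clear; lia.
rewrite -cats1 -cat_cons cut_cat //; last by rewrite size_cat /=; move: sqr cs; clear; lia.
have -> : c.+1 <= size (m1 :: qr) by rewrite /=; move: sqr cs; clear; lia.
rewrite -Eqr cut_block ?sb1 // Eqr; move: sqr cs; clear; lia.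
Qed.

Lemma tree_perm_exists t V : valid t -> sorted ltn V -> size V = nodes t ->
  exists p q, tree_perm t V p q.
Proof.
elim: t V => [|j l IHl r IHr] V.
  by case: V => // _ _ _; exists [::], [::]; apply: tree_perm_leaf.
rewrite /= => /and4P[vl vr jr jl] sV szV.
have sub U : subseq U V -> sorted ltn U by move=> h; apply: (subseq_sorted ltn_trans h).
case: (boolP (is_leaf l)) => ll.
  case: l ll {IHl vl} jl szV => //= _ /eqP -> szV.
  case/lastP: V sV szV sub => // V m sV; rewrite size_rcons => -[szV] sub.
  have [p [q H]] := IHr V vr (sub _ (subseq_rcons _ _)) szV.
  exists (m :: p), (rcons q m); apply: tree_perm_right => //.
  by move: sV; rewrite -cats1 (sorted_pairwise ltn_trans) pairwise_cat allrel1r => /and3P[].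
(* An auxiliary arrangement for [r]: it bounds the cut [c] by [nodes r] before [V] has been
   divided. *)
have [p0 [q0 H0]] := IHr (iota 0 (nodes r)) vr (iota_ltn_sorted _ _) (size_iota _ _).
pose c := nth 0 (cuts r) (fin_size r - j).
have cb : c <= nodes r.
  have : c \in cuts r by apply: mem_nth; rewrite size_cuts // ltnS leq_subr.
  have [<- _] := tree_perm_cuts H0; rewrite mem_filter mem_iota ltnS => /and3P[_ _].
  have [_ /perm_size ->] := tree_perm_perm_eq H0; by rewrite size_iota.
have lpos : 0 < nodes l by case: (l) ll.
pose A := take (nodes l).-1 V; pose W := drop (nodes l).-1 V.
have sA : size A = (nodes l).-1 by rewrite size_takel // szV; move: lpos; clear; lia.
have sW : size W = (nodes r).+2.
  by rewrite size_drop szV; move: lpos; clear; lia.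
have [B1 [m1 [B2 [m [EW sB1]]]]] : exists B1 m1 B2 m, W = B1 ++ m1 :: rcons B2 m /\ size B1 = c.
  exists (take c W), (nth 0 W c).
  have cW : c < size W by rewrite sW; move: cb; clear; lia.
  case/lastP E: (drop c.+1 W) => [|B2 m].
    move/(congr1 size): E; rewrite size_drop sW /=; move: cb; clear; lia.
  by exists B2, m; rewrite -E -(drop_nth 0 cW) cat_take_drop size_takel // ltnW.
have EV : V = A ++ B1 ++ m1 :: rcons B2 m by rewrite -EW cat_take_drop.
have [||pl [ql Hl]] := IHl (rcons A m1) vl.
- apply: sub; rewrite EV -cats1; apply: cat_subseq => //; rewrite sub1seq.
  by rewrite mem_cat mem_head orbT.
- by rewrite size_rcons sA prednK.
have [||pr [qr Hr]] := IHr (B1 ++ B2) vr.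
- apply: sub; rewrite EV; apply: (subseq_trans _ (suffix_subseq _ _)).
  by apply: cat_subseq => //; apply: (subseq_trans (subseq_rcons _ m) (subseq_cons _ _)).
- move: sW; rewrite EW !size_cat /= size_rcons; clear; lia.
rewrite EV in sV *.
by exists (pl ++ m :: pr), (ql ++ rcons qr m); apply: tree_perm_node.
Qed.

(** Avoidance of 231 with [m] in the role of the 2. *)
Lemma pairwise_split (m : nat) (s : seq nat) : m \notin s ->
  pairwise (fun y z => ~~ ((z < m) && (m < y))) s ->
  s = filter (gtn m) s ++ filter (ltn m) s.
Proof.
elim: s => //= y s IH; rewrite inE negb_or => /andP[my ms] /andP[hy /(IH ms) E].
case: (ltngtP y m) my => [ym|my|->] //= _; first by rewrite {1}E.
have -> : filter (gtn m) s = [::].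
  apply/eqP; rewrite -(negbK (_ == _)) -has_filter; apply/hasPn => z /(allP hy).
  by rewrite my andbT.
congr cons; apply/esym/all_filterP/allP => z zs; have := allP hy z zs.
rewrite my andbT -leqNgt leq_eqVlt => /orP[/eqP mz|//].
by rewrite mz zs in ms.
Qed.

(** Split [s] at its maximum. Avoidance passes to both sorted parts, puts all entries of the left
    one except its maximum [m1] below the right one, and makes the right one list its entries below
    [m1] before those above. This division is a cut, whose index gives [j]. *)
Lemma tree_perm_surj (s : seq nat) : uniq s -> avoids231 (stack_sort s) -> exists t V q, tree_perm t V s q.
Proof.
have [n] := ubnP (size s); elim: n s => // n IH s sn us.
have [-> _|/(split_max_uniq us) [a [m [b [Es ha hb]]]]] := eqVneq s [::].
  by exists Leaf, [::], [::]; apply: tree_perm_leaf.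
rewrite {}Es in us sn *; have hb' : all (geq m) b by apply: sub_all hb => x /= /ltnW.
rewrite stack_sort_cat // => av.
have uab : uniq (stack_sort a ++ stack_sort b ++ [:: m]).
  by rewrite -stack_sort_cat // (perm_uniq (perm_stack_sort _)).
move: (us); rewrite cat_uniq /= => /and3P[ua _ /andP[_ ub]].
move: sn; rewrite size_cat /= => sn.
have [|//||tr [Vb [qb Hb]]] := IH b; first by move: sn; clear; lia.
  exact: avoids231_catl (avoids231_catr av).
have [|//||tl [Va [qa Ha]]] := IH a; first by move: sn; clear; lia.
  exact: avoids231_catl av.
have Eb := tree_perm_stack_sort Hb; have Ea := tree_perm_stack_sort Ha.
have [pVa pqa] := tree_perm_perm_eq Ha; have [pVb pqb] := tree_perm_perm_eq Hb.
case/lastP: Va Ha pVa pqa => [|A m1] Ha pVa pqa.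
  have Ea0 : a = [::] by apply/perm_nilP.
  rewrite Ea0; exists (Node (fin_size tr) Leaf tr), (rcons Vb m), (rcons qb m).
  by apply: tree_perm_right => //; rewrite -(perm_all _ pVb).
have [al [Eal pal]] := tree_perm_last Ha.
rewrite -Ea -Eb Eal cat_rcons in av uab.
have hA : all (gtn m1) A.
  have := tree_perm_sorted Ha; rewrite -cats1 (sorted_pairwise ltn_trans) pairwise_cat allrel1r.
  by case/and3P.
have m1b : m1 \notin qb.
  move: uab; rewrite cat_uniq /= mem_cat => /and3P[_ _ /andP[]].
  by rewrite negb_or => /andP[].
have Aqb x z : x \in A -> z \in qb -> x < z.
  move=> xA zb; apply: (avoids231_mid av); rewrite ?(perm_mem pal) //.
  - by move: uab; rewrite -cat_rcons -cats1 -catA uniq_catCA cat_uniq => /and3P[].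
  - exact: (allP hA).
  - by rewrite mem_cat zb.
have Eqb : qb = filter (gtn m1) qb ++ filter (ltn m1) qb.
  apply: pairwise_split => //; have /= /andP[+ _] := avoids231_catr av.
  by rewrite pairwise_cat => /and3P[].
set b1 := filter (gtn m1) qb in Eqb; set b2 := filter (ltn m1) qb in Eqb.
have hb1 : all (gtn m1) b1 := filter_all _ _.
have hb2 : all (ltn m1) b2 := filter_all _ _.
have h12 : allrel ltn b1 b2.
  by apply/allrelP => x y /(allP hb1) /= h1 /(allP hb2) /= h2; apply: ltn_trans h1 h2.
have sb1 : size b1 <= size qb by rewrite Eqb size_cat leq_addr.
have cb : cut qb (size b1) by rewrite Eqb /cut take_size_cat // drop_size_cat.
have [pB1 pB2] := cut_perm cb sb1 pqb (tree_perm_sorted Hb).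
rewrite {1}Eqb take_size_cat // in pB1; rewrite {1}Eqb drop_size_cat // in pB2.
have [Ec _] := tree_perm_cuts Hb.
have : size b1 \in cuts tr by rewrite -Ec mem_filter cb mem_iota ltnS.
(* With [i] cuts before the chosen one, [fin_size tr - i] left-to-right maxima remain behind it. *)
move=> /(nthP 0) [i]; rewrite (size_cuts (tree_perm_valid Hb)) ltnS => il Ei.
exists (Node (fin_size tr - i) tl tr).
exists (A ++ take (size b1) Vb ++ m1 :: rcons (drop (size b1) Vb) m), (qa ++ rcons qb m).
have sVb : size b1 <= size Vb by rewrite -(perm_size pqb).
apply: tree_perm_node => //; rewrite ?cat_take_drop ?leq_subr //.
  by rewrite size_takel // subKn.
rewrite (sorted_pairwise ltn_trans) -cats1 pairwise_cat.
rewrite (pairwise_cat _ (take _ _)) pairwise_cons pairwise_cat.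
have := tree_perm_sorted Hb; rewrite -{1}(cat_take_drop (size b1) Vb) (sorted_pairwise ltn_trans).
rewrite pairwise_cat => /and3P[c12 -> ->].
have := tree_perm_sorted Ha; rewrite -cats1 (sorted_pairwise ltn_trans) pairwise_cat => /and3P[_ -> _].
have haA : all (gtn m) (rcons A m1) by rewrite -(perm_all _ pVa).
have hbV : all (gtn m) Vb by rewrite -(perm_all _ pVb).
move: haA; rewrite all_rcons /= => /andP[m1m hAm].
have /andP[hB1m hB2m] : all (gtn m) (take (size b1) Vb) && all (gtn m) (drop (size b1) Vb).
  by rewrite -all_cat cat_take_drop.
rewrite !allrel_catr !allrel_consr !allrel_catr !allrel1r !allrel0r hAm hB1m hB2m hA all_cat /= m1m.
rewrite -(perm_all _ pB1) hb1 -(perm_all _ pB2) hb2 c12 /= ?andbT; apply/andP; split.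
- by apply/allrelP => x y xA; rewrite -(perm_mem pB1) mem_filter => /andP[_]; apply: Aqb.
- by apply/allrelP => x y xA; rewrite -(perm_mem pB2) mem_filter => /andP[_]; apply: Aqb.
Qed.

Lemma max_split_inj (a b a' b' : seq nat) (m m' : nat) :
  all (gtn m) a -> all (gtn m) b -> all (gtn m') a' -> all (gtn m') b' ->
  a ++ m :: b = a' ++ m' :: b' -> [/\ a = a', m = m' & b = b'].
Proof.
move=> ha hb ha' hb' E.
have mm : m = m'.
  apply/eqP; rewrite eqn_leq; apply/andP; split.
    have : m \in a' ++ m' :: b' by rewrite -E mem_cat mem_head orbT.
    rewrite mem_cat inE => /or3P[/(allP ha')|/eqP ->|/(allP hb')] //= => /ltnW //.
  have : m' \in a ++ m :: b by rewrite E mem_cat mem_head orbT.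
  by rewrite mem_cat inE => /or3P[/(allP ha)|/eqP ->|/(allP hb)] //= => /ltnW.
subst m'; suff sa : size a = size a'.
  by move/eqP: E; rewrite eqseq_cat // => /andP[/eqP -> /eqP [->]].
have idx (u v : seq nat) : all (gtn m) u -> index m (u ++ m :: v) = size u.
  move=> hu; rewrite index_cat ifF /= ?eqxx ?addn0 //.
  by apply/negP => /(allP hu) /=; rewrite ltnn.
by rewrite -(idx a b) // E idx.
Qed.

(** The tree fixes the sizes of [A] and [B1], hence the division of [V]. *)
Lemma tree_perm_fun t V p q p' q' : tree_perm t V p q -> tree_perm t V p' q' -> p = p'.
Proof.
move=> H; elim: H p' q' => {t V p q} [|r V p q m H IH hm|j l r A m1 B1 B2 m pl ql pr qr Hl IHl Hr IHr jr sB so] p' q' H'.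
- by inversion H'.
- inversion H' as [|r0 V0 p0 q0 m0 H0 hm0 E1 E2|j0 l0 r0 A0 m10 B10 B20 m0 pl0 ql0 pr0 qr0 Hl0].
    by move/rcons_inj: E2 => [EV Em]; subst; rewrite (IH _ _ H0).
  by have := tree_perm_size Hl0; rewrite size_rcons.
- inversion H' as [|r0 V0 p0 q0 m0 H0 hm0 E1 E2|j0 l0 r0 A0 m10 B10 B20 m0 pl0 ql0 pr0 qr0 Hl0 Hr0 jr0 sB0 so0 E1 E2]; subst.
    by have := tree_perm_size Hl; rewrite size_rcons.
  have sA : size A0 = size A.
    by have := tree_perm_size Hl; rewrite -(tree_perm_size Hl0) !size_rcons => -[].
  move/eqP: E2; rewrite eqseq_cat // => /andP[/eqP EA].
  rewrite eqseq_cat ?sB ?sB0 // => /andP[/eqP EB /eqP [Em1 /rcons_inj [EB2 Em]]].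
  by subst; rewrite (IHl _ _ Hl0) (IHr _ _ Hr0).
Qed.

Lemma tree_perm_inv t V p q : tree_perm t V p q ->
  [\/ [/\ t = Leaf, V = [::] & p = [::]],
      exists r V' p' q' m, [/\ t = Node (fin_size r) Leaf r, tree_perm r V' p' q',
        all (gtn m) V' & p = m :: p']
    | exists j l r A m1 B1 B2 m pl, exists ql pr qr, [/\ t = Node j l r,
        [/\ tree_perm l (rcons A m1) pl ql & tree_perm r (B1 ++ B2) pr qr], p = pl ++ m :: pr,
        [/\ j <= fin_size r & size B1 = nth 0 (cuts r) (fin_size r - j)]
      & sorted ltn (A ++ B1 ++ m1 :: rcons B2 m)]].
Proof.
case=> [|r V' p' q' m H hm|j l r A m1 B1 B2 m pl ql pr qr Hl Hr jr sB so].
- by apply: Or31.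
- by apply: Or32; exists r, V', p', q', m.
- by apply: Or33; exists j, l, r, A, m1, B1, B2, m, pl, ql, pr, qr.
Qed.

(** The maximum splits [p], which gives both subtrees by induction. Then [m1] is the largest entry
    on the left, [size B1] counts the entries on the right below [m1], and this number determines
    [j] because the cuts are distinct. *)
Lemma tree_perm_unique t V p q t' V' q' : tree_perm t V p q -> tree_perm t' V' p q' -> t = t'.
Proof.
move=> H; elim: H t' V' q' => {t V p q} [|r V p q m H IH hm|j l r A m1 B1 B2 m pl ql pr qr Hl IHl Hr IHr jr sB so] t' V' q' H'.
- case: t' H' => // j l r H'; have [/perm_size + _] := tree_perm_perm_eq H'.
  by rewrite (tree_perm_size H').
- have hp : all (gtn m) p by have [/perm_all -> _] := tree_perm_perm_eq H.
  case: (tree_perm_inv H') => [[] //|[r0 [V0 [p0 [q0 [m0 [Et H0 hm0 [E1 E2]]]]]]]|].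
    by subst; rewrite (IH _ _ _ H0).
  move=> [j0 [l0 [r0 [A0 [m10 [B10 [B20 [m0 [pl0 [ql0 [pr0 [qr0 [Et [Hl0 Hr0] E2 _ so0]]]]]]]]]]]]].
  have [_ _ _ _] := sorted_parts so0; rewrite !all_cat /= => /and4P[hA hB1 hm1 hB2].
  have hl0 : all (gtn m0) pl0.
    by have [/perm_all -> _] := tree_perm_perm_eq Hl0; rewrite all_rcons /= hm1 hA.
  have hr0 : all (gtn m0) pr0.
    by have [/perm_all -> _] := tree_perm_perm_eq Hr0; rewrite all_cat hB1 hB2.
  have [El _ _] := max_split_inj (a := [::]) isT hp hl0 hr0 E2.
  by have [/perm_size] := tree_perm_perm_eq Hl0; rewrite -El size_rcons.
- have [_ _ hB1l hB2g] := sorted_parts so; rewrite !all_cat /= => /and4P[hA hB1 hm1 hB2].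
  have hl : all (gtn m) pl.
    by have [/perm_all -> _] := tree_perm_perm_eq Hl; rewrite all_rcons /= hm1 hA.
  have hr : all (gtn m) pr.
    by have [/perm_all -> _] := tree_perm_perm_eq Hr; rewrite all_cat hB1 hB2.
  case: (tree_perm_inv H') => [[_ _]|[r0 [V0 [p0 [q0 [m0 [Et H0 hm0 E2]]]]]]|].
  + by case: (pl).
  + have hp : all (gtn m0) p0 by have [/perm_all -> _] := tree_perm_perm_eq H0.
    have [El _ _] := max_split_inj (a := [::]) isT hp hl hr (esym E2).
    by have [/perm_size] := tree_perm_perm_eq Hl; rewrite -El size_rcons.
  move=> [j0 [l0 [r0 [A0 [m10 [B10 [B20 [m0 [pl0 [ql0 [pr0 [qr0 [Et [Hl0 Hr0] E2 [jr0 sB0] so0]]]]]]]]]]]]].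
  have [_ _ hB1l0 hB2g0] := sorted_parts so0; rewrite !all_cat /= => /and4P[hA0 hB10 hm10 hB20].
  have hl0 : all (gtn m0) pl0.
    by have [/perm_all -> _] := tree_perm_perm_eq Hl0; rewrite all_rcons /= hm10 hA0.
  have hr0 : all (gtn m0) pr0.
    by have [/perm_all -> _] := tree_perm_perm_eq Hr0; rewrite all_cat hB10 hB20.
  have [El _ Er] := max_split_inj hl hr hl0 hr0 E2; subst pl0 pr0.
  have El := IHl _ _ _ Hl0; have Er := IHr _ _ _ Hr0; subst l0 r0; rewrite Et.
  have /rcons_inj [_ Em1] : rcons A m1 = rcons A0 m10.
    apply: (sorted_eq leq_trans anti_leq).
    - by apply: sub_sorted (tree_perm_sorted Hl) => x y /ltnW.
    - by apply: sub_sorted (tree_perm_sorted Hl0) => x y /ltnW.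
    by have [p1 _] := tree_perm_perm_eq Hl; have [p2 _] := tree_perm_perm_eq Hl0; rewrite -(permPl p1).
  subst m10.
  have cnt (C1 C2 : seq nat) : perm_eq pr (C1 ++ C2) -> all (gtn m1) C1 -> all (ltn m1) C2 ->
      size C1 = count (gtn m1) pr.
    move=> /permP -> h1 h2; rewrite count_cat.
    have -> : count (gtn m1) C2 = 0.
      by apply/eqP; rewrite -leqn0 leqNgt -has_count; apply/hasPn => x /(allP h2) /= ?; rewrite -leqNgt ltnW.
    by move: h1; rewrite all_count => /eqP ->; rewrite addn0.
  have sBB : nth 0 (cuts r) (fin_size r - j) = nth 0 (cuts r) (fin_size r - j0).
    rewrite -sB -sB0 (cnt B1 B2) ?(cnt B10 B20) //.
      by have [] := tree_perm_perm_eq Hr0.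
    by have [] := tree_perm_perm_eq Hr.
  have uc : uniq (cuts r).
    by have [<- _] := tree_perm_cuts Hr; apply: (sorted_uniq ltn_trans ltnn); apply: cut_positions_sorted.
  move/eqP: sBB; rewrite nth_uniq ?(size_cuts (tree_perm_valid Hr)) ?ltnS ?leq_subr // => /eqP jj.
  by congr Node; move: jj jr jr0; clear; lia.
Qed.

(** * Statistics of the permutations read off the trees *)

Lemma ascentsE s : ascents s = steps ltn s.
Proof. exact: count_steps. Qed.

Lemma descentsE s : descents s = steps (fun x y => y < x) s.
Proof. exact: count_steps. Qed.

Lemma tree_perm_nil t V p q : tree_perm t V p q -> (p == [::]) = is_leaf t.
Proof.
move=> H; have [/perm_size + _] := tree_perm_perm_eq H; rewrite (tree_perm_size H).
by case: t H => [|j l r] _; case: p.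
Qed.

(** The maximum closes an ascent if its left part is nonempty and opens a descent if its right part
    is; all other steps lie inside the parts. *)
Lemma tree_perm_ascents t V p q : tree_perm t V p q -> ascents p = asc_count t.
Proof.
move=> H; rewrite ascentsE; elim: H => {t V p q} [|r V p q m H IH hm|j l r A m1 B1 B2 m pl ql pr qr Hl IHl Hr IHr _ _ so] //.
  have hp : all (gtn m) p by have [/perm_all -> _] := tree_perm_perm_eq H.
  rewrite /= IH !addn0 add0n; case: (p) hp => [|x p'] //= /andP[xm _].
  by rewrite ltnNge (ltnW xm).
have [_ _ _ _] := sorted_parts so; rewrite !all_cat /= => /and4P[hA hB1 hm1 hB2].
have hl : all (gtn m) pl.
  by have [/perm_all -> _] := tree_perm_perm_eq Hl; rewrite all_rcons /= hm1 hA.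
have hr : all (gtn m) pr.
  by have [/perm_all -> _] := tree_perm_perm_eq Hr; rewrite all_cat hB1 hB2.
rewrite steps_max IHl IHr [asc_count _]/= -(tree_perm_nil Hl).
have -> : (if pr is y :: _ then ltn m y else false) = false.
  by case: (pr) hr => [|y s] //= /andP[ym _]; rewrite ltnNge (ltnW ym).
rewrite addn0; congr (_ + nat_of_bool _); case: (pl) hl => [|y s] // hy /=.
by apply: (allP hy); apply: mem_last.
Qed.

Lemma tree_perm_descents t V p q : tree_perm t V p q -> descents p = des_count t.
Proof.
move=> H; rewrite descentsE; elim: H => {t V p q} [|r V p q m H IH hm|j l r A m1 B1 B2 m pl ql pr qr Hl IHl Hr IHr _ _ so] //.
  have hp : all (gtn m) p by have [/perm_all -> _] := tree_perm_perm_eq H.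
  rewrite /= IH -(tree_perm_nil H) add0n addnC; congr (_ + nat_of_bool _).
  by case: (p) hp => [|x p'] //= /andP[].
have [_ _ _ _] := sorted_parts so; rewrite !all_cat /= => /and4P[hA hB1 hm1 hB2].
have hl : all (gtn m) pl.
  by have [/perm_all -> _] := tree_perm_perm_eq Hl; rewrite all_rcons /= hm1 hA.
have hr : all (gtn m) pr.
  by have [/perm_all -> _] := tree_perm_perm_eq Hr; rewrite all_cat hB1 hB2.
rewrite steps_max IHl IHr [des_count _]/= -(tree_perm_nil Hr).
have -> : (if pl is y :: a' then m < last y a' else false) = false.
  case: (pl) hl => [|y s] // hy; apply/negbTE; rewrite -leqNgt ltnW //.
  by apply: (allP hy); apply: mem_last.
rewrite addn0; congr (_ + nat_of_bool _); case: (pr) hr => [|y s] //.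
by case/andP.
Qed.

Lemma tree_perm_ltr_maxima t V p q : tree_perm t V p q -> ltr_maxima q = fin_size t.
Proof.
move=> H; have [Ec av] := tree_perm_cuts H; have [_ [_ uq]] := tree_perm_uniq H.
by apply: succn_inj; rewrite ltr_maxima_cuts // Ec size_cuts // (tree_perm_valid H).
Qed.

Lemma uniq_catl (T : eqType) (a b : seq T) : uniq (a ++ b) -> uniq a.
Proof. by rewrite cat_uniq => /andP[]. Qed.

Definition precedes (q : seq nat) : rel nat := fun x y => index y q < index x q.

(** Each value from 2 on is paired with its predecessor in the list of values; the value 1
    contributes nothing because 0 does not occur in [q]. *)
Lemma precedes_pred_countE n q : perm_eq q (iota 1 n) ->
  precedes_pred_count q = steps (precedes q) (iota 1 n).
Proof.
move=> pq; rewrite -count_steps size_iota /precedes_pred_count.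
have /permP -> := pq; case: n pq => [|n] pq //.
have E : iota 1 n.+1 = 1 :: [seq 2 + i | i <- iota 0 n] by rewrite -iotaDl.
rewrite {1}E [count _ (_ :: _)]/= (perm_mem pq) mem_iota [_ && _]/= add0n count_map.
apply: eq_in_count => i; rewrite mem_iota add0n => /andP[_ ilt].
have ilt1 : i < n := ilt.
rewrite [preim _ _ _]/= /precedes (nth_iota _ _ (ltnW (ilt1 : i.+1 < n.+1))) (nth_iota _ _ (ilt1 : i.+1 < n.+1)).
rewrite (perm_mem pq) mem_iota; have -> : 2 + i - 1 = 1 + i by lia.
have -> : 1 + i.+1 = 2 + i by lia.
by have -> : (0 < 1 + i < 1 + n.+1) by lia.
Qed.

Lemma eq_in_steps (r1 r2 : rel nat) s : {in s &, r1 =2 r2} -> steps r1 s = steps r2 s.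
Proof.
elim: s => // x s IH H /=; rewrite IH; last first.
  by move=> y z ys zs; apply: H; rewrite inE ?ys ?zs orbT.
by case: s H {IH} => // y s H; rewrite H // !inE eqxx ?orbT.
Qed.

Lemma steps_cat_false r a b : (forall x y, x \in a -> y \in b -> r x y = false) ->
  steps r (a ++ b) = steps r a + steps r b.
Proof.
case: b => [|x b] H; first by rewrite cats0 addn0.
rewrite steps_cat; case: a H => [|y a] H; first by rewrite addn0.
by rewrite H ?addn0 ?mem_last ?mem_head.
Qed.

Lemma precedes_cat q1 q q3 : uniq (q1 ++ q) ->
  {in q &, precedes (q1 ++ q ++ q3) =2 precedes q}.
Proof.
rewrite cat_uniq => /and3P[_ /hasPn h _] x y xq yq; rewrite /precedes !index_cat.
by rewrite (negPf (h _ xq)) (negPf (h _ yq)) xq yq ltn_add2l.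
Qed.

Lemma precedes_cat_false q1 q2 x y : uniq (q1 ++ q2) -> x \in q1 -> y \in q2 ->
  precedes (q1 ++ q2) x y = false.
Proof.
rewrite cat_uniq => /and3P[_ /hasPn h _] xq yq; rewrite /precedes !index_cat.
rewrite (negPf (h _ yq)) xq; apply/negbTE; rewrite -leqNgt.
by apply: leq_trans (leq_addr _ _); apply: index_size.
Qed.

Lemma precedes_cat_true q1 q2 x y : uniq (q1 ++ q2) -> x \in q2 -> y \in q1 ->
  precedes (q1 ++ q2) x y.
Proof.
rewrite cat_uniq => /and3P[_ /hasPn h _] xq yq; rewrite /precedes !index_cat.
rewrite (negPf (h _ xq)) yq; apply: leq_trans (leq_addr _ _).
by rewrite index_mem.
Qed.

(** The values run through [A], [B1], [m1], [B2], [m], while [q] runs through [a], [m1], [b1], [b2],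
    [m]. Separating [B1] from [B2] loses no reversed pair, as [b1] precedes [b2]. The only new one
    consists of [m1] and the last value of [B1], if [B1] is nonempty. *)
Lemma tree_perm_cross t V p q : tree_perm t V p q -> steps (precedes q) V = cross_count t.
Proof.
move=> H; elim: (H) => {t V p q H} [|r V p q m H IH hm|j l r A m1 B1 B2 m pl ql pr qr Hl IHl Hr IHr jr sB so] //.
  have [_ pq] := tree_perm_perm_eq H.
  have uq : uniq (q ++ [:: m]).
    have [_ [_ uq]] := tree_perm_uniq (tree_perm_right H hm); by rewrite cats1.
  rewrite -!cats1 steps_cat_false /=; last first.
    by move=> x y xV ym; rewrite precedes_cat_false // (perm_mem pq).
  rewrite ltnn !addn0 add0n -IH; apply: eq_in_steps => x y xV yV.
  have := @precedes_cat [::] q [:: m]; rewrite /= => -> //; rewrite ?(perm_mem pq) //.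
  exact: uniq_catl uq.
have HN := tree_perm_node Hl Hr jr sB so.
have [_ [_ uQ]] := tree_perm_uniq HN.
have [al [Eal pal]] := tree_perm_last Hl; have [_ pqr] := tree_perm_perm_eq Hr.
have [Ec _] := tree_perm_cuts Hr; have vr := tree_perm_valid Hr.
have jc : fin_size r - j < size (cuts r) by rewrite size_cuts // ltnS leq_subr.
have : size B1 \in cuts r by rewrite sB; apply: mem_nth.
rewrite -Ec mem_filter mem_iota add0n ltnS => /andP[cB /andP[_ sB']].
have [pb1 pb2] := cut_perm cB sB' pqr (tree_perm_sorted Hr).
rewrite take_size_cat // in pb1; rewrite drop_size_cat // in pb2.
have Eqr := cat_take_drop (size B1) qr.
set b1 := take _ qr in pb1 Eqr; set b2 := drop _ qr in pb2 Eqr.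
have uX : uniq (al ++ [:: m1] ++ b1 ++ b2 ++ [:: m]).
  by move: uQ; rewrite Eal -Eqr cat_rcons -cats1 -!catA.
have EX : ql ++ rcons qr m = al ++ [:: m1] ++ b1 ++ b2 ++ [:: m].
  by rewrite Eal -Eqr cat_rcons -cats1 -!catA.
rewrite EX; set X := al ++ _.
have sA : steps (precedes X) A = cross_count l.
  rewrite -IHl -cats1 steps_cat_false /=; last first.
    move=> x y xA ym; rewrite Eal -cats1 precedes_cat_false ?(perm_mem pal) //.
    by move: uX; rewrite catA => /uniq_catl.
  rewrite !addn0; apply: eq_in_steps => x y xA yA.
  rewrite -(perm_mem pal) in xA; rewrite -(perm_mem pal) in yA.
  have ual := uniq_catl uX.
  have e1 := @precedes_cat [::] al ([:: m1] ++ b1 ++ b2 ++ [:: m]) ual x y xA yA.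
  have e2 := @precedes_cat [::] al [:: m1] ual x y xA yA.
  by rewrite /X; move: e1 e2; rewrite /= Eal -cats1 => -> ->.
have sBB : steps (precedes X) B1 + steps (precedes X) B2 = cross_count r.
  have uqr : uniq (b1 ++ b2) by have [_ [_]] := tree_perm_uniq Hr; rewrite Eqr.
  rewrite -IHr steps_cat_false /=; last first.
    by move=> x y xB yB; rewrite -Eqr precedes_cat_false ?(perm_mem pb1) ?(perm_mem pb2).
  have un : uniq ((al ++ [:: m1]) ++ (b1 ++ b2)).
    by apply: (@uniq_catl _ _ [:: m]); rewrite -!catA.
  have eX : X = (al ++ [:: m1]) ++ (b1 ++ b2) ++ [:: m] by rewrite /X -!catA.
  congr addn; apply: eq_in_steps => x y xB yB; rewrite eX (precedes_cat _ un) ?Eqr //;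
  by rewrite (perm_mem pqr) mem_cat ?xB ?yB ?orbT.
have -> : A ++ B1 ++ m1 :: rcons B2 m = A ++ (B1 ++ ([:: m1] ++ (B2 ++ [:: m]))).
  by rewrite /= cats1.
rewrite steps_cat_false; last first.
  move=> x y xA yB; rewrite /X precedes_cat_false ?(perm_mem pal) //.
  move: yB; rewrite !mem_cat !inE -(perm_mem pb1) -(perm_mem pb2).
  by do ?case/orP=> [->|]; rewrite ?orbT // => ->; rewrite ?orbT.
have uX1 : uniq ((al ++ [:: m1]) ++ (b1 ++ b2 ++ [:: m])) by rewrite -catA.
have EX1 : X = (al ++ [:: m1]) ++ (b1 ++ b2 ++ [:: m]) by rewrite /X -catA.
have sm : steps (precedes X) ([:: m1] ++ B2 ++ [:: m]) = steps (precedes X) B2.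
  rewrite steps_cat_false; last first.
    move=> x y xm yB; rewrite EX1 precedes_cat_false // ?mem_cat ?xm ?orbT //.
    by move: yB; rewrite !mem_cat -(perm_mem pb2) => /orP[] ->; rewrite ?orbT.
  rewrite steps_cat_false /= ?addn0 //.
  have uX2 : uniq ((al ++ [:: m1] ++ b1 ++ b2) ++ [:: m]) by rewrite -!catA.
  have EX2 : X = (al ++ [:: m1] ++ b1 ++ b2) ++ [:: m] by rewrite /X -!catA.
  move=> x y xB ym; rewrite EX2 precedes_cat_false //.
  by rewrite !mem_cat (perm_mem pb2) xB !orbT.
rewrite steps_cat -[m1 :: _]/([:: m1] ++ _) sm.
have -> : (if B1 is y :: a' then precedes X (last y a') m1 else false) = (0 < size B1).
  case EB: B1 => [|y a'] //=; rewrite EX1 precedes_cat_true //.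
    by rewrite !mem_cat (perm_mem pb1) EB mem_last.
  by rewrite mem_cat mem_head orbT.
rewrite sA addnA sBB -addnA addnA /= sB; congr (_ + nat_of_bool _).
(* The first cut is 0 and the cuts strictly increase, so [B1] is empty exactly when its cut is the
   first one, that is for [j = fin_size r]. *)
have c0 : nth 0 (cuts r) 0 = 0 by rewrite -Ec /cut_positions /= cut0.
have [->|jf] := eqVneq j (fin_size r); first by rewrite subnn c0 !ltnn.
rewrite (ltn_neqAle j) jf jr.
have jf0 : 0 < fin_size r - j by rewrite subn_gt0 ltn_neqAle jf.
apply: leq_ltn_trans (leq0n (nth 0 (cuts r) 0)) _.
have cs : sorted ltn (cuts r) by rewrite -Ec; apply: cut_positions_sorted.
by apply: (sorted_ltn_nth ltn_trans 0 cs) => //; rewrite inE (leq_ltn_trans _ jc).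
Qed.

(** * The bijection *)

Lemma tss_tree s : two_stack_sortable s ->
  exists t, tree_perm t (iota 1 (size s)) s (stack_sort s) /\ ~~ is_leaf t.
Proof.
move=> /and3P[s0 ps /eqP ss].
have us : uniq s by rewrite (perm_uniq ps) iota_uniq.
have uS : uniq (stack_sort s) by rewrite (perm_uniq (perm_stack_sort s)).
have [|t [V [q H]]] := tree_perm_surj us.
  by rewrite -sorted_stack_sort // ss iota_ltn_sorted.
have EV : V = iota 1 (size s).
  apply: (sorted_eq leq_trans anti_leq).
  - by apply: sub_sorted (tree_perm_sorted H) => x y /ltnW.
  - exact: iota_sorted.
  - by have [pV _] := tree_perm_perm_eq H; rewrite -(permPl pV).
exists t; rewrite -EV -(tree_perm_stack_sort H); split=> //.
by rewrite -(tree_perm_nil H); case: (s) s0.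
Qed.

Lemma tree_tss t : valid t -> ~~ is_leaf t -> exists s,
  two_stack_sortable s /\ tree_perm t (iota 1 (size s)) s (stack_sort s).
Proof.
move=> vt nl; have [s [q H]] := tree_perm_exists vt (iota_ltn_sorted 1 (nodes t)) (size_iota _ _).
have [ps pq] := tree_perm_perm_eq H; have [_ av] := tree_perm_cuts H; have [_ [us uq]] := tree_perm_uniq H.
have sz : size s = nodes t by rewrite (perm_size ps) size_iota.
exists s; rewrite sz -(tree_perm_stack_sort H); split=> //.
apply/and3P; split; [by rewrite sz; case: (t) nl|by rewrite /is_perm_seq sz|].
apply/eqP; rewrite sz -(tree_perm_stack_sort H).
apply: (sorted_eq leq_trans anti_leq); last first.
- by rewrite (perm_trans (perm_stack_sort q)).
- exact: iota_sorted.
apply: (@sub_sorted _ ltn) => [x y /ltnW //|].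
by rewrite sorted_stack_sort.
Qed.

(** Every node except the root is a left child, counted by [asc_count], or a right child, counted by
    [des_count]. *)
Lemma asc_des_nodes t : asc_count t + des_count t + ~~ is_leaf t = nodes t.
Proof. elim: t => //= j l IHl r IHr; lia. Qed.

(** A relation rather than a function: the tree determines the fish only up to isomorphism, and
    [functional_choice] picks a representative in the end. *)
Definition fish_of (p : TSS) (F : FishData) : Prop :=
  let s := val p in
  fish_gen F /\ exists t lam l X, [/\ tree_perm t (iota 1 (size s)) s (stack_sort s) /\ ~~ is_leaf t,
    @labelled F lam X, growth l X & kinds l = closed_word t].

Lemma fish_of_exists p : exists F, fish_of p F.
Proof.
have [t [Ht nl]] := tss_tree (valP p).
have [l [X [G El]]] := fishword_growth (fishword_closed (tree_perm_valid Ht) nl).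
have [F [lam [Fg L]]] := growth_fish_gen G.
by exists F; split=> //; exists t, lam, l, X.
Qed.

Lemma fish_of_inj p q F G : fish_of p F -> fish_of q G -> fish_iso F G -> p = q.
Proof.
move=> [_ [t [lam [l [X [[Ht _] L Gr El]]]]]] [_ [t' [lam' [l' [X' [[Ht' _] L' Gr' El']]]]]] iso.
have := iso_kinds L Gr L' Gr' iso; rewrite El El' => E.
have Et := closed_word_inj (tree_perm_valid Ht) (tree_perm_valid Ht') E; subst t'.
have sz : size (val q) = size (val p).
  by move: (tree_perm_size Ht) (tree_perm_size Ht'); rewrite !size_iota => -> ->.
by rewrite sz in Ht'; apply/val_inj/(tree_perm_fun Ht Ht').
Qed.

Lemma fish_iso_trans F G H : fish_iso F G -> fish_iso G H -> fish_iso F H.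
Proof.
move=> [f [bf fh fu fd]] [g [bg gh gu gd]]; exists (g \o f); split.
- exact: bij_comp.
- by rewrite /= fh.
- by move=> x; rewrite /= gu fu; case: (fur F x).
- by move=> x; rewrite /= gd fd; case: (fdr F x).
Qed.

Lemma fish_iso_refl F : fish_iso F F.
Proof.
exists id; split=> //; first by exists id.
- by move=> x; case: (fur F x).
- by move=> x; case: (fdr F x).
Qed.

(** The conclusion covers every [G] related to [p], so it applies to whichever representative is
    chosen. *)
Lemma fish_of_onto F : fighting_fish F ->
  exists p, forall G, fish_of p G -> fish_iso G F.
Proof.
move=> [G [Gg iso]]; have [lam [l [X [L Gr]]]] := fish_gen_growth Gg.
have [t [vt nl Et]] := fishword_tree (growth_fishword Gr).
have [s [ts Hs]] := tree_tss vt nl.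
exists (exist _ s ts) => G' [_ [t' [lam' [l' [X' [[Ht' _] L' Gr' El']]]]]].
have Ett := tree_perm_unique Ht' Hs; subst t'.
have [_ EX] := growth_kinds_inj Gr' Gr (etrans El' Et).
exact: fish_iso_trans (labelled_iso L' L EX) iso.
Qed.

Theorem theorem1 :
  exists phi : TSS -> FishData,
    [/\ forall p, fighting_fish (phi p),
        forall p q, fish_iso (phi p) (phi q) -> p = q,
        forall F, fighting_fish F -> exists p, fish_iso (phi p) F
      & forall p : TSS,
          let s := val p in
          [/\ lower_free (phi p) = (size s).+1,
              left_lower_free (phi p) = (ascents s).+1,
              right_lower_free (phi p) = (descents s).+1,
              fin_length (phi p) (ltr_maxima (stack_sort s)).+1
            & tails (phi p) = (precedes_pred_count (stack_sort s)).+1]].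
Proof.
have [phi phiP] := functional_choice _ fish_of_exists.
exists phi; split.
- by move=> p; have [Fg _] := phiP p; exists (phi p); split; last exact: fish_iso_refl.
- by move=> p q; apply: fish_of_inj.
- by move=> F /fish_of_onto [p H]; exists p; apply: H.
move=> p; have [_ [t [lam [l [X [[Ht nl] L G El]]]]]] := phiP p.
set s := val p in Ht *; have vt := tree_perm_valid Ht.
have ll : left_lower_free (phi p) = (ascents s).+1.
  by rewrite (left_lower_free_count L G) El (nLL_word t).1 (tree_perm_ascents Ht).
have rl : right_lower_free (phi p) = (descents s).+1.
  by rewrite (right_lower_free_count L G) El (nLR_word t).1 nl addn1 (tree_perm_descents Ht).
split=> //.
- rewrite /lower_free ll rl addSn addnS (tree_perm_ascents Ht) (tree_perm_descents Ht).
  by have := asc_des_nodes t; rewrite -(tree_perm_size Ht) size_iota nl addn1 => ->.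
- have [f [g [Ew Lf sf]]] := closed_word_fin vt.
  rewrite (tree_perm_ltr_maxima Ht) -sf; apply: (fin_length_kinds L G _ Lf).
  by rewrite El Ew.
- rewrite (tails_count L G) El (peaks_word vt).1 nl addn1.
  have [_ pq] := tree_perm_perm_eq Ht.
  by rewrite (precedes_pred_countE pq) (tree_perm_cross Ht).
Qed.
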